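(* Let $T$ be a tree with at least three vertices. Then the following properties are equivalent: (1) The domination subdivision number of $T$ equals $3$. (2) $T$ has a unique dominating $2$-packing containing all leaves of $T$. (3) $T$ belongs to the family $\mathcal{F}$ (with some labeling). (4) $T$ is (isomorphic to) a general corona $T'\circ\mathcal{P}$ of some tree $T'$. (5) There exists a tree $T'$ such that $T$ is obtained from the $2$-subdivision $S_2(T')$ by a sequence of internal contractions. (6) There exists a tree $T'$ such that $T$ is obtained from the corona $T'\circ K_1$ by a sequence of internal splittings.
   Context: Domination: a set $D$ is dominating if every vertex outside $D$ has a neighbor in $D$; $\gamma(G)$ is the minimum size of a dominating set. Subdividing an edge $uv$ replaces it by a path $u,x,v$ with a new vertex $x$. The domination subdivision number of a connected graph of order at least $3$ is the minimum number of edges that must be subdivided (each at most once) so that the domination number increases. A $2$-packing is a vertex set any two distinct members of which are at distance greater than $2$; a leaf is a vertex of degree $1$. The family $\mathcal{F}$ consists of trees whose vertices carry labels in $\{A,B\}$, defined as the smallest family that contains the path $P_4$ with its two leaves labeled $A$ and its two support vertices labeled $B$, and is closed under the operations: for a tree in $\mathcal{F}$ and a vertex $v$ of it, if $v$ has label $A$, attach a new path $x,y,z$ with labels $B,B,A$ by adding the edge $vx$; if $v$ has label $B$, attach a new path $x,y$ with labels $B,A$ by adding the edge $vx$. General corona: for a graph $T'$, a vertex neighborhood partition is a family $\mathcal{P}=\{\mathcal{P}(v): v\in V(T')\}$ where each $\mathcal{P}(v)$ is a partition of $N_{T'}(v)$ into nonempty parts; $T'\circ\mathcal{P}$ has vertex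 set $\{(v,1): v\in V(T')\}\cup\bigcup_{v}\{(v,A): A\in\mathcal{P}(v)\}$ and edge set $\bigcup_{v}\{(v,1)(v,A): A\in\mathcal{P}(v)\}\cup\bigcup_{uv\in E(T')}\{(v,A)(u,B): u\in A,\ v\in B\}$. Vertices $(v,1)$ are external; the vertices $(v,A)$ are internal. With $\mathcal{P}(v)=\{N_{T'}(v)\}$ for all $v$ one gets the corona $T'\circ K_1$ (one pendant vertex attached to each vertex of $T'$); with $\mathcal{P}(v)=\{\{u\}: u\in N_{T'}(v)\}$ for all $v$ one gets the $2$-subdivision $S_2(T')$ (each edge $uv$ replaced by a path $u,x_1,x_2,v$). An internal contraction of $T'\circ\mathcal{P}$ merges two internal vertices $(v,A),(v,B)$, $A\ne B\in\mathcal{P}(v)$, into one vertex adjacent to all neighbors of either, producing $T'\circ\mathcal{P}'$ with $\mathcal{P}'(v)=(\mathcal{P}(v)\setminus\{A,B\})\cup\{A\cup B\}$ and $\mathcal{P}'(x)=\mathcal{P}(x)$ for $x\neq v$; an internal splitting is the reverse operation. *)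

(* Defs.v *)
From mathcomp Require Import all_boot.

Set Implicit Arguments.
Unset Strict Implicit.
Unset Printing Implicit Defensive.

Record sgraph := SGraph {
  svertex :> finType;
  adj : rel svertex;
  adj_sym : symmetric adj;
  adj_irrefl : irreflexive adj }.

Arguments adj {s}.
Notation "x -- y" := (adj x y) (at level 30, no associativity).

Definition giso (G H : sgraph) : Prop :=
  exists f : G -> H, bijective f /\ forall x y, (f x -- f y) = (x -- y).

Section Basics.
Variable G : sgraph.

Definition nbhd (v : G) : {set G} := [set u | v -- u].

Definition leaves : {set G} := [set v | #|nbhd v| == 1].

Definition edges : {set {set G}} :=
  [set [set p.1; p.2] | p : G * G & p.1 -- p.2].

Definition connected : Prop := 0 < #|G| /\ forall x y : G, connect adj x y.

(* [cycle adj [:: x; y]] holds as soon as x -- y, hence the length bound. *)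
Definition acyclic : Prop :=
  forall s : seq G, 2 < size s -> ~~ (cycle adj s && uniq s).

Definition is_tree : Prop := connected /\ acyclic.

(* The least length of a path from x to y; the junk value #|G|, larger than any
   distance, when there is none. *)
Definition dist (x y : G) : nat :=
  find (fun n => [exists p : n.-tuple G, path adj x p && (last x p == y)])
       (iota 0 #|G|).

Definition dominating (D : {set G}) : bool :=
  [forall (v | v \notin D), exists u in D, v -- u].

Definition gamma : nat := #|[arg min_(D < [set: G] | dominating D) #|D|]|.

Definition two_packing (D : {set G}) : bool :=
  [forall x in D, forall y in D, (x != y) ==> (2 < dist x y)].

End Basics.

Section Subdivide.
Variables (G : sgraph) (F : {set {set G}}).

(* [inr E] is the vertex subdividing the edge E of F. *)
Definition subdivide_adj (a b : G + {E : {set G} | E \in F}) : bool :=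
  match a, b with
  | inl x, inl y => (x -- y) && ([set x; y] \notin F)
  | inl x, inr E => x \in val E
  | inr E, inl x => x \in val E
  | inr _, inr _ => false
  end.

Lemma subdivide_sym : symmetric subdivide_adj.
Proof. by move=> [x|E] [y|E'] //=; rewrite adj_sym setUC. Qed.

Lemma subdivide_irrefl : irreflexive subdivide_adj.
Proof. by move=> [x|E] //=; rewrite adj_irrefl. Qed.

Definition subdivide : sgraph := SGraph subdivide_sym subdivide_irrefl.

End Subdivide.

Definition subdivision_increases (G : sgraph) (F : {set {set G}}) : Prop :=
  F \subset edges G /\ gamma G < gamma (subdivide F).

Definition domination_subdivision_number (G : sgraph) (k : nat) : Prop :=
  (exists F : {set {set G}}, subdivision_increases F /\ #|F| = k) /\
  (forall F : {set {set G}}, subdivision_increases F -> k <= #|F|).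

Inductive label := LA | LB.

Definition consecutive n (i j : 'I_n) : bool :=
  (i.+1 == j :> nat) || (j.+1 == i :> nat).

Lemma consecutive_sym n : symmetric (@consecutive n).
Proof. by move=> i j; rewrite /consecutive orbC. Qed.

Lemma consecutive_irrefl n : irreflexive (@consecutive n).
Proof. by move=> i; rewrite /consecutive orbb gtn_eqF. Qed.

Definition path_graph (n : nat) : sgraph :=
  SGraph (@consecutive_sym n) (@consecutive_irrefl n).

Section Attach.
Variables (G : sgraph) (v : G) (n : nat).

Definition attach_adj (a b : G + 'I_n) : bool :=
  match a, b with
  | inl x, inl y => x -- y
  | inl x, inr i => (x == v) && (i == 0 :> nat)
  | inr i, inl x => (x == v) && (i == 0 :> nat)
  | inr i, inr j => consecutive i j
  end.

Lemma attach_sym : symmetric attach_adj.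
Proof.
by move=> [x|i] [y|j] //=; [exact: adj_sym | exact: consecutive_sym].
Qed.

Lemma attach_irrefl : irreflexive attach_adj.
Proof.
by move=> [x|i] /=; [exact: adj_irrefl | exact: consecutive_irrefl].
Qed.

Definition attach_path : sgraph := SGraph attach_sym attach_irrefl.

End Attach.

Definition attach_label (G : sgraph) (l : G -> label) (v : G) n
    (s : n.-tuple label) (a : attach_path v n) : label :=
  match a with inl x => l x | inr i => tnth s i end.

(* Representatives, up to label-preserving isomorphism, of the labelled trees
   of the family. *)
Inductive family_F : forall G : sgraph, (G -> label) -> Prop :=
| family_P4 :
    family_F (G := path_graph 4) (tnth [tuple LA; LB; LB; LA])
| family_attach3 (G : sgraph) (l : G -> label) (v : G) :
    family_F l -> l v = LA ->
    family_F (attach_label l (v := v) [tuple LB; LB; LA])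
| family_attach2 (G : sgraph) (l : G -> label) (v : G) :
    family_F l -> l v = LB ->
    family_F (attach_label l (v := v) [tuple LB; LA]).

(* A labelling of T is carried by the isomorphism. *)
Definition in_family_F (T : sgraph) : Prop :=
  exists (G : sgraph) (l : G -> label), family_F l /\ giso T G.

Section Corona.
Variable G : sgraph.
Implicit Type P : {ffun G -> {set {set G}}}.

(* [partition] excludes the empty part. *)
Definition nbhd_partition P : bool :=
  [forall v, partition (P v) (nbhd v)].

(* [inl v] is (v, 1) and [inr (v, A)] is (v, A). *)
Definition corona_vertex P : finType :=
  (G + {x : G * {set G} | x.2 \in P x.1})%type.

Definition gcorona_adj P (a b : corona_vertex P) : bool :=
  match a, b with
  | inl _, inl _ => false
  | inl v, inr x => v == (val x).1
  | inr x, inl v => v == (val x).1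
  | inr x, inr y =>
      [&& (val x).1 -- (val y).1,
          (val y).1 \in (val x).2 & (val x).1 \in (val y).2]
  end.

Lemma gcorona_sym P : symmetric (@gcorona_adj P).
Proof.
by move=> [v|x] [u|y] //=; rewrite adj_sym; congr andb; rewrite andbC.
Qed.

Lemma gcorona_irrefl P : irreflexive (@gcorona_adj P).
Proof. by move=> [v|x] //=; rewrite adj_irrefl. Qed.

Definition gcorona P : sgraph := SGraph (@gcorona_sym P) (@gcorona_irrefl P).

Definition merge_parts P (v : G) (A B : {set G}) : {ffun G -> {set {set G}}} :=
  [ffun x => if x == v then (A :|: B) |: (P v :\: [set A; B]) else P x].

Definition internal_contraction P P' : bool :=
  nbhd_partition P &&
  [exists v, exists A in P v, exists B in P v,
    (A != B) && (P' == merge_parts P v A B)].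

Definition internal_splitting P P' : bool := internal_contraction P' P.

(* [inr (u, v)] is the vertex next to u on the path replacing the edge uv. *)
Definition s2_adj (a b : G + {p : G * G | p.1 -- p.2}) : bool :=
  match a, b with
  | inl _, inl _ => false
  | inl u, inr p => u == (val p).1
  | inr p, inl u => u == (val p).1
  | inr p, inr q => ((val p).1 == (val q).2) && ((val p).2 == (val q).1)
  end.

Lemma s2_sym : symmetric s2_adj.
Proof.
move=> [u|p] [v|q] //=.
by rewrite andbC ![_ == (val q).1]eq_sym ![_ == (val q).2]eq_sym.
Qed.

Lemma s2_irrefl : irreflexive s2_adj.
Proof.
move=> [u|[[x y] /= xy]] //=; apply/negbTE/negP => /andP[/eqP exy _].
by move: xy; rewrite exy adj_irrefl.
Qed.

Definition two_subdivision : sgraph := SGraph s2_sym s2_irrefl.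

(* [inr v] is the pendant vertex attached to [inl v]. *)
Definition corona1_adj (a b : G + G) : bool :=
  match a, b with
  | inl u, inl v => u -- v
  | inl u, inr v => u == v
  | inr u, inl v => u == v
  | inr _, inr _ => false
  end.

Lemma corona1_sym : symmetric corona1_adj.
Proof. by move=> [u|u] [v|v] //=; [rewrite adj_sym | rewrite eq_sym..]. Qed.

Lemma corona1_irrefl : irreflexive corona1_adj.
Proof. by move=> [u|u] //=; rewrite adj_irrefl. Qed.

Definition corona1 : sgraph := SGraph corona1_sym corona1_irrefl.

(* T arises from H by a finite sequence of steps, where H is viewed as the
   general corona of G over some P0: the steps are only defined on general
   coronas. *)
Definition obtained_by (step : rel {ffun G -> {set {set G}}})
    (H T : sgraph) : Prop :=
  exists P0 P : {ffun G -> {set {set G}}},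
    [/\ nbhd_partition P0, giso H (gcorona P0), connect step P0 P
      & giso T (gcorona P)].

End Corona.

Lemma gcorona_singletons (G : sgraph) :
  let P := [ffun v : G => [set [set u] | u in nbhd v]] in
  nbhd_partition P /\ giso (two_subdivision G) (gcorona P).
Proof.
set P := finfun _; split.
  apply/forallP => v; rewrite ffunE; apply/and3P; split.
  - apply/eqP/setP => u; apply/bigcupP/idP.
      by case=> A /imsetP[w vw ->] /set1P->.
    by move=> vu; exists [set u]; rewrite ?set11 ?imset_f.
  - apply/trivIsetP => A B /imsetP[x _ ->] /imsetP[y _ ->] neq.
    by rewrite disjoints1 inE; apply: contraNneq neq => ->.
  - by apply/imsetP => -[u _ /setP/(_ u)]; rewrite !inE eqxx.
have Pin (p : {p : G * G | p.1 -- p.2}) :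
    [set (val p).2] \in P (val p).1.
  by rewrite ffunE imset_f // inE (valP p).
pose i (p : {p : G * G | p.1 -- p.2}) : {x : G * {set G} | x.2 \in P x.1} :=
  exist _ ((val p).1, [set (val p).2]) (Pin p).
pose f (a : two_subdivision G) : gcorona P := match a with
  | inl v => inl v
  | inr p => inr (i p)
  end.
have Pex (x : {x : G * {set G} | x.2 \in P x.1}) :
    exists u, ((val x).1 -- u) && ((val x).2 == [set u]).
  have := valP x; rewrite ffunE => /imsetP[u]; rewrite inE => vu ->.
  by exists u; rewrite vu eqxx.
pose h x : {p : G * G | p.1 -- p.2} :=
  exist (fun p : G * G => p.1 -- p.2) ((val x).1, xchoose (Pex x))
        (proj1 (andP (xchooseP (Pex x)))).
have hE x : (val x).2 = [set (val (h x)).2].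
  by case/andP: (xchooseP (Pex x)) => _ /eqP.
exists f; split.
  exists (fun a : gcorona P => match a with
          | inl v => (inl v : two_subdivision G)
          | inr x => inr (h x) end).
    case=> [v|p] //=; congr inr; apply: val_inj => /=.
    rewrite [RHS]surjective_pairing; congr pair; apply/esym/set1P.
    by rewrite -(hE (i p)) /= set11.
  case=> [v|x] //=; congr inr; apply: val_inj => /=.
  by rewrite -(hE x) -surjective_pairing.
move=> [u|[[u v] uv]] [w|[[w x] wx]] //=; rewrite !inE.
move: uv wx => /= uv wx; rewrite [v == w]eq_sym [RHS]andbC.
by case: (eqVneq w v) => [->|]; rewrite ?uv // andbF.
Qed.

Lemma gcorona_neighbourhoods (G : sgraph) :
  (forall v : G, nbhd v != set0) ->
  let P := [ffun v : G => [set nbhd v]] in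
  nbhd_partition P /\ giso (corona1 G) (gcorona P).
Proof.
move=> nG P; split.
  apply/forallP => v; rewrite ffunE; apply/and3P; split.
  - by rewrite /cover big_set1.
  - by apply/trivIsetP => A B /set1P-> /set1P->; rewrite eqxx.
  - by rewrite inE eq_sym.
have Pin (v : G) : (v, nbhd v).2 \in P (v, nbhd v).1 by rewrite ffunE set11.
have PinE (x : {x : G * {set G} | x.2 \in P x.1}) :
  (val x).2 = nbhd (val x).1 by have := valP x; rewrite ffunE => /set1P.
pose i v : {x : G * {set G} | x.2 \in P x.1} := exist _ (v, nbhd v) (Pin v).
(* The external vertices are the pendant ones. *)
exists (fun a : corona1 G => match a with
        | inl v => (inr (i v) : gcorona P) | inr v => inl v end); split.
  exists (fun a : gcorona P => match a with
          | inl v => (inr v : corona1 G) | inr x => inl (val x).1 end).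
    by case.
  case=> [v|x] //=; congr inr; apply: val_inj => /=.
  by rewrite -PinE -surjective_pairing.
move=> [u|u] [v|v] //=.
by rewrite !inE [v -- u]adj_sym !andbb.
Qed.

Lemma gcorona_merge_parts (G : sgraph) (P : {ffun G -> {set {set G}}})
    (v : G) (A B : {set G}) (hA : A \in P v) (hB : B \in P v) :
  nbhd_partition P -> A != B ->
  nbhd_partition (merge_parts P v A B) /\
  exists f : gcorona P -> gcorona (merge_parts P v A B),
    let a : gcorona P := inr (exist _ (v, A) hA) in
    let b : gcorona P := inr (exist _ (v, B) hB) in
    [/\ forall y, exists x, f x = y,
        forall x x', f x = f x' <->
          x = x' \/ (x \in [:: a; b]) && (x' \in [:: a; b])
      & forall y y', y -- y' <->
          exists x x', [/\ f x = y, f x' = y' & x -- x']].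
Proof.
move=> hP nAB; set P' := merge_parts P v A B.
have /and3P[/eqP cP tP nP] : partition (P v) (nbhd v) by exact: forallP hP v.
have tP2 C D u : C \in P v -> D \in P v -> u \in C -> u \in D -> C = D.
  move=> hC hD uC uD; apply/eqP/negPn/negP => nCD.
  by have := trivIsetP tP C D hC hD nCD; rewrite disjoint_subset => /subsetP/(_ u uC);
     rewrite inE uD.
have ne C : C \in P v -> exists u, u \in C.
  by move=> hC; apply/set0Pn; apply: contraNneq nP => <-.
have ABnew : A :|: B \notin P v.
  apply/negP => hC; have [u uA] := ne A hA; have [w wB] := ne B hB.
  have eA : A = A :|: B by apply: (tP2 _ _ u) => //; rewrite inE uA.
  have eB : B = A :|: B by apply: (tP2 _ _ w) => //; rewrite inE wB orbT.
  by move: nAB; rewrite {1}eA {2}eB eqxx.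
split.
  apply/forallP => x; rewrite ffunE; case: eqP => [->|_]; last exact: forallP hP x.
  apply/and3P; split.
  - apply/eqP; rewrite -cP; apply/setP => u; apply/bigcupP/bigcupP.
      case=> C; rewrite !inE => /orP[/eqP->|/andP[_ hC]] uC; last by exists C.
      by case/setUP: uC => uC; [exists A | exists B].
    case=> C hC uC; case: (boolP (C \in [set A; B])) => CAB; last first.
      by exists C => //; rewrite inE [C \in _ :\: _]inE CAB hC orbT.
    exists (A :|: B); first by rewrite !inE eqxx.
    by move: CAB uC; rewrite !inE => /orP[]/eqP-> ->; rewrite ?orbT.
  - have key C : C \in P v :\: [set A; B] -> [disjoint A :|: B & C].
      rewrite !inE negb_or => /andP[/andP[CA CB] hC].
      rewrite disjoint_subset; apply/subsetP => u uAB; rewrite inE.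
      apply/negP => uC; case/setUP: uAB => uA.
        by move: CA; rewrite (tP2 _ _ u hC hA uC uA) eqxx.
      by move: CB; rewrite (tP2 _ _ u hC hB uC uA) eqxx.
    apply/trivIsetP => C D /setU1P[->|hC] /setU1P[->|hD] nCD.
    + by rewrite eqxx in nCD.
    + exact: key.
    + by rewrite disjoint_sym; exact: key.
    + by apply: (trivIsetP tP) => //; [case/setDP: hC | case/setDP: hD].
  - rewrite !inE (negPf nP) andbF orbF eq_sym; have [u uA] := ne A hA.
    by apply/negP => /eqP/setP/(_ u); rewrite !inE uA.
pose mg (x : G * {set G}) :=
  if (x.1 == v) && (x.2 \in [set A; B]) then (v, A :|: B) else x.
have mg1 x : (mg x).1 = x.1 by rewrite /mg; case: andP => // -[/eqP->].
have mgP (x : {x : G * {set G} | x.2 \in P x.1}) :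
    (mg (val x)).2 \in P' (mg (val x)).1.
  case: x => -[w C] /= hC; rewrite mg1 ffunE /= /mg /=; case: eqP => //= ew.
  case: ifP => CAB /=; first by rewrite !inE eqxx.
  by rewrite inE [C \in _ :\: _]inE CAB -ew hC orbT.
pose f (x : gcorona P) : gcorona P' := match x with
  | inl w => inl w
  | inr x => inr (exist (fun x : G * {set G} => x.2 \in P' x.1)
                        (mg (val x)) (mgP x)) end.
have mg2 (x : G * {set G}) u : u \in x.2 -> u \in (mg x).2.
  rewrite /mg; case: ifP => //= /andP[_]; rewrite !inE.
  by case/orP=> /eqP-> ->; rewrite ?orbT.
(* every vertex has a preimage whose part contains a prescribed element *)
have lift (y : {x : G * {set G} | x.2 \in P' x.1}) u : u \in (val y).2 ->
    exists x : {x : G * {set G} | x.2 \in P x.1},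
      [/\ f (inr x) = inr y, u \in (val x).2 & (val x).1 = (val y).1].
  case: y => -[w C] /= hC uC; have := hC; rewrite {1}ffunE.
  case: eqP => [ew|nw] hC'; last first.
    exists (exist (fun x : G * {set G} => x.2 \in P x.1) (w, C) hC'); split => //.
    by congr inr; apply: val_inj; rewrite /= /mg /=; case: eqP.
  subst w; case/setU1P: hC' => [eC|].
    subst C; case/setUP: uC => uC;
      [pose D := A; have hD := hA | pose D := B; have hD := hB];
      exists (exist (fun x : G * {set G} => x.2 \in P x.1) (v, D) hD);
      split => //; congr inr; apply: val_inj;
      by rewrite /= /mg /= !inE !eqxx ?orbT.
  case/setDP => hC' nC.
  exists (exist (fun x : G * {set G} => x.2 \in P x.1) (v, C) hC'); split => //.
  by congr inr; apply: val_inj; rewrite /= /mg /= (negPf nC) andbF.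
have P'ne (y : {x : G * {set G} | x.2 \in P' x.1}) : exists u, u \in (val y).2.
  case: y => -[w C] /=; rewrite ffunE; case: eqP => [_|_] hC.
    case/setU1P: hC => [->|/setDP[/ne]//].
    by have [u uA] := ne A hA; exists u; rewrite inE uA.
  have /and3P[_ _ n0] : partition (P w) (nbhd w) by exact: forallP hP w.
  by apply/set0Pn; apply: contraNneq n0 => <-.
exists f => a b; split.
- case=> [w|y]; first by exists (inl w).
  by have [u /lift[x [fx _ _]]] := P'ne y; exists (inr x).
- have inab x : (inr x \in [:: a; b]) =
                ((val x).1 == v) && ((val x).2 \in [set A; B]).
    rewrite !inE /a /b; case: x => -[w C] hC /=.
    rewrite -![inr _ == inr _]/(_ == _ :> {x : G * {set G} | _}) -!val_eqE /=.
    by rewrite !xpair_eqE -andb_orr.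
  case=> [w|x] [w'|x'] /=; split=> //.
  + by case=> ->; left.
  + by case=> [[->]|].
  + by case.
  + by case=> // /andP[_]; rewrite !inE.
  + case=> e; rewrite !inab; move: e; rewrite /mg.
    case: ifP => c; case: ifP => c' e.
    * by right.
    * have : (sval x').2 \in P (sval x').1 := valP x'.
      by rewrite -e /= (negPf ABnew).
    * have : (sval x).2 \in P (sval x).1 := valP x.
      by rewrite e /= (negPf ABnew).
    * by left; congr inr; apply: val_inj.
  + case=> [[->]//|]; rewrite !inab => /andP[c c'].
    by congr inr; apply: val_inj; rewrite /= /mg c c'.
- case=> [w|y] [w'|y'] /=; split=> //.
  + by case=> [[x|x] [[x'|x'] []]].
  + move=> e; have [u /lift[x [fx _ ex]]] := P'ne y'.
    by exists (inl w), (inr x); rewrite /= ex.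
  + by case=> [[x|x] [[x'|x'] [//= [<-] [<-] /=]]]; rewrite mg1.
  + move=> e; have [u /lift[x [fx _ ex]]] := P'ne y.
    by exists (inr x), (inl w'); rewrite /= ex.
  + by case=> [[x|x] [[x'|x'] [//= [<-] [<-] /=]]]; rewrite mg1.
  + case/and3P=> e /lift[x [fx ux ex]] /lift[x' [fx' ux' ex']].
    by exists (inr x), (inr x'); split=> //=; rewrite ex ex' e ux ux'.
  + case=> [[x|x] [[x'|x'] [//= [<-] [<-] /=]]]; rewrite !mg1.
    by case/and3P=> -> /mg2-> /mg2->.
Qed.

(* Main.v *)
Require Import Defs.
From mathcomp Require Import all_boot zify.

(* Call a dominating 2-packing containing all leaves a code.  Every statement
   is equivalent to the existence of a code.

   Root the tree at a leaf r.  An edge is then named by its lower end, and all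
   trees of an induction are the subtrees induced by parent-closed vertex sets.
   A deepest vertex y0 ends a pendant path y0, y1, y2 whose removal (of y0, y1
   if y2 has another child, of y0, y1, y2 otherwise) undoes one operation of
   the family F; in this way a code yields a construction of the tree (built),
   with the members of the code as the vertices labelled A.

   If no set of at most two edges can be subdivided so as to increase the
   domination number, the same pruning works: of this hypothesis only the sets
   contained in {x - par x, par x - par (par x)} are needed, and they suffice
   to carry it over to the pruned tree.  Conversely, a construction gives, for
   any two edges, dominating sets of the subdivided tree with as many vertices
   as the code.  Subdividing an edge st outside the code and the edges from s
   and t to the code increases the domination number, because the code and the
   new vertex on st form a 2-packing.

   A code is unique: from a deepest vertex on which two codes differ one finds
   a deeper one.  The tree T' of the corona is obtained by contracting the
   closed neighbourhoods of the members of the code; it is a tree because the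
   edges of T are bridges.  Finally, any two neighbourhood partitions, one
   refining the other, are linked by internal contractions. *)

Set Implicit Arguments.
Unset Strict Implicit.
Unset Printing Implicit Defensive.

(** * Codes *)

(** A root that is a leaf lies in every code, so it can stay an A-vertex while everything is pruned
    from the far end, and the property of having at most one child passes to all subtrees containing
    it. Keeping all subtrees inside one fixed type avoids carrying domination statements along newly
    built graphs. In the same spirit a set of subdivided edges is a set [S] of lower ends, and its
    restriction to a subtree is [S :&: X].

    Two obstacles shape the inductions. The two-vertex tree is stable under subdivision but has no
    construction, so the pruning of a stable tree must be shown never to reach it. And the plain
    bound for two subdivided edges is not inductive: the edges may be shared between the old tree
    and the attached path, so that one vertex of the budget has to move across the attaching vertex.
    The bounds with an exempt vertex or with a prescribed vertex record exactly these transfers. *)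

Section Code.
Variable G : sgraph.
Implicit Types (v u w x y : G) (D : {set G}).

Definition near u v := (u == v) || (u -- v).

Lemma near_refl v : near v v. Proof. by rewrite /near eqxx. Qed.

(* Dominating 2-packings containing all leaves, in first-order form. *)
Definition code D : Prop :=
  [/\ forall v, v \notin D -> exists2 u, u \in D & v -- u,
      forall v u w, u \in D -> w \in D -> near v u -> near v w -> u = w
    & forall v, v \notin D -> exists2 u, u \notin D & v -- u].

(** With at least three vertices the lengths searched begin with 0, 1, 2, so the result exceeds 2
    exactly when these three tests fail, whether or not a longer path exists. *)
Lemma dist_gt2 x y : 2 < #|G| ->
  (2 < dist x y) = [&& x != y, ~~ (x -- y) & [forall z, ~~ ((x -- z) && (z -- y))]].
Proof.
rewrite /dist => G3; have -> : #|G| = (#|G| - 3).+3 by lia.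
rewrite [iota _ _]/= [find _ _]/=.
have -> : [exists p : 0.-tuple G, path adj x p && (last x p == y)] = (x == y).
  apply/existsP/idP => [[[[|] //= _]]//|xy]; first by exists [tuple].
have -> : [exists p : 1.-tuple G, path adj x p && (last x p == y)] = (x -- y).
  apply/existsP/idP => [[[[|a [|]] //= _]]|xy]; first by rewrite andbT => /andP[? /eqP<-].
  by exists [tuple y]; rewrite /= xy eqxx.
have -> : [exists p : 2.-tuple G, path adj x p && (last x p == y)] =
          ~~ [forall z, ~~ ((x -- z) && (z -- y))].
  apply/existsP/forallPn => [[[[|a [|b [|]]] //= _]]|[z]].
    by rewrite andbT => /andP[? /eqP<-]; exists a; rewrite negbK.
  by rewrite negbK => /andP[xz zy]; exists [tuple z; y]; rewrite /= xz zy eqxx.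
by case: (x == y); case: (x -- y); case: [forall z, _].
Qed.

(** By domination and packing a vertex outside [D] has exactly one neighbour in [D]. Hence it fails
    to be a leaf exactly when it also has a neighbour outside [D], which is the last clause of
    [code]. *)
Lemma codeP D : 2 < #|G| ->
  code D <-> [/\ dominating D, two_packing D & leaves G \subset D].
Proof.
move=> G3; split=> [[dom pack leaf]|[/forall_inP dom /forall_inP pack /subsetP leaf]].
  split.
  - apply/forall_inP => v /dom[u uD vu]; apply/existsP; exists u; exact/andP.
  - apply/forall_inP => x xD; apply/forall_inP => y yD; apply/implyP => nxy.
    rewrite dist_gt2 // nxy /=; apply/andP; split.
      apply: contra nxy => xy; apply/eqP/(pack x) => //; first exact: near_refl.
      by rewrite /near xy orbT.
    apply/forallP => z; apply: contra nxy => /andP[xz zy]; apply/eqP/(pack z) => //.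
      by rewrite /near adj_sym xz orbT.
    by rewrite /near zy orbT.
  - apply/subsetP => v; rewrite inE => /cards1P[a Na]; apply/negPn/negP => vD.
    have [u uD vu] := dom v vD; have [w wD vw] := leaf v vD.
    have: u \in nbhd v by rewrite inE.
    have: w \in nbhd v by rewrite inE.
    by rewrite Na !inE => /eqP wa /eqP ua; move: wD; rewrite wa -ua uD.
have domD v : v \notin D -> exists2 u, u \in D & v -- u.
  by move=> /dom/existsP[u /andP[]]; exists u.
have packD v u w : u \in D -> w \in D -> near v u -> near v w -> u = w.
  move=> uD wD vu vw; apply/eqP/negPn/negP => nuw.
  have /forall_inP/(_ w wD) := pack u uD; rewrite nuw dist_gt2 // nuw /=.
  case/andP=> uw /forallP/(_ v).
  case/orP: vu => [/eqP e|vu]; case/orP: vw => [/eqP e'|vw].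
  - by rewrite -e e' eqxx in nuw.
  - by rewrite -e vw in uw.
  - by rewrite -e' adj_sym vu in uw.
  - by rewrite adj_sym vu vw.
split=> // v vD.
have [u uD vu] := domD v vD.
have: ~~ (nbhd v \subset [set u]).
  apply/negP => sub; move: vD; rewrite leaf // inE; apply/cards1P; exists u.
  by apply/eqP; rewrite eqEsubset sub sub1set inE.
case/subsetPn=> w; rewrite !inE => vw nwu; exists w => //.
apply: contra nwu => wD; apply/eqP/(packD v) => //; by rewrite /near ?vw ?vu orbT.
Qed.

Lemma gamma_min D : dominating D -> gamma G <= #|D|.
Proof.
by rewrite /gamma; case: arg_minnP => [|i _]; [apply/forall_inP => v; rewrite inE | apply].
Qed.

Lemma gamma_ex : exists2 D : {set G}, dominating D & #|D| = gamma G.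
Proof.
rewrite /gamma; case: arg_minnP => [|i di _]; last by exists i.
by apply/forall_inP => v; rewrite inE.
Qed.

End Code.

Lemma giso_sym (G H : sgraph) : giso G H -> giso H G.
Proof.
case=> f [[g fK gK] adjf]; exists g; split; first by exists f.
by move=> x y; rewrite -{2}(gK x) -{2}(gK y) adjf.
Qed.

Lemma giso_inj_surj (G H : sgraph) (f : H -> G) : injective f ->
  (forall x, exists g, f g = x) -> (forall g h, (f g -- f h) = (g -- h)) -> giso G H.
Proof.
move=> finj fim fadj; apply: giso_sym; exists f; split=> //.
apply: inj_card_bij => //.
have -> : #|G| = #|codom f|.
  apply/eqP; rewrite eqn_leq max_card andbT; apply: subset_leq_card.
  by apply/subsetP => x _; have [g <-] := fim x; exact: codom_f.
by rewrite card_codom.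
Qed.

Lemma giso_code (G H : sgraph) : giso G H ->
  (exists D : {set H}, code D) -> exists D : {set G}, code D.
Proof.
case=> f [[g fK gK] adjf] [D [dom pack leaf]].
have nearf x y : near (f x) (f y) = near x y.
  by rewrite /near adjf (inj_eq (can_inj fK)).
have adjg x y : (x -- g y) = (f x -- y) by rewrite -adjf gK.
exists (f @^-1: D); split.
- move=> v; rewrite inE => /dom[u uD fvu]; exists (g u); first by rewrite inE gK.
  by rewrite adjg.
- move=> v u w; rewrite !inE => uD wD vu vw; apply: (can_inj fK).
  by apply: (pack (f v)); rewrite ?nearf.
- move=> v; rewrite inE => /leaf[u uD fvu]; exists (g u); first by rewrite inE gK.
  by rewrite adjg.
Qed.

(** * Trees: bridges and rootings *)

Section Bridges.
Variable G : sgraph.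
Implicit Types x y a b : G.

Definition del x y a b := (a -- b) && ([set a; b] != [set x; y]).

Lemma del_sym x y : symmetric (del x y).
Proof. by move=> a b; rewrite /del adj_sym setUC. Qed.

Lemma set2_eq (T : finType) (a b c d : T) : [set a; b] = [set c; d] ->
  (a = c /\ b = d) \/ (a = d /\ b = c).
Proof.
move=> e; have/setP e' := e.
have /set2P[ac|ad] : a \in [set c; d] by rewrite -e set21.
  subst c; case: (eqVneq b d) => [|nbd]; first by left.
  have := e' d; rewrite !inE eqxx orbT orbC eq_sym (negPf nbd) /= => /eqP da.
  by have := e' b; rewrite !inE eqxx orbT da orbb -da (negPf nbd).
subst d; case: (eqVneq b c) => [|nbc]; first by right.
have := e' c; rewrite !inE eqxx orbC eq_sym (negPf nbc) /= => /eqP ca.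
by have := e' b; rewrite !inE eqxx orbT -ca orbb (negPf nbc).
Qed.


(** Acyclicity means that every edge is a bridge. A path from x to y avoiding the edge xy has at
    least two steps and closes up with that edge to a cycle; conversely the rest of a cycle is a
    detour around its first edge. *)
Lemma acyclicP :
  acyclic G <-> forall x y, x -- y -> ~~ connect (del x y) x y.
Proof.
split=> [ac x y xy|br s s2].
  apply/negP => /connectP[p0]; case/shortenP => p pp up _ yl.
  case: p => [|a [|b p]] in pp up yl.
  - by rewrite yl adj_irrefl in xy.
  - by move: pp; rewrite yl /= /del eqxx andbF.
  have /negP[] := ac (x :: a :: b :: p) isT; rewrite up andbT.
  have {}pp : path adj x [:: a, b & p].
    by apply: sub_path pp => u v /andP[].
  by rewrite [cycle _ _]rcons_path pp adj_sym -yl.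
case: s s2 => [|x [|y [|z s]]] // _; apply/negP => /andP[].
rewrite [cycle _ _]/= rcons_path => /and4P[xy yz zs lx] us.
have /negP[] := br x y xy; rewrite (sym_connect_sym (@del_sym x y)).
apply: (@connect_trans _ _ (last z s)); last first.
  apply: connect1; rewrite /del lx /=; apply/eqP => /set2_eq[[e1 e2]|[e1 e2]].
    by rewrite -e2 /= mem_head in us.
  by rewrite -e1 [uniq _]/= mem_last andbF in us.
apply/connectP; exists (z :: s) => //.
have : path adj y (z :: s) by rewrite /= yz.
apply: (@sub_in_path _ (predC1 x)) => [a b|].
  rewrite !inE => ax bx ab; rewrite /del ab; apply/eqP => /set2_eq[[e _]|[_ e]].
    by rewrite e eqxx in ax.
  by rewrite e eqxx in bx.
apply/allP => a ain; rewrite inE; apply: contraTneq us => <-.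
by rewrite /= ain.
Qed.

End Bridges.

Section Rooting.
Variables (G : sgraph) (r : G).

(** The depth of the root is left free: what counts is the strict decrease towards the root. The
    condition [x != y] in the last field discards the loop [par r = r]. *)
Record rooting (par : G -> G) (dep : G -> nat) : Prop := Rooting {
  par_root : par r = r;
  dep_par : forall x, x != r -> dep x = (dep (par x)).+1;
  adjE : forall x y, (x -- y) = (x != y) && ((par x == y) || (par y == x)) }.

(** The rooted part [X] grows by one vertex at a time. Connectedness provides an edge from some x in
    [X] to some y outside, and x becomes the parent of y. A second neighbour z of y in [X] would
    give a detour from y over x and the root to z, although yz is a bridge. *)
Lemma rootingP : is_tree G -> exists par dep, rooting par dep.
Proof.
case=> [[G0 conG] /acyclicP br].
pose good (X : {set G}) par dep :=
  [/\ r \in X, par r = r,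
      forall x, x \in X -> x != r -> par x \in X /\ dep x = (dep (par x)).+1
    & forall x y, x \in X -> y \in X ->
      (x -- y) = (x != y) && ((par x == y) || (par y == x))].
have grow n : n < #|G| -> exists (X : {set G}) par (dep : G -> nat), #|X| = n.+1 /\ good X par dep.
  elim: n => [_|n IHn ltn].
    exists [set r], (fun=> r), (fun=> 0); rewrite cards1; split=> //; split=> //.
    - by rewrite set11.
    - by move=> x /set1P->; rewrite eqxx.
    - by move=> x y /set1P-> /set1P->; rewrite eqxx adj_irrefl.
  have [X [par [dep [cX [rX pr pX aX]]]]] := IHn (ltnW ltn).
  (* The walk to the root stays in [X], hence uses no edge at y. *)
  have toroot y x' x : y \notin X -> x \in X -> connect (del y x') x r.
    move=> yX; move: {2}(dep x) (erefl (dep x)) => d.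
    elim: d x => [|d IHd] x dx xX.
      case: (eqVneq x r) => [->//|nxr].
      by have [_] := pX x xX nxr; rewrite dx.
    case: (eqVneq x r) => [->|nxr]; first by rewrite connect0.
    have [pxX] := pX x xX nxr; rewrite dx => -[edx].
    apply: connect_trans (IHd _ (esym edx) pxX); apply: connect1.
    rewrite /del aX // eqxx andbT; apply/andP; split.
      by apply/eqP => e; move: dx; rewrite {1}e -edx; lia.
    by apply/eqP => /set2_eq[[e _]|[_ e]]; rewrite -e ?xX ?pxX in yX.
  have [x [y [xX yX xy]]] : exists x y, [/\ x \in X, y \notin X & x -- y].
    have /subsetPn[z _ zX] : ~~ ([set: G] \subset X).
      by apply: contraL ltn => /subset_leq_card; rewrite cardsT cX -leqNgt.
    case: (pickP (fun p : G * G => [&& p.1 \in X, p.2 \notin X & p.1 -- p.2])) => [[x y] /and3P[]|nex].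
      by exists x, y.
    have cl : closed adj (mem X).
      apply: intro_closed; first by apply: sym_connect_sym; exact: adj_sym.
      move=> a b ab aX'; apply/negPn/negP => bX.
      by have := nex (a, b); rewrite /= -topredE /= in aX' bX *; rewrite aX' bX ab.
    have := closed_connect cl (conG r z); change ((r \in X) = (z \in X) -> 
      exists x y, [/\ x \in X, y \notin X & x -- y]).
    by rewrite rX (negPf zX).
  have uniq_nb z : z \in X -> (y -- z) = (z == x).
    move=> zX; apply/idP/eqP => [yz|->]; last by rewrite adj_sym.
    apply/eqP/negPn/negP => nzx; have /negP[] := br y z yz.
    apply: (@connect_trans _ _ x); first apply: connect1.
      rewrite /del adj_sym xy /=; apply/eqP => /set2_eq[[_ e]|[e _]].
        by rewrite e eqxx in nzx.
      by rewrite e zX in yX.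
    apply: (connect_trans (toroot y z x yX xX)).
    by rewrite (sym_connect_sym (@del_sym _ y z)); apply: toroot.
  have nXy z : z \in X -> (z == y) = false by move=> zX; apply: contraNF yX => /eqP<-.
  exists (y |: X), (fun z => if z == y then x else par z),
         (fun z => if z == y then (dep x).+1 else dep z).
  rewrite cardsU1 yX cX; split=> //; split.
  - by rewrite inE rX orbT.
  - by rewrite (nXy r rX).
  - move=> z /setU1P[-> _|zX nzr]; first by rewrite eqxx !inE xX orbT (nXy x xX).
    have [pX' dX] := pX z zX nzr.
    by rewrite (nXy z zX) (nXy _ pX') !inE pX' orbT.
  - move=> a b /setU1P[->|aX'] /setU1P[->|bX'].
    + by rewrite adj_irrefl eqxx.
    + rewrite uniq_nb // eqxx [y == b]eq_sym (nXy b bX') /= [x == b]eq_sym.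
      case: (eqVneq b r) => [->|nb]; first by rewrite pr (nXy r rX) orbF.
      by rewrite (nXy (par b)) ?orbF //; case: (pX b bX' nb).
    + rewrite adj_sym uniq_nb // eqxx (nXy a aX') /= [x == a]eq_sym.
      case: (eqVneq a r) => [->|na]; first by rewrite pr (nXy r rX).
      by rewrite (nXy (par a)) //; case: (pX a aX' na).
    + by rewrite (nXy a aX') (nXy b bX'); exact: aX.
have [|X [par [dep [cX [rX pr pX aX]]]]] := grow #|G|.-1; first by rewrite prednK.
have XT z : z \in X.
  have : X == setT by rewrite eqEcard subsetT cardsT cX prednK /=.
  by move/eqP->; rewrite inE.
exists par, dep; split=> // [x nxr|x y]; first by case: (pX x).
exact: aX.
Qed.

End Rooting.

(** * Codes of rooted trees *)

Section Rooted.
Variables (T : finType) (r : T) (par : T -> T) (dep : T -> nat).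
Hypothesis par_r : par r = r.
Hypothesis depP : forall x, x != r -> dep x = (dep (par x)).+1.

Implicit Types (x y z u v w : T) (X D S : {set T}).

(** Closed adjacency of the tree, read off [par] alone. *)
Definition nr x y := [|| x == y, par x == y | par y == x].

Definition closed_up X := r \in X /\ forall x, x \in X -> par x \in X.

Record rcode X D : Prop := RCode {
  rcode_sub : D \subset X;
  rcode_dom : forall x, x \in X -> x \notin D -> exists2 d, d \in D & nr x d;
  rcode_pack : forall x d e, x \in X -> d \in D -> e \in D -> nr x d -> nr x e -> d = e;
  rcode_leaf : forall x, x \in X -> x \notin D ->
    exists u, [/\ u \in X, u \notin D, u != x & nr x u] }.

(* The operations of the family F, performed inside the rooted tree: [X] is the
   set of vertices built so far and [D] the set of those labelled A.  The
   one-vertex start is legitimate because the first step turns it into P4. *)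
Inductive built : {set T} -> {set T} -> Prop :=
| built_root : built [set r] [set r]
| built_path3 X D x y z : built X D -> par x \in D ->
    x \notin X -> y \notin X -> z \notin X -> par y = x -> par z = y ->
    built (x |: (y |: (z |: X))) (z |: D)
| built_path2 X D x y : built X D -> par x \in X -> par x \notin D ->
    x \notin X -> y \notin X -> par y = x ->
    built (x |: (y |: X)) (y |: D).

Lemma nr_refl x : nr x x. Proof. by rewrite /nr eqxx. Qed.

Lemma nr_sym x y : nr x y = nr y x.
Proof. by rewrite /nr eq_sym orbCA orbA orbC [in RHS]orbC orbA. Qed.

Lemma par_neq x : x != r -> par x != x.
Proof. by move/depP => dx; apply/eqP => e; rewrite e in dx; lia. Qed.

Lemma par2_neq x : x != r -> par x != r -> par (par x) != x.
Proof.
by move=> /depP dx /depP dpx; apply/eqP => e; rewrite e in dpx; lia.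
Qed.

Lemma notin_neq X u x : u \in X -> x \notin X -> (u == x) = false.
Proof. by move=> uX; apply: contraNF => /eqP<-. Qed.

Lemma notin_neqr X u x : u \in X -> x \notin X -> (x == u) = false.
Proof. by rewrite eq_sym; exact: notin_neq. Qed.

Lemma nr_new X u x : closed_up X -> x \notin X -> u \in X -> nr u x = (par x == u).
Proof.
move=> [rX cX] xX uX.
by rewrite /nr (notin_neq uX xX) (notin_neq (cX u uX) xX).
Qed.

Lemma built_closed X D : built X D -> [/\ closed_up X, D \subset X & r \in D].
Proof.
elim=> {X D} [|X D x y z _ [[rX cX] sD rD] pxD xX yX zX py pz|X D x y _ [[rX cX] sD rD] pxX pxD xX yX py].
- rewrite /closed_up set11; split=> //; split=> // x /set1P->.
  by rewrite par_r set11.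
- have sD' := subsetP sD; split; last by rewrite inE rD orbT.
    split=> [|u]; first by rewrite !inE rX !orbT.
    rewrite !inE => /or4P[/eqP->|/eqP->|/eqP->|/cX->]; rewrite ?orbT //.
    + by rewrite (sD' _ pxD) !orbT.
    + by rewrite py eqxx.
    + by rewrite pz eqxx orbT.
  apply/subsetP => u; rewrite !inE => /orP[->|/sD'->]; by rewrite !orbT.
- have sD' := subsetP sD; split; last by rewrite inE rD orbT.
    split=> [|u]; first by rewrite !inE rX !orbT.
    rewrite !inE => /or3P[/eqP->|/eqP->|/cX->]; rewrite ?orbT //.
    + by rewrite pxX !orbT.
    + by rewrite py eqxx.
  apply/subsetP => u; rewrite !inE => /orP[->|/sD'->]; by rewrite !orbT.
Qed.

(** In a three-vertex step x is dominated by its parent and y by z, while x and y are each other's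
    neighbours outside the code. In a two-vertex step y dominates x, and the neighbour of x outside
    the code is its parent. *)
Lemma built_rcode X D : built X D -> rcode X D.
Proof.
elim=> {X D} [|X D x y z bX IH pxD xX yX zX py pz|X D x y bX IH pxX pxD xX yX py].
- split=> //; try by move=> x /set1P->; rewrite set11.
  by move=> x d e _ /set1P-> /set1P->.
- have [cX /subsetP sD rD] := built_closed bX.
  have [_ dom pack leaf] := IH.
  have pxX := sD _ pxD; have rX : r \in X by case: cX.
  have nx u : u \in X -> nr u x = (par x == u) by apply: nr_new.
  have ny u : u \in X -> nr u y = false.
    by move=> uX; rewrite (nr_new cX) // py (notin_neqr uX).
  have nz u : u \in X -> nr u z = false.
    by move=> uX; rewrite (nr_new cX) // pz (notin_neqr uX).
  have xr := notin_neqr rX xX; have yr := notin_neqr rX yX; have zr := notin_neqr rX zX.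
  have nxy : x != y by rewrite -py par_neq // yr.
  have nyz : y != z by rewrite -pz par_neq // zr.
  have nxz : x != z by rewrite -py -pz par2_neq ?pz ?zr ?yr.
  have xz : nr x z = false.
    by rewrite /nr (negPf nxz) pz eq_sym [y == x]eq_sym (negPf nxy) (notin_neqr pxX zX).
  have DX u : u \notin X -> u \notin D by apply: contra => /sD.
  have yl u : u \in D -> nr y u = false by move=> /sD uX; rewrite nr_sym ny.
  have zl u : u \in D -> nr z u = false by move=> /sD uX; rewrite nr_sym nz.
  split.
  + apply/subsetP => u; rewrite !inE => /orP[->|/sD->]; by rewrite !orbT.
  + move=> u; rewrite !inE => /or4P[/eqP->|/eqP->|/eqP->|uX]; rewrite negb_or => /andP[uz uD].
    * by exists (par x); rewrite ?inE ?pxD ?orbT // /nr eqxx orbT.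
    * by exists z; rewrite ?inE ?eqxx // /nr pz eqxx !orbT.
    * by rewrite eqxx in uz.
    * by have [d dD ud] := dom u uX uD; exists d; rewrite // inE dD orbT.
  + move=> u d e; rewrite !inE => /or4P[/eqP->|/eqP->|/eqP->|uX] /orP[/eqP->|dD] /orP[/eqP->|eD] //;
      rewrite ?xz //.
    * by rewrite ![nr x _]nr_sym !nx ?sD // => /eqP<- /eqP<-.
    * by rewrite (yl e).
    * by rewrite (yl d).
    * by rewrite (yl d).
    * by rewrite (zl e).
    * by rewrite (zl d).
    * by rewrite (zl d).
    * by rewrite nz.
    * by rewrite nz.
    * exact: pack.
  + move=> u; rewrite !inE => /or4P[/eqP->|/eqP->|/eqP->|uX]; rewrite negb_or => /andP[uz uD].
    * by exists y; rewrite !inE eqxx orbT negb_or nyz DX // eq_sym nxy /nr py eqxx !orbT.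
    * by exists x; rewrite !inE eqxx negb_or nxz DX // nxy /nr py eqxx !orbT.
    * by rewrite eqxx in uz.
    * have [w [wX wD wu uw]] := leaf u uX uD; exists w.
      by rewrite !inE wX !orbT negb_or (notin_neq wX zX).
- have [cX /subsetP sD rD] := built_closed bX.
  have [_ dom pack leaf] := IH.
  have rX : r \in X by case: cX.
  have nx u : u \in X -> nr u x = (par x == u) by apply: nr_new.
  have ny u : u \in X -> nr u y = false.
    by move=> uX; rewrite (nr_new cX) // py (notin_neqr uX).
  have xr := notin_neqr rX xX; have yr := notin_neqr rX yX.
  have nxy : x != y by rewrite -py par_neq // yr.
  have DX u : u \notin X -> u \notin D by apply: contra => /sD.
  have yl u : u \in D -> nr y u = false by move=> /sD uX; rewrite nr_sym ny.
  have nxD u : u \in D -> nr x u = false.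
    move=> uD; rewrite nr_sym nx ?sD //; by apply: contraNF pxD => /eqP->.
  split.
  + apply/subsetP => u; rewrite !inE => /orP[->|/sD->]; by rewrite !orbT.
  + move=> u; rewrite !inE => /or3P[/eqP->|/eqP->|uX]; rewrite negb_or => /andP[uz uD].
    * by exists y; rewrite ?inE ?eqxx // /nr py eqxx !orbT.
    * by rewrite eqxx in uz.
    * by have [d dD ud] := dom u uX uD; exists d; rewrite // inE dD orbT.
  + move=> u d e; rewrite !inE => /or3P[/eqP->|/eqP->|uX] /orP[/eqP->|dD] /orP[/eqP->|eD] //;
      rewrite ?(nxD d dD) ?(nxD e eD) //.
    * by rewrite (yl e).
    * by rewrite (yl d).
    * by rewrite (yl d).
    * by rewrite ny.
    * by rewrite ny.
    * exact: pack.
  + move=> u; rewrite !inE => /or3P[/eqP->|/eqP->|uX]; rewrite negb_or => /andP[uz uD].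
    * exists (par x); rewrite !inE pxX !orbT negb_or pxD (notin_neq pxX yX).
      by rewrite (notin_neq pxX xX) /nr eqxx orbT.
    * by rewrite eqxx in uz.
    * have [w [wX wD wu uw]] := leaf u uX uD; exists w.
      by rewrite !inE wX !orbT negb_or (notin_neq wX yX).
Qed.

Lemma dep_root x : x != r -> dep r < dep x.
Proof.
move: {2}(dep x) (leqnn (dep x)) => n; elim: n x => [|n IHn] x dx nxr.
  by move: dx; rewrite (depP nxr).
move: dx; rewrite (depP nxr) !ltnS; case: (eqVneq (par x) r) => [->//|np] dx.
exact/ltnW/IHn.
Qed.

Lemma deepest X : closed_up X -> X != [set r] ->
  exists y, [/\ y \in X, y != r & forall x, x \in X -> dep x <= dep y].
Proof.
move=> [rX cX] nX.
have [x xX nxr] : exists2 x, x \in X & x != r.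
  have /subsetPn[x xX] : ~~ (X \subset [set r]).
    by apply: contra nX => sX; rewrite eqEsubset sX sub1set.
  by rewrite inE; exists x.
have [y yX ymax] := @arg_maxnP T r (fun x => x \in X) dep rX.
exists y; split=> //; apply/eqP => ye.
have: dep x <= dep y by exact: ymax.
by rewrite ye leqNgt dep_root.
Qed.

Lemma deepest_leaf X y : (forall x, x \in X -> dep x <= dep y) -> y != r ->
  forall c, c \in X -> par c != y.
Proof.
move=> ymax nyr c cX; apply/eqP => cy; have := ymax c cX.
case: (eqVneq c r) => [e|/depP->]; last by rewrite cy ltnn.
by rewrite -cy e par_r eqxx in nyr.
Qed.


Lemma setUD2 X x y : x \in X -> y \in X -> x |: (y |: X :\: [set x; y]) = X.
Proof.
move=> xX yX; apply/setP => u; rewrite !inE.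
case: (eqVneq u x) => [->|_]; first by rewrite xX.
by case: (eqVneq u y) => [->|_]; first by rewrite yX.
Qed.

Lemma setUD3 X x y z : x \in X -> y \in X -> z \in X ->
  x |: (y |: (z |: X :\: [set x; y; z])) = X.
Proof.
move=> xX yX zX; apply/setP => u; rewrite !inE.
case: (eqVneq u x) => [->|_]; first by rewrite xX.
case: (eqVneq u y) => [->|_]; first by rewrite yX.
by case: (eqVneq u z) => [->|_]; first by rewrite zX.
Qed.

Lemma closed_upD X (A : {set T}) : closed_up X -> r \notin A ->
  (forall c, c \in X -> par c \in A -> c \in A) -> closed_up (X :\: A).
Proof.
move=> [rX cX] rA hA; split=> [|x]; first by rewrite inE rA rX.
by rewrite !inE => /andP[xA xX]; rewrite cX // andbT; apply: contra xA => /hA; apply.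
Qed.

(** The only neighbour of such a vertex is its parent, which cannot be both the neighbour in [D] and
    the neighbour outside [D] that a vertex outside [D] must have. *)
Lemma rcode_leaf_mem X D c : rcode X D -> closed_up X -> c \in X -> c != r ->
  (forall d, d \in X -> par d != c) -> c \in D.
Proof.
move=> [/subsetP sD dom _ leaf] clX cX cr cl; apply/negPn/negP => cD.
have nb u : u \in X -> nr c u -> u != c -> u = par c.
  move=> uX; rewrite /nr => /or3P[/eqP->|/eqP->//|e]; first by rewrite eqxx.
  by move: (cl u uX); rewrite e.
have [d dD cd] := dom c cX cD; have [u [uX uD uc cu]] := leaf c cX cD.
have dc : d != c by apply: contra cD => /eqP<-.
by move: uD; rewrite (nb u) // -(nb d) ?dD ?sD.
Qed.

(** The deepest vertex y0 is childless, hence in [D], and packing keeps y1 and y2 out of [D].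
    Another child of y1 would be a second member of [D] adjacent to y1. If y2 has a further child,
    then y0, y1 are pruned; otherwise y2 can only be dominated by y3, so y3 has label A and y0, y1,
    y2 are pruned. *)
Lemma rcode_built X D : closed_up X -> r \in D -> rcode X D -> built X D.
Proof.
move: {2}#|X| (leqnn #|X|) => n; elim: n X D => [|n IHn] X D.
  by rewrite leqn0 cards_eq0 => /eqP-> [] ; rewrite inE.
move=> szX clX rD codeX; have [rX cX] := clX.
have [/subsetP sD dom pack leaf] := codeX.
case: (eqVneq X [set r]) => [eX|nX].
  suff -> : D = [set r] by rewrite eX; exact: built_root.
  apply/eqP; rewrite eqEsubset sub1set rD andbT; apply/subsetP => u /sD.
  by rewrite eX.
have [y0 [y0X y0r ymax]] := deepest clX nX.
have leafy := deepest_leaf ymax y0r.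
have leafD c := @rcode_leaf_mem X D c codeX clX.
have y0D : y0 \in D by apply: leafD.
set y1 := par y0 in leafy *; set y2 := par y1.
have y1X : y1 \in X by exact: cX.
have y2X : y2 \in X by exact: cX.
have nr01 : nr y1 y0 by rewrite /nr eqxx !orbT.
have y01 : y1 != y0 by exact: par_neq.
have y1D : y1 \notin D.
  by apply: contra y01 => y1D; apply/eqP/(pack y1) => //; exact: nr_refl.
have y1r : y1 != r by apply: contraNneq y1D => ->.
have y12 : y2 != y1 by exact: par_neq.
have y02 : y2 != y0 by exact: par2_neq.
have nr12 : nr y1 y2 by rewrite /nr eqxx !orbT.
have y2D : y2 \notin D.
  by apply: contra y02 => y2D; apply/eqP/(pack y1).
have only0 c : c \in X -> par c = y1 -> c = y0.
  move=> cXX cy1; apply: (pack y1) => //; last by rewrite /nr cy1 eqxx !orbT.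
  apply: leafD => //.
    by apply: contraNneq y1r => e; rewrite -cy1 e par_r.
  have cr : c != r by apply: contraNneq y1r => e; rewrite -cy1 e par_r.
  apply: (deepest_leaf _ cr) => u uX.
  by rewrite (depP cr) cy1 -(depP y0r) ymax.
have y2r : y2 != r by apply: contraNneq y2D => ->.
set y3 := par y2.
have y3X : y3 \in X by exact: cX.
have y23 : y3 != y2 by exact: par_neq.
have y13 : y3 != y1 by exact: par2_neq.
have y03 : y3 != y0 by exact: leafy.
(* Domination and packing survive both prunings for the same reason: y0 is the only member of [D]
   removed and its only other neighbour y1 is removed too. The neighbours outside [D] depend on the
   case. *)
have codeD0 (A : {set T}) : y0 \in A -> A \subset X :\: D :|: [set y0] ->
    (forall x, x \in X -> x \notin D -> x \notin A -> exists u, [/\ u \in X :\: A, u \notin D, u != x & nr x u]) ->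
    y1 \in A ->
    rcode (X :\: A) (D :\ y0).
  move=> y0A /subsetP sA leafA y1A; split.
  - apply/subsetP => u; rewrite !inE => /andP[u0 uD]; rewrite sD // andbT.
    by apply/negP => /sA; rewrite !inE (negPf u0) uD.
  - move=> x; rewrite !inE => /andP[xA xXX]; rewrite negb_and negbK => /orP[/eqP e|xD].
      by rewrite e y0A in xA.
    have [d dD xd] := dom x xXX xD; exists d; rewrite // !inE dD andbT.
    apply: contra xA => /eqP e; move: xd; rewrite /nr e.
    by case/or3P=> [/eqP->//|/eqP e'|/eqP<-//]; move: (leafy x xXX); rewrite e' eqxx.
  - move=> x d e; rewrite !inE => /andP[_ xXX] /andP[_ dD] /andP[_ eD].
    exact: pack.
  - move=> x; rewrite !inE => /andP[xA xXX]; rewrite negb_and negbK => /orP[/eqP e|xD].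
      by rewrite e y0A in xA.
    have [u [uX uD ux xu]] := leafA x xXX xD xA; exists u; split=> //.
    by rewrite !inE negb_and uD orbT.
case: (pickP (fun w => [&& w \in X, par w == y2 & w != y1])) => [w /and3P[wX /eqP wy2 wy1]|onlyw].
- have wr : w != r by apply: contraNneq y2r => e; rewrite -wy2 e par_r.
  have w0 : w != y0 by apply: contraNneq y12 => e; rewrite -wy2 e.
  have cX0 : closed_up (X :\: [set y1; y0]).
    apply: closed_upD => //; first by rewrite !inE negb_or ![r == _]eq_sym y1r.
    move=> c cXX; rewrite !inE => /orP[/eqP e|e]; last by rewrite (negPf (leafy c cXX)) in e.
    by rewrite (only0 c) ?eqxx ?orbT.
  rewrite -(setUD2 y1X y0X) -(setD1K y0D); apply: built_path2 => //.
  + apply: IHn => //; last apply: codeD0.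
    * rewrite -ltnS; apply: leq_trans szX; apply: proper_card.
      by apply/properP; split; [exact: subsetDl | exists y0; rewrite ?inE ?eqxx ?orbT].
    * by rewrite !inE rD andbT eq_sym.
    * by rewrite !inE eqxx orbT.
    * by apply/subsetP => u; rewrite !inE => /orP[/eqP->|/eqP->]; rewrite ?y1D ?y1X ?eqxx ?orbT.
    * move=> x xXX xD xA; have [u [uX uD ux xu]] := leaf x xXX xD.
      have u0 : u != y0 by apply: contraNneq uD => ->.
      case: (eqVneq u y1) => [e|u1]; last by exists u; rewrite !inE negb_or u0 u1.
      move: xA; rewrite !inE negb_or => /andP[x1 x0].
      have ex : x = y2.
        move: xu; rewrite e /nr (negPf x1) /= => /orP[/eqP/(only0 x xXX) ex|/eqP//].
        by rewrite ex eqxx in x0.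
      (* Only y2 can have lost its neighbour outside [D]. If w is in [D], then packing at y2 keeps
         y3 out of [D]; otherwise w itself serves. *)
      subst x; case: (boolP (w \in D)) => wD.
        exists y3; rewrite !inE negb_or y13 y03 y3X y23 /nr eqxx orbT; split=> //.
        apply/negP => y3D; have e3 : y3 = w.
          by apply: (pack y2) => //; rewrite /nr ?wy2 eqxx ?orbT.
        by have := par2_neq wr; rewrite wy2 -/y3 e3 eqxx => /(_ y2r).
      exists w; rewrite !inE negb_or wX wy1 w0 wD /nr wy2 eqxx !orbT; split=> //.
      by rewrite -wy2 eq_sym par_neq.
    * by rewrite !inE eqxx.
  + by rewrite !inE negb_or y2X y12 y02.
  + by rewrite !inE (negPf y2D) andbF.
  + by rewrite !inE eqxx.
  + by rewrite !inE eqxx orbT.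
have only1 c : c \in X -> par c = y2 -> c = y1.
  by move=> cXX cy2; have := onlyw c; rewrite /= cXX cy2 eqxx => /negbT; rewrite negbK => /eqP.
have cX0 : closed_up (X :\: [set y2; y1; y0]).
  apply: closed_upD => //; first by rewrite !inE !negb_or ![r == _]eq_sym y1r y2r.
  move=> c cXX; rewrite !inE => /orP[/orP[/eqP e|/eqP e]|e].
  - by rewrite (only1 c) ?eqxx ?orbT.
  - by rewrite (only0 c) ?eqxx ?orbT.
  - by rewrite (negPf (leafy c cXX)) in e.
have y3D : y3 \in D.
  have [d dD] := dom y2 y2X y2D; rewrite /nr => /or3P[/eqP e|/eqP e|/eqP /(only1 d (sD _ dD)) e].
  - by rewrite e dD in y2D.
  - by rewrite /y3 e.
  - by rewrite -e dD in y1D.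
rewrite -(setUD3 y2X y1X y0X) -(setD1K y0D); apply: built_path3 => //.
- apply: IHn => //; last apply: codeD0.
  + rewrite -ltnS; apply: leq_trans szX; apply: proper_card.
    by apply/properP; split; [exact: subsetDl | exists y0; rewrite ?inE ?eqxx ?orbT].
  + by rewrite !inE rD andbT eq_sym.
  + by rewrite !inE eqxx orbT.
  + apply/subsetP => u; rewrite !inE => /orP[/orP[]|] /eqP->; rewrite ?eqxx ?orbT //.
      by rewrite y2D y2X.
    by rewrite y1D y1X.
  + move=> x xXX xD xA; have [u [uX uD ux xu]] := leaf x xXX xD.
    have u0 : u != y0 by apply: contraNneq uD => ->.
    move: xA; rewrite !inE !negb_or => /andP[/andP[x2 x1] x0].
    case: (eqVneq u y1) => [e|u1].
      move: xu; rewrite e /nr (negPf x1) /= => /orP[/eqP/(only0 x xXX) ex|/eqP ex].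
        by rewrite ex eqxx in x0.
      by rewrite -ex eqxx in x2.
    case: (eqVneq u y2) => [e|u2]; last by exists u; rewrite !inE !negb_or u0 u1 u2.
    move: xu; rewrite e /nr (negPf x2) /= => /orP[/eqP/(only1 x xXX) ex|/eqP ex].
      by rewrite ex eqxx in x1.
    by rewrite -ex y3D in xD.
  + by rewrite !inE eqxx orbT.
- by rewrite !inE y03.
- by rewrite !inE eqxx.
- by rewrite !inE eqxx orbT.
- by rewrite !inE eqxx orbT.
Qed.

(** Let y be in A but not in B, and let q in B dominate y; packing of A keeps q out of A. If q is a
    child of y, it is the deeper difference. If q is the parent, y has a child s outside B, and the
    member t of B dominating s lies below s; it is not in A, because s is already adjacent to y. *)
Lemma rcode_uniq D D' : r \in D -> r \in D' -> rcode setT D -> rcode setT D' -> D = D'.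
Proof.
suff sub (A B : {set T}) : r \in B -> rcode setT A -> rcode setT B ->
    (forall y, y \in A -> y \notin B ->
       exists2 z, dep y < dep z & (z \in A) (+) (z \in B)).
  move=> rD rD' cD cD'; apply/setP => x; apply/eqP/negPn/negP => nx.
  have {}nx : (x \in D) (+) (x \in D') by move: nx; case: (x \in D); case: (x \in D').
  have [y] := @arg_maxnP T x (fun x => (x \in D) (+) (x \in D')) dep nx.
  case: (boolP (y \in D)) => yD yD' ymax.
    have [z lt_yz nz] := sub D D' rD' cD cD' y yD yD'.
    by have: dep z <= dep y by [exact: ymax]; rewrite leqNgt lt_yz.
  have [z lt_yz nz] := sub D' D rD cD' cD y yD' yD.
  have: dep z <= dep y by apply: ymax; rewrite /= addbC.
  by rewrite leqNgt lt_yz.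
move=> rB cA cB y yA yB.
have yr : y != r by apply: contraNneq yB => ->.
have [_ _ packA _] := cA; have [_ domB packB leafB] := cB.
have child u : u != y -> nr y u -> u != par y -> u != r /\ par u = y.
  move=> uy; rewrite /nr eq_sym (negPf uy) /= => /orP[/eqP->|/eqP e _].
    by rewrite eqxx.
  by split=> //; apply: contraNneq yr => ur; rewrite -e ur par_r.
have deep u v : u != r -> par u = v -> dep v < dep u by move=> ur <-; rewrite (depP ur).
have [q qB yq] := domB y (in_setT _) yB.
have qy : q != y by apply: contraNneq yB => <-.
have qA : q \notin A.
  by apply: contra qy => qA; apply/eqP/(packA y) => //; rewrite ?inE ?nr_refl.
case: (eqVneq q (par y)) => [eq|qp]; last first.
  have [qr pq] := child q qy yq qp.
  by exists q; [exact: deep | rewrite qB (negPf qA)].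
have [s [_ sB sy ys]] := leafB y (in_setT _) yB.
have sp : s != par y by apply: contraNneq sB => ->; rewrite -eq.
have [sr ps] := child s sy ys sp.
have [t tB st] := domB s (in_setT _) sB.
have ty : t != y by apply: contraNneq yB => <-.
have ts : t != s by apply: contraNneq sB => <-.
have tA : t \notin A.
  apply: contra ty => tA; apply/eqP/(packA s) => //; rewrite ?inE //.
  by rewrite nr_sym.
have [pt tr] : par t = s /\ t != r.
  move: st; rewrite /nr eq_sym (negPf ts) ps eq_sym (negPf ty) /= => /eqP pt.
  by split=> //; apply: contraNneq sr => e; rewrite -pt e par_r.
exists t; last by rewrite tB (negPf tA).
by apply: (ltn_trans (deep s y sr ps)); apply: deep.
Qed.

End Rooted.

(** * Subdivided rooted trees *)

Section Points.
Variables (T : finType) (par : T -> T).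
Implicit Types (x y z u v w : T) (X Y D S : {set T}) (p q : T + T) (C B : {set T + T}).
Implicit Types (E F : pred (T + T)).

(* [inl x] is the vertex x; for x in S, the edge from x to its parent is
   subdivided and [inr x] is the new vertex.  [cl S] is closed adjacency. *)
Definition cl S p q : bool := match p, q with
  | inl x, inl y => [|| x == y, (par x == y) && (x \notin S) | (par y == x) && (y \notin S)]
  | inl x, inr y | inr y, inl x => (x == y) || (x == par y)
  | inr x, inr y => x == y
  end.

Definition pts X S : {set T + T} :=
  [set p | match p with inl x => x \in X | inr x => x \in S end].

Definition cov S C p := [exists q in C, cl S p q].

(** [E] collects the points exempt from domination; with [pred0] these are the dominating sets of
    the subdivided subtree. *)
Definition domx X S (E : pred (T + T)) C :=
  C \subset pts X S /\ forall p, p \in pts X S -> ~~ E p -> cov S C p.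

Lemma cl_refl S p : cl S p p.
Proof. by case: p => x /=; rewrite eqxx. Qed.

Lemma covI S C p q : q \in C -> cl S p q -> cov S C p.
Proof. by move=> qC pq; apply/existsP; exists q; rewrite qC. Qed.

Lemma cov_mem S C p : p \in C -> cov S C p.
Proof. by move=> pC; apply: covI pC (cl_refl _ _). Qed.

Lemma inl_pts X S x : (inl x \in pts X S) = (x \in X). Proof. by rewrite inE. Qed.
Lemma inr_pts X S x : (inr x \in pts X S) = (x \in S). Proof. by rewrite inE. Qed.

Lemma cl_restr X S p q : p \in pts X (S :&: X) -> q \in pts X (S :&: X) ->
  cl (S :&: X) p q = cl S p q.
Proof.
case: p => x; case: q => y //; rewrite !inE /= !inE => xX yX.
by rewrite xX yX !andbT.
Qed.

Lemma cov_restr X S C B p : C \subset pts X (S :&: X) -> p \in pts X (S :&: X) ->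
  cov (S :&: X) C p -> cov S (C :|: B) p.
Proof.
move=> /subsetP sC pX /existsP[q /andP[qC pq]]; apply: (@covI _ _ _ q).
  by rewrite inE qC.
by rewrite -(cl_restr pX (sC q qC)).
Qed.

(** Closed adjacency between points of the smaller subtree is the same for [S] and [S :&: X], so
    after adding [B] only the formerly exempt points and the new points remain to be checked. *)
Lemma domx_glue X S Y E F C B :
  domx X (S :&: X) E C -> X \subset Y -> B \subset pts Y S ->
  (forall p, p \in pts X (S :&: X) -> E p -> ~~ F p -> cov S (C :|: B) p) ->
  (forall x, x \in Y -> x \notin X -> ~~ F (inl x) -> cov S (C :|: B) (inl x)) ->
  (forall x, x \in S -> x \notin X -> ~~ F (inr x) -> cov S (C :|: B) (inr x)) ->
  domx Y S F (C :|: B).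
Proof.
move=> [sC covC] sXY sB hE hl hr; split.
  rewrite subUset sB andbT; apply: (subset_trans sC); apply/subsetP => -[x|x]; rewrite !inE.
    exact: (subsetP sXY).
  by case/andP.
move=> p pY nF.
case: (boolP (p \in pts X (S :&: X))) => pX.
  case: (boolP (E p)) => [Ep|nE]; first exact: hE.
  exact: cov_restr (covC _ pX nE).
case: p pY nF pX => x; rewrite !inE => xY nF; first by move=> xX; exact: hl.
by rewrite xY /= => xX; exact: hr.
Qed.

(* Both dominate the edge from x to its parent completely: its two ends and, when
   it is subdivided, its middle. *)
Definition low S x : T + T := if x \in S then inr x else inl x.
Definition top S x : T + T := if x \in S then inr x else inl (par x).

Lemma low_pts X S x : x \in X -> low S x \in pts X S.
Proof. by rewrite /low; case: ifP; rewrite inE. Qed.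

Lemma top_pts X S x : par x \in X -> top S x \in pts X S.
Proof. by rewrite /top; case: ifP; rewrite inE. Qed.

Lemma cl_low S x : cl S (inl x) (low S x).
Proof. by rewrite /low; case: ifP => xS /=; rewrite eqxx. Qed.

Lemma cl_low_par S x : cl S (inl (par x)) (low S x).
Proof. by rewrite /low; case: ifP => xS /=; rewrite eqxx ?xS ?orbT. Qed.

Lemma cl_low_mid S x : cl S (inr x) (low S x).
Proof. by rewrite /low; case: ifP => xS /=; rewrite eqxx. Qed.

Lemma cl_top S x : cl S (inl x) (top S x).
Proof. by rewrite /top; case: ifP => xS /=; rewrite eqxx ?xS ?orbT. Qed.

Lemma cl_top_par S x : cl S (inl (par x)) (top S x).
Proof. by rewrite /top; case: ifP => xS /=; rewrite eqxx ?orbT. Qed.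

Lemma cl_top_mid S x : cl S (inr x) (top S x).
Proof. by rewrite /top; case: ifP => xS /=; rewrite eqxx ?orbT. Qed.

Lemma cl_par S x : x \notin S -> cl S (inl x) (inl (par x)).
Proof. by move=> xS /=; rewrite eqxx xS !orbT. Qed.

Lemma cl_child S x : x \notin S -> cl S (inl (par x)) (inl x).
Proof. by move=> xS /=; rewrite eqxx xS !orbT. Qed.

Lemma cl_mid_par S x : cl S (inr x) (inl (par x)).
Proof. by rewrite /= eqxx orbT. Qed.

Lemma cl_mid S x : cl S (inr x) (inl x).
Proof. by rewrite /= eqxx. Qed.

Lemma cl_sym S p q : cl S p q = cl S q p.
Proof.
case: p => x; case: q => y //=; rewrite eq_sym //.
by congr orb; rewrite orbC.
Qed.

Lemma cardsU_le (A : finType) (C B : {set A}) n m : #|C| <= n -> #|B| <= m -> #|C :|: B| <= n + m.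
Proof. by move=> cn bm; apply: leq_trans (leq_card_setU _ _) (leq_add cn bm). Qed.

Lemma addn_le0 a b : a + b <= b -> a = 0.
Proof. lia. Qed.

(** The quantity [#|C| + (v \notin C)] of [flex_one] says that either v is in the set, and so is
    dominated, or one vertex of the budget is still available for v. It behaves well when vertices
    are added. *)
Lemma cardU_missing (A : finType) (C B : {set A}) (v : A) m k :
  #|C| + (v \notin C) <= m -> #|B| <= k -> #|C :|: B| + (v \notin C :|: B) <= m + k.
Proof.
move=> Cm Bk; have : #|C :|: B| <= #|C| + #|B| := leq_card_setU C B.
by move: Cm Bk; rewrite inE; case: (v \in C) => //=; case: (v \in B) => /=; lia.
Qed.

Lemma card_set2 (A : finType) (a b : A) : #|[set a; b]| <= 2.
Proof. by rewrite cards2; case: (a != b). Qed.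

Lemma card_inl D : #|[set inl d | d in D] : {set T + T}| = #|D|.
Proof. by apply: card_imset => x y []. Qed.

Lemma mem_inl D x : ((inl x : T + T) \in [set inl d | d in D]) = (x \in D).
Proof. by apply: mem_imset => u v []. Qed.

Lemma rcode_domx X D : rcode par X D -> domx X set0 pred0 [set inl d | d in D].
Proof.
case=> /subsetP sD dom _ _; split.
  by apply/subsetP => _ /imsetP[d /sD dX ->]; rewrite inE.
case=> x; rewrite !inE // => xX _.
case: (boolP (x \in D)) => xD; first by apply: cov_mem; rewrite mem_inl.
have [d dD xd] := dom x xX xD; apply: (@covI _ _ _ (inl d)); first by rewrite mem_inl.
by rewrite /= !inE !andbT.
Qed.

End Points.

(** * Upper bounds after few subdivisions: attaching a path with two vertices *)

Section UpperBound.
Variables (T : finType) (r : T) (par : T -> T) (dep : T -> nat).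
Hypothesis par_r : par r = r.
Hypothesis depP : forall x, x != r -> dep x = (dep (par x)).+1.

Notation cl := (cl par).
Notation cov := (cov par).
Notation domx := (domx par).
Notation built := (built r par).
Notation top := (top par).
Implicit Types (x y z u v w : T) (X Y D S : {set T}) (p q : T + T) (C B : {set T + T}).
Implicit Types (E F : pred (T + T)).

(* The induction hypotheses needed to carry [flex_two] through the two
   operations: [flex_omit] and [flex_one] when a path is attached at an A-vertex
   v, which must possibly be dominated from the path, [flex_use] when it is
   attached at a B-vertex b, which must possibly dominate the path. *)
Record flexible X D : Prop := Flexible {
  flex_omit : forall v, v \in D ->
    exists2 C, domx X set0 (pred1 (inl v)) C & #|C| < #|D|;
  flex_use : forall b, b \in X -> b \notin D ->
    exists C, [/\ domx X set0 pred0 C, inl b \in C & #|C| <= #|D|];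
  flex_one : forall v S, v \in D -> S \subset X -> r \notin S -> #|S| <= 1 ->
    exists2 C, domx X S (pred1 (inl v)) C & #|C| + (inl v \notin C) <= #|D|;
  flex_two : forall S, S \subset X -> r \notin S -> #|S| <= 2 ->
    exists2 C, domx X S pred0 C & #|C| <= #|D| }.

(** In [flex_two] the one additional vertex is [top S y]. It dominates x, y and the middle of the
    edge at y, and also the middle of the edge at x unless both new edges are subdivided. In that
    case no edge of the old tree is subdivided, and [flex_use] provides a set containing the
    attaching vertex, which dominates the missing middle. *)
Lemma flexible_path2 X D x y : built X D -> flexible X D ->
    par x \in X -> par x \notin D -> x \notin X -> y \notin X -> par y = x ->
  flexible (x |: (y |: X)) (y |: D).
Proof.
move=> bX [omit use one two] pxX pxD xX yX py.
have [[rX cX] sD rD] := built_closed par_r bX.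
have codeX := built_rcode par_r depP bX.
have yD : y \notin D by apply: contra yX => /(subsetP sD).
have cD : #|y |: D| = #|D|.+1 by rewrite cardsU1 yD.
set Y := x |: (y |: X).
have sXY : X \subset Y by apply/subsetP => u; rewrite !inE => ->; rewrite !orbT.
have xY : x \in Y by rewrite !inE eqxx.
have yY : y \in Y by rewrite !inE eqxx orbT.
have newY u : u \in Y -> u \notin X -> u = x \/ u = y.
  by rewrite !inE => /or3P[/eqP->|/eqP->|->] //; [left | right].
have yr : y != r by apply: contraNneq yX => ->.
have nxy : x != y by rewrite -py (par_neq depP).
have cS S : S \subset Y -> #|S| = #|S :&: X| + (x \in S) + (y \in S).
  move=> sS; rewrite [in LHS](cardsD1 x) [in LHS](cardsD1 y) !inE eq_sym (negPf nxy) /=.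
  suff -> : S :\ x :\ y = S :&: X by rewrite addnA addnC addnA.
  apply/setP => u; rewrite !inE.
  case: (boolP (u \in X)) => uX; rewrite ?andbT ?andbF.
    by rewrite (notin_neq uX xX) (notin_neq uX yX).
  apply/negbTE/negP => /and3P[uy ux uS].
  by have [e|e] := newY u (subsetP sS _ uS) uX; rewrite e eqxx in ux uy.
have S0 S : S \subset Y -> #|S| <= (x \in S) + (y \in S) -> S :&: X = set0.
  move=> sS; rewrite (cS S sS) -addnA => /addn_le0; exact: cards0_eq.
have sSX S : S :&: X \subset X by exact: subsetIr.
have rSX S : r \notin S -> r \notin S :&: X by rewrite inE => /negPf->.
have glue S C B E F :
    S \subset Y -> domx X (S :&: X) E C -> B \subset pts Y S ->
    (forall p, p \in pts X (S :&: X) -> E p -> ~~ F p -> cov S (C :|: B) p) ->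
    (~~ F (inl x) -> cov S (C :|: B) (inl x)) ->
    (~~ F (inl y) -> cov S (C :|: B) (inl y)) ->
    (x \in S -> ~~ F (inr x) -> cov S (C :|: B) (inr x)) ->
    (y \in S -> ~~ F (inr y) -> cov S (C :|: B) (inr y)) ->
    domx Y S F (C :|: B).
  move=> sS dC sB hE h1 h2 h3 h4; apply: (domx_glue dC) => // u uY uX.
    by have [->|->] := newY u uY uX.
  by have [e|e] := newY u (subsetP sS _ uY) uX; subst u; [exact: h3 | exact: h4].
have dD := rcode_domx codeX; have cDi := card_inl D.
have pyT S : S \subset Y -> [set top S y] \subset pts Y S.
  by move=> _; rewrite sub1set; apply: top_pts; rewrite py.
have topC S C B : y \notin S \/ (x \notin S \/ inl (par x) \in C) -> top S y \in B ->
   [/\ cov S (C :|: B) (inl x), cov S (C :|: B) (inl y),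
    (x \in S -> cov S (C :|: B) (inr x)) & (y \in S -> cov S (C :|: B) (inr y))].
  move=> h tB; have tC : top S y \in C :|: B by rewrite inE tB orbT.
  split=> [|||_]; try by apply: covI tC _; rewrite -?py ?cl_top ?cl_top_par ?cl_top_mid.
  move=> xS; case: h => [yS|[/negP//|pC]].
    by apply: covI tC _; rewrite /top (negPf yS) py cl_mid.
  by apply: (@covI _ _ _ _ _ (inl (par x))); rewrite ?cl_mid_par // inE pC.
have noS (S : {set T}) : (x \notin S) && (y \notin S) || (0 < (x \in S) + (y \in S)).
  by case: (x \in S); case: (y \in S).
have [Cp [dCp pCp cCp]] := use _ pxX pxD.
have sub0Y : set0 \subset Y by exact: sub0set.
have e0 : set0 = set0 :&: X by rewrite set0I.
have xB : [set inl x] \subset pts Y set0 by rewrite sub1set inE.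
split.
- move=> v; rewrite !inE => /orP[/eqP->|vD].
    exists (Cp :|: set0); last by rewrite setU0 cD.
    rewrite e0 in dCp; apply: (glue _ _ _ _ _ sub0Y dCp) => //; rewrite ?inE ?eqxx //.
      exact: sub0set.
    move=> _; apply: (@covI _ _ _ _ _ (inl (par x))); rewrite ?cl_par ?inE //.
    by rewrite pCp.
  have [C dC lC] := omit v vD.
  exists (C :|: [set inl x]); last first.
    rewrite cD ltnS; apply: leq_trans lC; rewrite -addn1.
    by apply: cardsU_le => //; rewrite cards1.
  rewrite e0 in dC; apply: (glue _ _ _ _ _ sub0Y dC) => //; rewrite ?inE //.
  + by move=> p _ ->.
  + by move=> _; apply: cov_mem; rewrite !inE eqxx orbT.
  + move=> _; apply: (@covI _ _ _ _ _ (inl x)); rewrite ?inE ?eqxx ?orbT //.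
    by rewrite -py cl_par ?inE.
- move=> b bY; rewrite !inE negb_or => /andP[by' bD].
  have [C [dC bC cC]] : exists C, [/\ domx X set0 pred0 C, inl b \in C :|: [set inl x] & #|C| <= #|D|].
    have [bX'|bX'] := boolP (b \in X).
      by have [C [? h ?]] := use b bX' bD; exists C; rewrite inE h.
    have [e|e] := newY b bY bX'; last by rewrite e eqxx in by'.
    by exists [set inl d | d in D]; rewrite cDi e !inE eqxx orbT.
  exists (C :|: [set inl x]); split=> //; last first.
    by rewrite cD -addn1; apply: cardsU_le => //; rewrite cards1.
  rewrite e0 in dC; apply: (glue _ _ _ _ _ sub0Y dC) => //; rewrite ?inE //.
  + by move=> _; apply: cov_mem; rewrite !inE eqxx orbT.
  + move=> _; apply: (@covI _ _ _ _ _ (inl x)); rewrite ?inE ?eqxx ?orbT //.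
    by rewrite -py cl_par ?inE.
- move=> v S; rewrite in_setU1 => /orP[/eqP->|vD] sS rS S1.
    have zB : [set inl y] \subset pts Y S by rewrite sub1set inE.
    have yC C : inl y \in C :|: [set inl y] by rewrite !inE eqxx orbT.
    case/orP: (noS S) => [/andP[xS yS]|n0].
      have [|C dC lC] := two (S :&: X) (sSX S) (rSX S rS).
        by apply: leq_trans (subset_leq_card (subsetIl S X)) (leq_trans S1 _).
      exists (C :|: [set inl y]); last first.
        by rewrite yC addn0 cD -addn1; apply: cardsU_le => //; rewrite cards1.
      apply: (glue _ _ _ _ _ sS dC) => //; rewrite ?inE ?eqxx ?(negPf xS) ?(negPf yS) //.
      by move=> _; apply: covI (yC _) _; rewrite -py cl_child.
    have eS : set0 = S :&: X by rewrite S0 // (leq_trans S1).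
    exists (Cp :|: [set inl y]); last first.
      by rewrite yC addn0 cD -addn1; apply: cardsU_le => //; rewrite cards1.
    have dCp' := dCp; rewrite eS in dCp'.
    have pC : inl (par x) \in Cp :|: [set inl y] by rewrite inE pCp.
    apply: (glue _ _ _ _ _ sS dCp') => //; rewrite ?inE ?eqxx //.
    + move=> _; case: (boolP (x \in S)) => xS; last by apply: covI pC _; rewrite cl_par.
      have yS : y \notin S.
        by apply/negP => yS; move: S1; rewrite (cS S sS) xS yS addn1 addnC.
      by apply: covI (yC _) _; rewrite -py cl_child.
    + by move=> _ _; apply: covI pC _; rewrite cl_mid_par.
    + by move=> _ _; apply: covI (yC _) _; rewrite cl_mid.
  case/orP: (noS S) => [/andP[xS yS]|n0].
    have [|C dC lC] := one v (S :&: X) vD (sSX S) (rSX S rS).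
      exact: leq_trans (subset_leq_card (subsetIl S X)) S1.
    exists (C :|: [set top S y]); last first.
      by rewrite cD -addn1; apply: cardU_missing => //; rewrite cards1.
    have [h1 h2 h3 h4] := topC S C [set top S y] (or_introl yS) (set11 _).
    apply: (glue _ _ _ _ _ sS dC) => //; rewrite ?pyT //; first by move=> p _ ->.
    * by move=> xS'; rewrite xS' in xS.
    * by move=> yS'; rewrite yS' in yS.
  have eS : set0 = S :&: X by rewrite S0 // (leq_trans S1).
  rewrite eS in dD.
  exists ([set inl d | d in D] :|: [set top S y]); last first.
    have -> : inl v \notin [set inl d | d in D] :|: [set top S y] = false.
      by rewrite inE mem_inl vD.
    by rewrite addn0 cD -addn1; apply: cardsU_le; rewrite ?cards1 ?cDi.
  have [|h1 h2 h3 h4] := topC S [set inl d | d in D] [set top S y] _ (set11 _).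
    case: (boolP (y \in S)) => yS; [right; left | by left].
    by apply/negP => xS; move: S1; rewrite (cS S sS) xS yS addn1 addnC.
  by apply: (glue _ _ _ _ _ sS dD) => //; rewrite ?pyT // => ? _; auto.
- move=> S sS rS S2.
  have [C [dC cC xyC]] : exists C, [/\ domx X (S :&: X) pred0 C, #|C| <= #|D| &
      y \notin S \/ (x \notin S \/ inl (par x) \in C)].
    case: (boolP ((x \in S) && (y \in S))) => [/andP[xS yS]|nxS].
      exists Cp; have -> : S :&: X = set0 by rewrite S0 // xS yS.
      by split=> //; right; right.
    have [|C dC lC] := two (S :&: X) (sSX S) (rSX S rS).
      exact: leq_trans (subset_leq_card (subsetIl S X)) S2.
    exists C; split=> //; move: nxS; rewrite negb_and => /orP[xS|yS]; last by left.
    by right; left.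
  exists (C :|: [set top S y]); last first.
    by rewrite cD -addn1; apply: cardsU_le; rewrite ?cards1.
  have [h1 h2 h3 h4] := topC S C [set top S y] xyC (set11 _).
  by apply: (glue _ _ _ _ _ sS dC) => //; rewrite ?pyT // => ? _; auto.
Qed.

End UpperBound.

(** * Upper bounds after few subdivisions: attaching a path with three vertices *)

Section UpperBound.
Variables (T : finType) (r : T) (par : T -> T) (dep : T -> nat).
Hypothesis par_r : par r = r.
Hypothesis depP : forall x, x != r -> dep x = (dep (par x)).+1.

Notation cl := (cl par).
Notation cov := (cov par).
Notation domx := (domx par).
Notation built := (built r par).
Notation top := (top par).
Notation flexible := (flexible r par).
Implicit Types (x y z u v w : T) (X D S : {set T}) (p q : T + T) (C B : {set T + T}).

Lemma leq_addsub a b k l : a + b <= k -> l <= b -> a <= k - l.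
Proof. lia. Qed.

Lemma cardU_two (A : finType) (C : {set A}) (a b : A) m :
  #|C| < m -> #|C :|: [set a; b]| <= m.+1.
Proof.
move=> Cm; apply: leq_trans (cardsU_le (leqnn _) (card_set2 a b)) _.
by rewrite addn2 ltnS.
Qed.

Lemma split3 (a b c : bool) : a + b + c <= 2 -> ~~ [&& a, b & c].
Proof. by case: a; case: b; case: c. Qed.

Lemma split3_one (a b c : bool) : a + b + c <= 1 -> [&& ~~ (a && b), ~~ (a && c) & ~~ (b && c)].
Proof. by case: a; case: b; case: c. Qed.

Lemma split3_zero (a b c : bool) : a + b + c = 0 -> [/\ a = false, b = false & c = false].
Proof. by case: a; case: b; case: c. Qed.

(** The cases are counted by the number of subdivided edges on the new path. With none, one vertex
    at y suffices. With two, the old tree is unsubdivided, and [flex_omit] at [par x] frees a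
    vertex: [low S x] and [top S z] together dominate the new path and [par x]. With one, [flex_one]
    gives either a set containing [par x], completed by [top S z], or a set with a vertex to spare,
    completed by both. *)
Lemma flexible_path3 X D x y z : built X D -> flexible X D ->
    par x \in D -> x \notin X -> y \notin X -> z \notin X -> par y = x -> par z = y ->
  flexible (x |: (y |: (z |: X))) (z |: D).
Proof.
move=> bX [omit use one two] pxD xX yX zX py pz.
have [[rX cX] /subsetP sD rD] := built_closed par_r bX.
have codeX := built_rcode par_r depP bX.
have pxX := sD _ pxD.
have zD : z \notin D by apply: contra zX => /sD.
have cD : #|z |: D| = #|D|.+1 by rewrite cardsU1 zD.
set Y := x |: (y |: (z |: X)).
have sXY : X \subset Y by apply/subsetP => u; rewrite !inE => ->; rewrite !orbT.
have xY : x \in Y by rewrite !inE eqxx.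
have yY : y \in Y by rewrite !inE eqxx orbT.
have zY : z \in Y by rewrite !inE eqxx !orbT.
have newY u : u \in Y -> u \notin X -> [\/ u = x, u = y | u = z].
  by rewrite !inE => /or4P[/eqP->|/eqP->|/eqP->|->] //; [constructor 1|constructor 2|constructor 3].
have yr : y != r by apply: contraNneq yX => ->.
have zr : z != r by apply: contraNneq zX => ->.
have nxy : x != y by rewrite -py (par_neq depP).
have nyz : y != z by rewrite -pz (par_neq depP).
have nxz : x != z by rewrite -py -pz (par2_neq depP) ?pz.
have cS S : S \subset Y -> #|S| = #|S :&: X| + ((x \in S) + (y \in S) + (z \in S)).
  move=> sS; rewrite [in LHS](cardsD1 x) [in LHS](cardsD1 y) [in LHS](cardsD1 z) !inE.
  rewrite [y == x]eq_sym [z == y]eq_sym [z == x]eq_sym (negPf nxy) (negPf nyz) (negPf nxz) /=.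
  suff -> : S :\ x :\ y :\ z = S :&: X by rewrite !addnA addnC !addnA.
  apply/setP => u; rewrite !inE.
  case: (boolP (u \in X)) => uX; rewrite ?andbT ?andbF.
    by rewrite (notin_neq uX xX) (notin_neq uX yX) (notin_neq uX zX).
  apply/negbTE/negP => /and4P[uz uy ux uS].
  by case: (newY u (subsetP sS _ uS) uX) => e; rewrite e eqxx in ux uy uz.
have S0 S : S \subset Y -> #|S| <= (x \in S) + (y \in S) + (z \in S) -> S :&: X = set0.
  by move=> sS; rewrite (cS S sS) => /addn_le0; exact: cards0_eq.
have sSX S : S :&: X \subset X by exact: subsetIr.
have rSX S : r \notin S -> r \notin S :&: X by rewrite inE => /negPf->.
have nle S k : S \subset Y -> #|S| <= k -> (x \in S) + (y \in S) + (z \in S) <= k.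
  by move=> sS; rewrite (cS S sS); apply: leq_trans; rewrite leq_addl.
have mle S k l : S \subset Y -> #|S| <= k -> l <= (x \in S) + (y \in S) + (z \in S) ->
    #|S :&: X| <= k - l.
  by move=> sS; rewrite (cS S sS); exact: leq_addsub.
have glue S C B E F :
    S \subset Y -> domx X (S :&: X) E C -> B \subset pts Y S ->
    (forall p, p \in pts X (S :&: X) -> E p -> ~~ F p -> cov S (C :|: B) p) ->
    [/\ cov S (C :|: B) (inl x), cov S (C :|: B) (inl y),
    ~~ F (inl z) -> cov S (C :|: B) (inl z) &
    [/\ x \in S -> cov S (C :|: B) (inr x),
    y \in S -> cov S (C :|: B) (inr y) &
    z \in S -> cov S (C :|: B) (inr z)]] ->
    domx Y S F (C :|: B).
  move=> sS dC sB hE [h1 h2 h3 [h4 h5 h6]]; apply: (domx_glue dC) => // u uY uX.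
    by case: (newY u uY uX) => ->.
  case: (newY u (subsetP sS _ uY) uX) => e _; subst u; auto.
have dD := rcode_domx codeX; have cDi := card_inl D.
have [Cv [sCv dCv] cCv] := omit _ pxD.
have sub0Y : set0 \subset Y by exact: sub0set.
have e0 : set0 = set0 :&: X by rewrite set0I.
(* Three ways to dominate the new path: with two points, with one point besides [par x], and with
   two points of which one is z, as wanted by [flex_one] at z. *)
have lowtop S C : low S x \in C -> top S z \in C -> ~~ [&& x \in S, y \in S & z \in S] ->
    [/\ cov S C (inl x), cov S C (inl y), cov S C (inl z) &
    [/\ x \in S -> cov S C (inr x),
    y \in S -> cov S C (inr y) &
    z \in S -> cov S C (inr z)]].
  move=> lC tC nS; split; last split.
  + exact: covI lC (cl_low _ _ _).
  + by apply: covI tC _; rewrite -pz cl_top_par.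
  + exact: covI tC (cl_top _ _ _).
  + by move=> _; exact: covI lC (cl_low_mid _ _ _).
  + move=> yS; move: nS; rewrite yS /= negb_and => /orP[xS|zS].
      by apply: covI lC _; rewrite /low (negPf xS) -py cl_mid_par.
    by apply: covI tC _; rewrite /top (negPf zS) pz cl_mid.
  + by move=> _; exact: covI tC (cl_top_mid _ _ _).
have partop S C : inl (par x) \in C -> top S z \in C ->
    (x \in S) + (y \in S) + (z \in S) <= 1 ->
    [/\ cov S C (inl x), cov S C (inl y), cov S C (inl z) &
    [/\ x \in S -> cov S C (inr x),
    y \in S -> cov S C (inr y) &
    z \in S -> cov S C (inr z)]].
  move=> pC tC /split3_one/and3P[xy xz yz]; split; last split.
  + case: (boolP (x \in S)) => xS; last exact: covI pC (cl_par _ xS).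
    rewrite xS /= in xy xz.
    by apply: covI tC _; rewrite /top (negPf xz) pz -py cl_child.
  + by apply: covI tC _; rewrite -pz cl_top_par.
  + exact: covI tC (cl_top _ _ _).
  + by move=> _; exact: covI pC (cl_mid_par _ _ _).
  + move=> yS; rewrite yS /= in yz.
    by apply: covI tC _; rewrite /top (negPf yz) pz cl_mid.
  + by move=> _; exact: covI tC (cl_top_mid _ _ _).
have lowz S C : low S x \in C -> inl z \in C ->
    (x \in S) + (y \in S) + (z \in S) <= 1 ->
    [/\ cov S C (inl x), cov S C (inl y), cov S C (inl z) &
    [/\ x \in S -> cov S C (inr x),
    y \in S -> cov S C (inr y) &
    z \in S -> cov S C (inr z)]].
  move=> lC zC /split3_one/and3P[xy xz yz]; split; last split.
  + exact: covI lC (cl_low _ _ _).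
  + case: (boolP (z \in S)) => zS; last by apply: covI zC _; rewrite -pz cl_child.
    rewrite zS /= !andbT in xz yz.
    by apply: covI lC _; rewrite /low (negPf xz) -py cl_par.
  + exact: cov_mem.
  + by move=> _; exact: covI lC (cl_low_mid _ _ _).
  + move=> yS; rewrite yS andbT in xy.
    by apply: covI lC _; rewrite /low (negPf xy) -py cl_mid_par.
  + by move=> _; exact: covI zC (cl_mid _ _ _).
have tpY S : top S z \in pts Y S by apply: top_pts; rewrite pz.
have lpY S : low S x \in pts Y S by apply: low_pts.
have tB S C : top S z \in C :|: [set top S z] by rewrite !inE eqxx orbT.
have tB2 S C : top S z \in C :|: [set low S x; top S z] by rewrite !inE eqxx !orbT.
have lB2 S C : low S x \in C :|: [set low S x; top S z] by rewrite !inE eqxx !orbT.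
have lzB S C : low S x \in C :|: [set low S x; inl z] by rewrite !inE eqxx !orbT.
have zB S C : inl z \in C :|: [set low S x; inl z] by rewrite !inE eqxx !orbT.
have sT S : [set top S z] \subset pts Y S by rewrite sub1set.
have sLT S : [set low S x; top S z] \subset pts Y S by rewrite subUset !sub1set tpY lpY.
have sLZ S : [set low S x; inl z] \subset pts Y S by rewrite subUset !sub1set lpY inl_pts.
have top0 : top set0 z = inl y by rewrite /top inE pz.
have low0 : low set0 x = inl x by rewrite /low inE.
have covp S C (F : pred (T + T)) : low S x \in C ->
    forall p, p \in pts X (S :&: X) -> pred1 (inl (par x)) p -> ~~ F p -> cov S C p.
  by move=> lC p _ /eqP-> _; apply: covI lC (cl_low_par _ _ _).
have dCvS S : S :&: X = set0 -> domx X (S :&: X) (pred1 (inl (par x))) Cv by move->.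
split.
- move=> v; rewrite in_setU1 => /orP[/eqP->|vD].
    exists (Cv :|: [set low set0 x]); last first.
      by rewrite cD ltnS -addn1 in cCv *; apply: leq_trans cCv; apply: cardsU_le; rewrite ?cards1.
    have lC : low set0 x \in Cv :|: [set low set0 x] by rewrite !inE eqxx orbT.
    apply: (glue _ _ _ _ _ sub0Y (dCvS _ (esym e0))); rewrite ?sub1set //; first exact: covp.
    split; rewrite /= ?eqxx //; first exact: covI lC (cl_low _ _ _).
      by apply: covI lC _; rewrite low0 -py cl_par ?inE.
    by split; rewrite inE.
  have [C dC lC] := omit v vD.
  exists (C :|: [set top set0 z]); last first.
    by rewrite cD ltnS -addn1 in lC *; apply: leq_trans lC; apply: cardsU_le; rewrite ?cards1.
  rewrite e0 in dC; apply: (glue _ _ _ _ _ sub0Y dC) => //; first by move=> p _ ->.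
  have tC := tB set0 C.
  split; last by split; rewrite inE.
  + by apply: covI tC _; rewrite top0 -py cl_child ?inE.
  + by apply: cov_mem; rewrite -top0.
  + by move=> _; apply: covI tC _; rewrite cl_top.
- move=> b bY; rewrite in_setU1 negb_or => /andP[bz bD].
  case: (eqVneq b x) => [->|bx].
    exists (Cv :|: [set low set0 x; top set0 z]); split; last 1 first.
    + by rewrite cD cardU_two.
    + apply: (glue _ _ _ _ _ sub0Y (dCvS _ (esym e0))) => //; first exact: covp.
      by have [|h1 h2 h3 h4] := lowtop set0 _ (lB2 set0 Cv) (tB2 set0 Cv); first by rewrite inE.
    + by rewrite -low0.
  have [C [dC bC cC]] : exists C, [/\ domx X set0 pred0 C, inl b \in C :|: [set inl y] & #|C| <= #|D|].
    have [bX'|bX'] := boolP (b \in X).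
      by have [C [? h ?]] := use b bX' bD; exists C; rewrite inE h.
    case: (newY b bY bX') => e; try by rewrite e eqxx in bx bz.
    by exists [set inl d | d in D]; rewrite cDi e !inE eqxx orbT.
  exists (C :|: [set inl y]); split=> //; last first.
    by rewrite cD -addn1; apply: cardsU_le => //; rewrite cards1.
  rewrite e0 in dC; rewrite -top0; apply: (glue _ _ _ _ _ sub0Y dC) => //.
  have tC := tB set0 C.
  split; last by split; rewrite inE.
  + by apply: covI tC _; rewrite top0 -py cl_child ?inE.
  + by apply: cov_mem; rewrite -top0.
  + by move=> _; apply: covI tC _; rewrite cl_top.
- move=> v S; rewrite in_setU1 => /orP[/eqP->|vD] sS rS S1.
    case: (posnP ((x \in S) + (y \in S) + (z \in S))) => n0.
      have [xS yS zS] := split3_zero n0.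
      have [|C dC lC] := one _ (S :&: X) pxD (sSX S) (rSX S rS).
        exact: leq_trans (subset_leq_card (subsetIl S X)) S1.
      case: (boolP (inl (par x) \in C)) => pC; rewrite ?pC /= in lC.
        have pC' B : inl (par x) \in C :|: B by rewrite inE pC.
        have zC : inl z \in C :|: [set inl z] by rewrite !inE eqxx orbT.
        exists (C :|: [set inl z]); last first.
          by rewrite zC addn0 cD -addn1; apply: cardsU_le; rewrite ?cards1 // -[#|C|]addn0.
        apply: (glue _ _ _ _ _ sS dC) => //; rewrite ?sub1set ?inl_pts //.
          by move=> p _ /eqP-> _; apply: cov_mem.
        split; last by split; rewrite ?xS ?yS ?zS.
        + by apply: covI (pC' _) _; rewrite cl_par ?xS.
        + by apply: covI zC _; rewrite -pz cl_child ?zS.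
        + by rewrite /= eqxx.
      exists (C :|: [set low S x; inl z]); last first.
        by rewrite zB addn0 cD cardU_two // -addn1.
      apply: (glue _ _ _ _ _ sS dC) => //; first exact: covp.
      have [|h1 h2 h3 h4] := lowz S _ (lzB S C) (zB S C); first by rewrite n0.
      by split.
    have eS : S :&: X = set0 by rewrite S0 // (leq_trans S1).
    exists (Cv :|: [set low S x; inl z]); last first.
      by rewrite zB addn0 cD cardU_two.
    apply: (glue _ _ _ _ _ sS (dCvS S eS)) => //; first exact: covp.
    by have [|h1 h2 h3 h4] := lowz S _ (lzB S Cv) (zB S Cv); first exact: nle.
  case: (posnP ((x \in S) + (y \in S) + (z \in S))) => n0.
    have [xS yS zS] := split3_zero n0.
    have [|C dC lC] := one v (S :&: X) vD (sSX S) (rSX S rS).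
      exact: leq_trans (subset_leq_card (subsetIl S X)) S1.
    exists (C :|: [set top S z]); last first.
      by rewrite cD -addn1; apply: cardU_missing => //; rewrite cards1.
    apply: (glue _ _ _ _ _ sS dC) => //; first by move=> p _ ->.
    have tC := tB S C.
    split; last by split; rewrite ?xS ?yS ?zS.
    + by apply: covI tC _; rewrite /top zS pz -py cl_child ?yS.
    + by apply: covI tC _; rewrite -pz cl_top_par.
    + by move=> _; apply: covI tC _; rewrite cl_top.
  have eS : set0 = S :&: X by rewrite S0 // (leq_trans S1).
  rewrite eS in dD.
  exists ([set inl d | d in D] :|: [set top S z]); last first.
    have -> : inl v \notin [set inl d | d in D] :|: [set top S z] = false.
      by rewrite inE mem_inl vD.
    by rewrite addn0 cD -addn1; apply: cardsU_le; rewrite ?cards1 ?cDi.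
  apply: (glue _ _ _ _ _ sS dD) => //.
  have pD : inl (par x) \in [set inl d | d in D] :|: [set top S z].
    by rewrite inE mem_inl pxD.
  by have [|h1 h2 h3 h4] := partop S _ pD (tB S _); first exact: nle.
- move=> S sS rS S2.
  have n2 := nle S 2 sS S2.
  case: (ltnP 1 ((x \in S) + (y \in S) + (z \in S))) => n1.
    have eS : S :&: X = set0 by rewrite S0 // (leq_trans S2).
    exists (Cv :|: [set low S x; top S z]); last first.
      by rewrite cD cardU_two.
    apply: (glue _ _ _ _ _ sS (dCvS S eS)) => //; first exact: covp.
    by have [|h1 h2 h3 h4] := lowtop S _ (lB2 S Cv) (tB2 S Cv); first exact: split3.
  case: (posnP ((x \in S) + (y \in S) + (z \in S))) => n0.
    have [xS yS zS] := split3_zero n0.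
    have [|C dC lC] := two (S :&: X) (sSX S) (rSX S rS).
      exact: leq_trans (subset_leq_card (subsetIl S X)) S2.
    exists (C :|: [set top S z]); last first.
      by rewrite cD -addn1; apply: cardsU_le => //; rewrite cards1.
    apply: (glue _ _ _ _ _ sS dC) => //.
    have tC := tB S C.
    split; last by split; rewrite ?xS ?yS ?zS.
    + by apply: covI tC _; rewrite /top zS pz -py cl_child ?yS.
    + by apply: covI tC _; rewrite -pz cl_top_par.
    + by move=> _; apply: covI tC _; rewrite cl_top.
  have [|C dC lC] := one _ (S :&: X) pxD (sSX S) (rSX S rS); first exact: (mle S 2 1).
  case: (boolP (inl (par x) \in C)) => pC; rewrite ?pC /= in lC.
    have pC' B : inl (par x) \in C :|: B by rewrite inE pC.
    exists (C :|: [set top S z]); last first.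
      by rewrite cD -addn1; apply: cardsU_le; rewrite ?cards1 // -[#|C|]addn0.
    apply: (glue _ _ _ _ _ sS dC) => //; first by move=> p _ /eqP-> _; apply: cov_mem.
    by have [|h1 h2 h3 h4] := partop S _ (pC' _) (tB S C).
  exists (C :|: [set low S x; top S z]); last first.
    by rewrite cD cardU_two // -addn1.
  apply: (glue _ _ _ _ _ sS dC) => //; first exact: covp.
  by have [|h1 h2 h3 h4] := lowtop S _ (lB2 S C) (tB2 S C); first exact: split3.
Qed.

Lemma built_flexible X D : built X D -> flexible X D.
Proof.
elim=> {X D} [|X D x y z bX IH pxD xX yX zX py pz|X D x y bX IH pxX pxD xX yX py].
- have n1 (S : {set T}) : S \subset [set r] -> r \notin S -> S = set0.
    move=> sS rS; apply/eqP; rewrite -subset0; apply/subsetP => u uS.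
    by move: (subsetP sS u uS) rS; rewrite inE => /eqP<-; rewrite uS.
  have d0 : domx [set r] set0 pred0 [set inl r].
    split; first by rewrite sub1set !inE.
    case=> u; rewrite !inE // => /eqP-> _; apply: cov_mem; exact: set11.
  split.
  + move=> v /set1P->; exists set0; last by rewrite cards0 cards1.
    split; first exact: sub0set.
    by case=> u; rewrite !inE // => /eqP->; rewrite eqxx.
  + by move=> b ->.
  + move=> v S /set1P-> sS rS _; rewrite (n1 S sS rS).
    exists [set inl r]; last by rewrite !cards1 set11.
    by case: d0 => ? h; split=> // p pX _; apply: h.
  + move=> S sS rS _; rewrite (n1 S sS rS); exists [set inl r] => //.
    by rewrite !cards1.
- exact: flexible_path3.
- exact: (flexible_path2 par_r depP bX).
Qed.

End UpperBound.

(** The comparison of a packing [D] with a dominating set [C]; in the applications [R] is closed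
    adjacency. *)
Lemma leq_card_rel (A B : finType) (D : {set A}) (C : {set B}) (R : A -> B -> bool) :
  (forall d, d \in D -> exists2 q, q \in C & R d q) ->
  (forall d e q, d \in D -> e \in D -> q \in C -> R d q -> R e q -> d = e) ->
  #|D| <= #|C|.
Proof.
move=> ex inj.
have ex' d : d \in D -> [exists q in C, R d q].
  by case/ex => q qC Rq; apply/existsP; exists q; rewrite qC.
case: (set_0Vmem D) => [->|[d0 /ex [q0 _ _]]]; first by rewrite cards0.
pose f d := odflt q0 [pick q in C | R d q].
have fP d : d \in D -> (f d \in C) && R d (f d).
  move=> dD; rewrite /f; case: pickP => [q //|no] /=.
  by have /existsP[q] := ex' d dD; rewrite no.
rewrite -(@card_in_imset _ _ f D) => [|d e dD eD fde].
  by apply: subset_leq_card; apply/subsetP => _ /imsetP[d /fP/andP[? _] ->].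
have /andP[dC Rd] := fP d dD; have /andP[eC Re] := fP e eD.
by apply: (inj d e (f d)) => //; rewrite fde.
Qed.

(** * Lower bounds *)

Section LowerBound.
Variables (T : finType) (r : T) (par : T -> T) (dep : T -> nat).
Hypothesis par_r : par r = r.
Hypothesis depP : forall x, x != r -> dep x = (dep (par x)).+1.

Notation cl := (cl par).
Notation cov := (cov par).
Notation domx := (domx par).
Notation nr := (nr par).
Notation rcode := (rcode par).
Implicit Types (x y z u v w : T) (X D S : {set T}) (p q : T + T) (C B : {set T + T}).

Lemma cl_nr S x y : cl S (inl x) (inl y) -> nr x y.
Proof. by rewrite /= /nr => /or3P[->|/andP[-> _]|/andP[-> _]]; rewrite ?orbT. Qed.

Lemma nr_cl0 x y : nr x y -> cl set0 (inl x) (inl y).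
Proof. by rewrite /= /nr !inE !andbT. Qed.

Lemma cl_nr_mid S x y : cl S (inl x) (inr y) -> nr y x.
Proof. by rewrite /= /nr => /orP[/eqP->|/eqP->]; rewrite eqxx ?orbT. Qed.

(** Members of a packing need distinct dominating vertices. Exempt points outside [D] do not weaken
    the bound, which later contradicts dominating sets that are too small. *)
Lemma rcode_min X D C (E : pred (T + T)) : rcode X D -> domx X set0 E C ->
  (forall d, d \in D -> ~~ E (inl d)) -> #|D| <= #|C|.
Proof.
move=> [/subsetP sD _ pack _] [/subsetP sC covC] ED.
apply: (@leq_card_rel _ _ _ _ (fun d q => cl set0 (inl d) q)).
  move=> d dD; have [||q /andP[]] := existsP (covC (inl d) _ _); last by exists q.
    by rewrite inE sD.
  exact: ED.
move=> d e [] u dD eD /sC; rewrite !inE // => uX /cl_nr du /cl_nr eu.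
by apply: (pack u); rewrite // nr_sym.
Qed.

Lemma rcode_three X D : closed_up r par X -> r \in D -> rcode X D -> X != [set r] ->
  exists S, [/\ S \subset X, r \notin S, #|S| = 3 &
    forall C, domx X S pred0 C -> #|D| < #|C|].
Proof.
move=> cX rD cD nX; have [y [yX yr _]] := deepest depP cX nX.
case: cX => rX cX; have [/subsetP sD dom pack leaf] := cD.
have [x0 x0X x0D] : exists2 x, x \in X & x \notin D.
  case: (boolP (y \in D)) => yD; last by exists y.
  exists (par y); first exact: cX.
  apply/negP => pD; have /eqP[] := par_neq depP yr.
  by apply: (pack y) => //; rewrite ?nr_refl // /nr eqxx orbT.
(* Least depth forces the parent of s into [D]. Hence the neighbour t of s outside [D] is a child of
   s, and the member u of [D] dominating t is a child of t. *)
have [s /andP[sX sD'] smin] := @arg_minnP T x0 (fun x => (x \in X) && (x \notin D)) dep (introT andP (conj x0X x0D)).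
have sr : s != r by apply: contraNneq sD' => ->.
have pD : par s \in D.
  apply/negPn/negP => pD; have: dep s <= dep (par s) by apply: smin; rewrite cX.
  by rewrite (depP sr) ltnn.
have [t [tX tD ts st]] := leaf s sX sD'.
have pt : par t = s.
  move: st; rewrite /nr eq_sym (negPf ts) /= => /orP[/eqP e|/eqP//].
  by rewrite -e pD in tD.
have [u uD tu] := dom t tX tD.
have tr : t != r by apply: contraNneq tD => ->.
have ut : u != t by apply: contraNneq tD => <-.
have us : u != s by apply: contraNneq sD' => <-.
have pu : par u = t.
  by move: tu; rewrite /nr eq_sym (negPf ut) pt eq_sym (negPf us) /= => /eqP.
have ur : u != r by apply: contraNneq tr => e; rewrite -pu e par_r.
exists (u |: (t |: [set s])); split.
- by rewrite !subUset !sub1set sX tX sD.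
- by rewrite !inE !negb_or ![r == _]eq_sym ur tr sr.
- by rewrite !cardsU1 cards1 !inE negb_or ut us ts.
set S := u |: _ => C [/subsetP sC covC].
have -> : #|D|.+1 = #|inr t |: [set inl d | d in D]|.
  rewrite cardsU1 card_inl; suff -> : inr t \notin [set inl d | d in D] by [].
  by apply/imsetP => -[].
(* Only s, t and the middle point itself dominate the middle of st. None of them dominates a member
   of [D]: the only neighbours of s and t in [D] are [par s] and u, and both edges leading there are
   subdivided. *)
have noboth d q : d \in D -> q \in C -> cl S (inr t) q -> cl S (inl d) q -> false.
  case: q => x dD /sC; rewrite inE => xX.
    rewrite /= pt => /orP[/eqP e|/eqP e]; subst x.
      case/or3P => [/eqP e|/andP[/eqP e dS]|/andP[/eqP e _]].
      + by rewrite -e dD in tD.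
      + move: dS; rewrite !inE (pack t d u) ?eqxx // /nr ?e ?eqxx ?orbT //.
      + by rewrite -e pt (negPf sD') in dD.
    case/or3P => [/eqP e|/andP[/eqP e dS]|/andP[/eqP e sS]].
    + by rewrite -e dD in sD'.
    + have e' : d = par s by apply: (pack s); rewrite // /nr ?e eqxx ?orbT.
      case: (eqVneq (par s) r) => psr; last by have := par2_neq depP sr psr; rewrite -e' e eqxx.
      by move: sr; rewrite -e e' psr par_r eqxx.
    + by rewrite !inE eqxx !orbT in sS.
  move=> /= /eqP <- /orP[/eqP e|/eqP e]; first by rewrite e (negPf tD) in dD.
  by rewrite e pt (negPf sD') in dD.
apply: (@leq_card_rel _ _ _ _ (cl S)).
  move=> d dD; have [||q /andP[]] := existsP (covC d _ _) => //; last by exists q.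
  case/setU1P: dD => [->|/imsetP[d' /sD d'X ->]]; rewrite inE //.
  by rewrite !inE eqxx orbT.
move=> _ _ q /setU1P[->|/imsetP[d dD ->]] /setU1P[->|/imsetP[e eD ->]] // qC.
- by move=> h1 h2; case: (noboth e q eD qC h1 h2).
- by move=> h2 h1; case: (noboth d q dD qC h1 h2).
case: q qC => x /sC; rewrite inE => xX.
  by move=> /cl_nr du /cl_nr eu; rewrite (pack x d e) // nr_sym.
move=> /cl_nr_mid xd /cl_nr_mid xe; rewrite (pack x d e) //.
by move: xX; rewrite !inE => /or3P[] /eqP-> //; exact: sD.
Qed.

End LowerBound.

(** The gain from discarding a region [B] that is known to contain the members [Q] of [C]. *)
Lemma cardsD_sub (A : finType) (C B Q : {set A}) : Q \subset C -> Q \subset B ->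
  #|C :\: B| + #|Q| <= #|C|.
Proof.
move=> QC QB; rewrite -[#|C|](cardsID B) addnC leq_add2r.
by apply: subset_leq_card; rewrite subsetI QC.
Qed.

(** * Pruning when the domination number is stable *)

Section Stable.
Variables (T : finType) (r : T) (par : T -> T) (dep : T -> nat).
Hypothesis par_r : par r = r.
Hypothesis depP : forall x, x != r -> dep x = (dep (par x)).+1.

Notation cl := (cl par).
Notation cov := (cov par).
Notation domx := (domx par).
Notation nr := (nr par).
Notation rcode := (rcode par).
Notation closed_up := (closed_up r par).
Notation built := (built r par).
Notation top := (top par).
Implicit Types (x y z u v w : T) (X D S L R A : {set T}) (p q : T + T) (C B : {set T + T}).
Implicit Types (E F : pred (T + T)).

(* Only subdivisions of one edge or of two consecutive edges are considered:
   this class is large enough for all contradictions below and is inherited by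
   pruned trees. *)
Definition stable X := forall S x, S \subset X -> r \notin S -> S \subset [set x; par x] ->
  forall C, domx X set0 pred0 C -> exists2 C', domx X S pred0 C' & #|C'| <= #|C|.

(** Local surgery on a dominating set, which may at the same time change the subtree and the
    subdivision: the members of [C] in the region [pts L R] are replaced by [B]. A point not
    dominated by [B] must have been dominated only from outside the region, by adjacencies that
    persist. *)
Lemma domx_swap X X0 S' S E F C B L R :
  domx X S' E C ->
  (forall q, q \in C -> q \notin pts L R -> q \in pts X0 S) -> B \subset pts X0 S ->
  (forall p, p \in pts X0 S -> ~~ F p -> cov S (C :\: pts L R :|: B) p \/
    [/\ p \in pts X S', ~~ E p &
       forall q, q \in C -> cl S' p q -> q \notin pts L R /\ cl S p q]) ->
  domx X0 S F (C :\: pts L R :|: B).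
Proof.
move=> [sC covC] hC hB hcov; split.
  rewrite subUset hB andbT; apply/subsetP => q; rewrite inE => /andP[nq qC].
  exact: hC.
move=> p pX nF; case: (hcov p pX nF) => // -[pX' nE h].
have /existsP[q /andP[qC pq]] := covC p pX' nE.
have [nq clq] := h q qC pq.
by apply: covI clq; rewrite in_setU in_setD nq qC.
Qed.

Lemma no_descent X : (forall C, domx X set0 pred0 C ->
    exists2 C', domx X set0 pred0 C' & #|C'| < #|C|) -> False.
Proof.
move=> desc; have: domx X set0 pred0 (pts X set0).
  by split=> // p pX _; exact: cov_mem.
move: {2}#|_| (leqnn #|pts X set0|) => n; elim: n (pts X set0) => [|n IHn] C Cn dC.
  by have [C' _] := desc C dC; move: Cn; rewrite leqn0 => /eqP->.
have [C' dC' lC] := desc C dC; apply: (IHn C') => //.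
by rewrite -ltnS; apply: leq_trans Cn.
Qed.

Lemma pts_neq (x y : T) : (inl x : T + T) != inl y = (x != y) /\ (inr x : T + T) != inr y = (x != y).
Proof. by []. Qed.

(* With two leaves at par y0 this vertex dominates both, but subdividing one of
   the two leaf edges forces a further vertex. *)
Lemma stable_no_twin_leaf X y0 a : stable X -> closed_up X ->
  y0 \in X -> y0 != r -> (forall c, c \in X -> par c != y0) ->
  a \in X -> a != y0 -> a != par y0 -> nr a (par y0) ->
  (forall x, x \in X -> nr x a -> x = a \/ x = par y0) -> False.
Proof.
move=> stX [rX cX] y0X y0r leafy aX ay0 ay1 nay1 nra.
set y1 := par y0 in ay1 nay1 nra; have y1X : y1 \in X by exact: cX.
have y01 : y1 != y0 by apply: (par_neq depP).
apply: (@no_descent X) => C0 dC0.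
have [|||C dC lC] := stX [set y0] y0 _ _ _ C0 dC0.
- by rewrite sub1set.
- by rewrite inE eq_sym.
- by rewrite sub1set set21.
have [/subsetP sC covC] := dC.
have n0 x : x \in X -> nr x y0 -> x = y0 \/ x = y1.
  move=> xX /or3P[/eqP->|e|/eqP e]; [by left | | by right; rewrite -e].
  by rewrite (negPf (leafy x xX)) in e.
have [q0 q0C q0E] : exists2 q, q \in C & q = inl y0 \/ q = inr y0.
  have [||q /andP[qC cq]] := existsP (covC (inl y0) _ _); rewrite ?inE //.
  exists q => //; case: q qC cq => x /sC; rewrite inE => xX.
    rewrite /= set11 andbF /= (negPf (leafy x xX)) /= orbF => /eqP->; by left.
  by move: xX; rewrite inE => /eqP->; right.
have [qa qaC qaE] : exists2 q, q \in C & q = inl a \/ q = inl y1.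
  have [||q /andP[qC cq]] := existsP (covC (inl a) _ _); rewrite ?inE //.
  exists q => //; case: q qC cq => x /sC; rewrite inE => xX.
    by rewrite (cl_sym _ _ (inl a)) => /cl_nr /(nra x xX) [->|->]; [left | right].
  move: xX; rewrite inE => /eqP-> /= /orP[] /eqP e; first by rewrite e eqxx in ay0.
  by rewrite e eqxx in ay1.
(* The distinct members [q0] and [qa] of [C] lie in this region. In the unsubdivided tree y1 alone
   replaces them, since y0 and a have no neighbour other than y1. *)
pose L := [set y0; a; y1]; pose R := [set y0].
have q0A : q0 \in pts L R by case: q0E => ->; rewrite !inE eqxx.
have qaA : qa \in pts L R by case: qaE => ->; rewrite !inE eqxx ?orbT.
have nq : q0 != qa.
  case: q0E qaE => -> [] -> //; first by rewrite (pts_neq _ _).1 eq_sym.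
  by rewrite (pts_neq _ _).1 eq_sym.
exists (C :\: pts L R :|: [set inl y1]).
  apply: (domx_swap dC).
  - case=> x xC; rewrite !inE.
      by move=> _; have := sC _ xC; rewrite inE.
    by have := sC _ xC; rewrite !inE => ->.
  - by rewrite sub1set inE.
  have y1C p : cl set0 p (inl y1) -> cov set0 (C :\: pts L R :|: [set inl y1]) p.
    by apply: (@covI _ _ _ _ _ (inl y1)); rewrite in_setU set11 orbT.
  case=> x; rewrite !inE // => xX _.
  case: (boolP (nr x y1)) => xy1; first by left; apply: y1C; exact: nr_cl0.
  have xa : x != a by apply: contraNneq xy1 => ->.
  have x0 : x != y0 by apply: contraNneq xy1 => ->; rewrite /nr eqxx orbT.
  right; split; rewrite ?inE //; case=> u /sC; rewrite inE => uX cxu.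
    have xu := cl_nr cxu; split; last exact: nr_cl0.
    rewrite !inE; apply/negP => /orP[/orP[]|] /eqP e; rewrite e in xu.
    + by case: (n0 x xX xu) => e'; [rewrite e' eqxx in x0 | rewrite e' nr_refl in xy1].
    + by case: (nra x xX xu) => e'; [rewrite e' eqxx in xa | rewrite e' nr_refl in xy1].
    + by rewrite xu in xy1.
  move: uX cxu; rewrite inE => /eqP-> /= /orP[] /eqP e; first by rewrite e eqxx in x0.
  by rewrite e nr_refl in xy1.
apply: leq_trans lC; have := @cardsD_sub _ C (pts L R) [set q0; qa].
rewrite !subUset !sub1set q0C qaC q0A qaA cards2 nq => /(_ isT isT) cD.
apply: leq_trans cD; rewrite addn2 ltnS; apply: leq_trans (cardsU_le (leqnn _) (leqnn _)) _.
by rewrite cards1 addn1.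
Qed.

Lemma domx_pick X S C p : domx X S pred0 C -> p \in pts X S ->
  exists q, [/\ q \in C, q \in pts X S & cl S p q].
Proof.
move=> [/subsetP sC covC] pX; have /existsP[q /andP[qC pq]] := covC p pX isT.
by exists q; split=> //; exact: sC.
Qed.

(** * Pruning a pendant path from a stable tree *)

Section PendantPath.
Variables (X : {set T}) (y0 y1 y2 : T).
Hypotheses (stX : stable X) (clX : closed_up X) (y0X : y0 \in X).
Hypotheses (py0 : par y0 = y1) (py1 : par y1 = y2).
Hypotheses (y0r : y0 != r) (y1r : y1 != r) (y2r : y2 != r).
Hypothesis leafy : forall c, c \in X -> par c != y0.
Hypothesis only0 : forall c, c \in X -> par c = y1 -> c = y0.

Let y3 := par y2.

Lemma pendant_facts : [/\ y1 \in X, y2 \in X, y3 \in X &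
  [/\ y0 != y1, y1 != y2, y0 != y2, y2 != y3 & [/\ y1 != y3, y0 != y3, r \in X & forall x, x \in X -> par x \in X]]].
Proof.
have [rX cX] := clX; have y1X : y1 \in X by rewrite -py0; exact: cX.
have y2X : y2 \in X by rewrite -py1; exact: cX.
split=> //; first exact: cX.
split; last split=> //.
- by rewrite -py0 eq_sym (par_neq depP).
- by rewrite -py1 eq_sym (par_neq depP).
- by rewrite -py1 -py0 eq_sym (par2_neq depP) ?py0.
- by rewrite eq_sym (par_neq depP).
- by rewrite /y3 -py1 eq_sym (par2_neq depP) ?py1.
- by rewrite eq_sym; exact: leafy.
Qed.

Lemma near0 x : x \in X -> nr x y0 -> x = y0 \/ x = y1.
Proof.
move=> xX /or3P[/eqP->|e|/eqP<-]; [by left | | by right].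
by rewrite (negPf (leafy xX)) in e.
Qed.

Lemma near1 x : x \in X -> nr x y1 -> [\/ x = y0, x = y1 | x = y2].
Proof.
move=> xX /or3P[/eqP->|/eqP e|/eqP<-]; [by constructor 2 | | by constructor 3].
by constructor 1; exact: only0.
Qed.

Lemma end_meet S C : y0 \notin S -> y1 \notin S -> S \subset X -> domx X S pred0 C ->
  exists2 q, q \in C & q = inl y0 \/ q = inl y1.
Proof.
move=> y0S y1S /subsetP sS dC.
have [|q [qC qX cq]] := @domx_pick _ _ _ (inl y0) dC; first by rewrite inE.
exists q => //; case: q qX cq {qC} => u; rewrite inE => uX cq.
  by move: (cl_nr cq); rewrite nr_sym => /(near0 uX) [->|->]; [left | right].
move: cq => /= /orP[] /eqP e; first by rewrite e uX in y0S.
by have := leafy (sS u uX); rewrite e eqxx.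
Qed.

Lemma end_mid_meet S C : y0 \in S -> S \subset X -> domx X S pred0 C ->
  exists2 q, q \in C & q = inl y0 \/ q = inr y0.
Proof.
move=> y0S /subsetP sS dC.
have [|q [qC qX cq]] := @domx_pick _ _ _ (inl y0) dC; first by rewrite inE.
exists q => //; case: q qX cq {qC} => u; rewrite inE => uX /=.
  by rewrite y0S andbF /= (negPf (leafy uX)) orbF => /eqP->; left.
case/orP=> /eqP e; first by right; rewrite e.
by have := leafy (sS u uX); rewrite e eqxx.
Qed.

Lemma mid_meet S C : y1 \in S -> domx X S pred0 C ->
  exists2 q, q \in C & [\/ q = inr y1, q = inl y1 | q = inl y2].
Proof.
move=> y1S dC.
have [|q [qC qX cq]] := @domx_pick _ _ _ (inr y1) dC; first by rewrite inE.
exists q => //; case: q cq {qX qC} => u /=.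
  by rewrite py1 => /orP[] /eqP->; [constructor 2 | constructor 3].
by move=> /eqP->; constructor 1.
Qed.

Lemma add_y1 A (C0 : {set T + T}) : y0 \in A -> y1 \in A -> A \subset [set y0; y1; y2] ->
  domx (X :\: A) set0 pred0 C0 -> domx X set0 pred0 (C0 :|: [set inl y1]).
Proof.
move=> y0A y1A sA dC.
have [y1X y2X _ _] := pendant_facts.
have {}dC : domx (X :\: A) (set0 :&: (X :\: A)) pred0 C0 by rewrite set0I.
apply: (domx_glue dC); rewrite ?subsetDl ?sub1set ?inE //.
  move=> u uX; rewrite inE uX andbT negbK => /(subsetP sA).
  rewrite !inE => /orP[/orP[]|] /eqP-> _; apply: (@covI _ _ _ _ _ (inl y1)); rewrite ?inE ?eqxx ?orbT //.
  - by apply: nr_cl0; rewrite /nr py0 eqxx orbT.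
  - exact: cl_refl.
  - by apply: nr_cl0; rewrite /nr py1 eqxx !orbT.
by move=> u; rewrite inE.
Qed.

(** Adding y1 to a dominating set of the pruned tree dominates the whole tree, to which stability
    applies. The additional vertex is won back when the pendant path is cut off again. *)
Lemma stable_use C0 A S x : y0 \in A -> y1 \in A -> A \subset [set y0; y1; y2] ->
  domx (X :\: A) set0 pred0 C0 ->
  S \subset X -> r \notin S -> S \subset [set x; par x] ->
  exists2 C, domx X S pred0 C & #|C| <= #|C0|.+1.
Proof.
move=> y0A y1A sA /(add_y1 y0A y1A sA) dC sS rS xS.
have [C dC' lC] := stX sS rS xS dC; exists C => //.
by apply: (leq_trans lC); rewrite -addn1; apply: cardsU_le; rewrite ?cards1.
Qed.

Section NoBranch.
Hypothesis only1 : forall c, c \in X -> par c = y2 -> c = y1.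
Let X0 := X :\: [set y2; y1; y0].

Lemma near2 x : x \in X -> nr x y2 -> [\/ x = y1, x = y2 | x = y3].
Proof.
move=> xX /or3P[/eqP->|/eqP e|/eqP<-]; [by constructor 2 | | by constructor 3].
by constructor 1; exact: only1.
Qed.

Let y0A : y0 \in [set y2; y1; y0]. Proof. by rewrite !inE eqxx !orbT. Qed.
Let y1A : y1 \in [set y2; y1; y0]. Proof. by rewrite !inE eqxx !orbT. Qed.
Let subA : [set y2; y1; y0] \subset [set y0; y1; y2].
Proof. by apply/subsetP => u; rewrite !inE => /orP[/orP[]|] ->; rewrite ?orbT. Qed.

(** Subdividing the edges at y0 and y1 forces two vertices on the pendant path, one for y0 and one
    for the middle of y1y2. Deleting them saves one vertex compared with [C0], and only y3 may have
    been dominated from there. *)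
Lemma omit_y3 C0 : domx X0 set0 pred0 C0 ->
  exists2 C, domx X0 set0 (pred1 (inl y3)) C & #|C| < #|C0|.
Proof.
move=> dC0.
have [y1X y2X y3X [n01 n12 n02 n23 [n13 n03 rX cX]]] := pendant_facts.
have sS : [set y0; y1] \subset X by rewrite subUset !sub1set y0X.
have rS : r \notin [set y0; y1] by rewrite !inE negb_or ![r == _]eq_sym y0r.
have [|C dC lC] := @stable_use C0 _ [set y0; y1] y0 y0A y1A subA dC0 sS rS.
  by rewrite py0.
have [q0 q0C q0E] := end_mid_meet (set21 _ _) sS dC.
have [q1 q1C q1E] := mid_meet (set22 _ _) dC.
have [/subsetP sC _] := dC.
pose L := [set y0; y1; y2]; pose R := [set y0; y1].
exists (C :\: pts L R :|: set0).
  apply: (domx_swap dC); rewrite ?sub0set //.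
    case=> u uC; have := sC _ uC; rewrite !inE; last by move=> ->.
    by rewrite !negb_or => -> /andP[/andP[-> ->] ->].
  case=> x; rewrite !inE // !negb_or => /andP[/andP[/andP[x2 x1] x0] xX] x3; right.
  split=> //; case=> u /sC; rewrite inE => uX cxu.
    have xu := cl_nr cxu; split; last exact: nr_cl0.
    rewrite !inE; apply/negP => /orP[/orP[]|] /eqP e; rewrite e in xu.
    + by case: (near0 xX xu) => e'; rewrite e' eqxx in x0 x1.
    + by case: (near1 xX xu) => e'; rewrite e' eqxx in x0 x1 x2.
    + by case: (near2 xX xu) => e'; rewrite ?e' ?eqxx in x1 x2 x3.
  move: cxu uX; rewrite !inE /= => /orP[/eqP<-|/eqP e].
    by rewrite (negPf x0) (negPf x1).
  by case/orP=> /eqP e'; rewrite e e' ?py0 ?py1 eqxx in x1 x2.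
rewrite setU0; have := @cardsD_sub _ C (pts L R) [set q0; q1].
have -> : [set q0; q1] \subset C by rewrite subUset !sub1set q0C.
have -> : [set q0; q1] \subset pts L R.
  rewrite subUset !sub1set; apply/andP; split.
    by case: q0E => ->; rewrite !inE eqxx.
  by case: q1E => ->; rewrite !inE eqxx ?orbT.
have -> : #|[set q0; q1]| = 2.
  rewrite cards2; suff -> : q0 != q1 by [].
  by case: q0E => ->; case: q1E => ->.
by move=> /(_ isT isT); rewrite addn2 => h; have := leq_trans h lC; rewrite ltnS.
Qed.

(** A dominating set contains y0 or y1, which pays for the vertex added by [stable_use]. If y2 is in
    it as well, cutting the path may leave y3 undominated, and y3 then takes the place of y2. *)
Lemma stable_path3 : stable X0.
Proof.
move=> S x sS0 rS chS C0 dC0.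
have [y1X y2X y3X [n01 n12 n02 n23 [n13 n03 rX cX]]] := pendant_facts.
have sSX : S \subset X by apply: subset_trans sS0 (subsetDl _ _).
have [C dC lC] := stable_use y0A y1A subA dC0 sSX rS chS.
have nS u : u \in [set y2; y1; y0] -> u \notin S.
  by move=> uA; apply/negP => /(subsetP sS0); rewrite inE uA.
have [q0 q0C q0E] := end_meet (nS _ y0A) (nS _ y1A) sSX dC.
have [/subsetP sC _] := dC.
pose L := [set y0; y1; y2]; pose R : {set T} := set0.
exists (C :\: pts L R :|: (if inl y2 \in C then [set inl y3] else set0)).
  apply: (domx_swap dC).
  - case=> u uC; have := sC _ uC; rewrite !inE; last by move=> ->.
    by rewrite !negb_or => -> /andP[/andP[-> ->] ->].
  - case: ifP => _; rewrite ?sub0set // sub1set !inE !negb_or.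
    by rewrite eq_sym n23 eq_sym n13 eq_sym n03.
  case=> x'; rewrite inE => xX0 _; last first.
    right; have xX := subsetP sS0 _ xX0; split; rewrite ?inE //.
    move: xX; rewrite !inE !negb_or => /andP[/andP[/andP[x2 x1] x0] xX].
    case=> u /sC; rewrite inE => uX cxu; split=> //; last by rewrite !inE.
    rewrite !inE; move: cxu => /= /orP[/eqP->|/eqP e].
      by rewrite !negb_or x0 x1 x2.
    apply/negP; rewrite e => /orP[/orP[]|] /eqP e'.
    + by move: (leafy xX); rewrite e' eqxx.
    + by rewrite (only0 xX e') eqxx in x0.
    + by rewrite (only1 xX e') eqxx in x1.
  move: xX0; rewrite !inE !negb_or => /andP[/andP[/andP[x2 x1] x0] xX].
  case: (boolP ((x' == y3) && (inl y2 \in C))) => [/andP[/eqP-> ->]|nx3].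
    by left; apply: cov_mem; rewrite in_setU set11 orbT.
  right; split; rewrite ?inE //; case=> u uC cxu; split=> //; last by rewrite !inE.
  rewrite !inE; apply/negP => /orP[/orP[]|] /eqP e; rewrite e in cxu uC; have xu := cl_nr cxu.
  + by case: (near0 xX xu) => e'; rewrite e' eqxx in x0 x1.
  + by case: (near1 xX xu) => e'; rewrite e' eqxx in x0 x1 x2.
  + by case: (near2 xX xu) => e'; rewrite ?e' ?uC ?eqxx in x1 x2 nx3.
have q0A : q0 \in pts L R by case: q0E => ->; rewrite !inE eqxx ?orbT.
case: ifP => y2C; last first.
  rewrite setU0; have := @cardsD_sub _ C (pts L R) [set q0].
  rewrite !sub1set cards1 addn1 => /(_ q0C q0A) h.
  by have := leq_trans h lC; rewrite ltnS.
have := @cardsD_sub _ C (pts L R) [set q0; inl y2].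
rewrite !subUset !sub1set q0C y2C q0A !inE eqxx orbT cards2 => /(_ isT isT).
have -> : q0 != inl y2.
  by case: q0E => ->; [change (y0 != y2) | change (y1 != y2)].
rewrite addn2 => h; have {}h := leq_trans h lC; rewrite ltnS in h.
by apply: leq_trans (cardsU_le (leqnn _) (leqnn _)) _; rewrite cards1 addn1.
Qed.

End NoBranch.
Section Branch.
Let X0 := X :\: [set y1; y0].

Let y0A : y0 \in [set y1; y0]. Proof. by rewrite !inE eqxx orbT. Qed.
Let y1A : y1 \in [set y1; y0]. Proof. by rewrite !inE eqxx. Qed.
Let subA : [set y1; y0] \subset [set y0; y1; y2].
Proof. by apply/subsetP => u; rewrite !inE => /orP[] ->; rewrite ?orbT. Qed.

(** Some vertex of the set is y0 or y1, and y2 is the only remaining vertex adjacent to either. What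
    is left to each kind of branch is to dominate y2 at no cost. *)
Lemma drop_end S C : S \subset X0 -> domx X S pred0 C ->
  exists2 C', domx X0 S (pred1 (inl y2)) C' & #|C'| < #|C|.
Proof.
move=> sS0 dC.
have sSX : S \subset X by apply: subset_trans sS0 (subsetDl _ _).
have nS u : u \in [set y1; y0] -> u \notin S.
  by move=> uA; apply/negP => /(subsetP sS0); rewrite inE uA.
have [q0 q0C q0E] := end_meet (nS _ y0A) (nS _ y1A) sSX dC.
have [/subsetP sC _] := dC.
pose L := [set y0; y1]; pose R : {set T} := set0.
exists (C :\: pts L R :|: set0); last first.
  rewrite setU0; have := @cardsD_sub _ C (pts L R) [set q0].
  rewrite !sub1set cards1 addn1; apply=> //.
  by case: q0E => ->; rewrite !inE eqxx ?orbT.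
apply: (domx_swap dC); rewrite ?sub0set //.
  case=> u uC; have := sC _ uC; rewrite !inE; last by move=> ->.
  by rewrite !negb_or => -> /andP[-> ->].
case=> x xX0 nx; right; split=> //; try by move: xX0; rewrite !inE // => /andP[].
  move: xX0; rewrite !inE !negb_or => /andP[/andP[x1 x0] xX].
  case=> u uC cxu; split=> //; last by rewrite !inE.
  have xu := cl_nr cxu.
  rewrite !inE; apply/negP => /orP[] /eqP e; rewrite e in xu.
    by case: (near0 xX xu) => e'; rewrite e' eqxx in x0 x1.
  case: (near1 xX xu) => e'; try by rewrite e' eqxx in x0 x1.
  by rewrite e' /= eqxx in nx.
move: xX0; rewrite inE => xS; have := subsetP sS0 _ xS.
rewrite !inE !negb_or => /andP[/andP[x1 x0] xX].
case=> u uC cxu; split=> //; last by rewrite !inE.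
rewrite !inE; move: cxu => /= /orP[/eqP->|/eqP e].
  by rewrite !negb_or x0 x1.
apply/negP; rewrite e => /orP[] /eqP e'.
  by move: (leafy xX); rewrite e' eqxx.
by rewrite (only0 xX e') eqxx in x0.
Qed.

Lemma branch_meet S C p : domx X0 S (pred1 (inl y2)) C -> p \in pts X0 S ->
  p != inl y2 -> exists q, [/\ q \in C, q \in pts X S & cl S p q].
Proof.
move=> [/subsetP sC covC] pX np; have /existsP[q /andP[qC pq]] := covC p pX np.
exists q; split=> //; have := sC _ qC; case: (q) => u; rewrite !inE //.
by case/andP.
Qed.

Lemma domx_y2 S C : domx X0 S (pred1 (inl y2)) C -> cov S C (inl y2) -> domx X0 S pred0 C.
Proof.
move=> [sC covC] h; split=> // p pX _; case: (eqVneq p (inl y2)) => [->//|np].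
exact: covC.
Qed.

(** If the edge at the leaf w is intact, whatever dominates w also dominates y2. If it is
    subdivided, the vertex dominating w may be moved to the middle of the edge, which dominates both
    ends. *)
Lemma stable_branch_leaf w : w \in X -> w != y1 -> par w = y2 ->
  (forall c, c \in X -> par c != w) -> stable X0.
Proof.
move=> wX w1 pw wleaf S x sS0 rS chS C0 dC0.
have [y1X y2X y3X [n01 n12 n02 n23 [n13 n03 rX cX]]] := pendant_facts.
have sSX : S \subset X by apply: subset_trans sS0 (subsetDl _ _).
have [C' dC' lC'] := stable_use y0A y1A subA dC0 sSX rS chS.
have [C dC lC] := drop_end sS0 dC'.
have {lC lC'}lC : #|C| <= #|C0| by rewrite -ltnS; exact: leq_trans lC lC'.
have wr : w != r by apply: contraNneq y2r => e; rewrite -pw e par_r.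
have w0 : w != y0 by apply: contraNneq n12 => e; rewrite -py0 -e pw.
have w2 : w != y2 by rewrite eq_sym -pw (par_neq depP).
have wX0 : w \in X0 by rewrite !inE negb_or w1 w0.
have y2X0 : y2 \in X0 by rewrite !inE negb_or eq_sym n12 eq_sym n02.
have nearw u : u \in X -> nr u w -> u = w \/ u = y2.
  move=> uX /or3P[/eqP->|e|/eqP<-]; [by left | | by right].
  by rewrite (negPf (wleaf u uX)) in e.
have [|//|q [qC qX cq]] := @branch_meet S C (inl w) dC; first by rewrite inE.
case: (boolP (w \in S)) => wS; last first.
  exists C => //; apply: domx_y2 => //; case: q qC qX cq => u; rewrite inE => uC uX.
    move/cl_nr; rewrite nr_sym => /(nearw u uX) [] e; rewrite e in uC.
      by apply: covI uC _; rewrite -pw cl_child.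
    exact: cov_mem.
  rewrite /= => /orP[] /eqP e; first by rewrite e uX in wS.
  by have := wleaf u (subsetP sSX u uX); rewrite e eqxx.
have [/subsetP sC _] := dC.
have qA : q \in pts [set w] [set w].
  case: q qC qX cq => u; rewrite inE => uC uX; last first.
    rewrite /= inE inE => /orP[] /eqP e; first by rewrite e.
    by have := wleaf u (subsetP sSX u uX); rewrite e eqxx.
  by rewrite /= wS andbF (negPf (wleaf u uX)) orbF !inE eq_sym.
exists (C :\: pts [set w] [set w] :|: [set inr w]); last first.
  apply: leq_trans lC; have := @cardsD_sub _ C (pts [set w] [set w]) [set q].
  rewrite !sub1set cards1 => /(_ qC qA); apply: leq_trans.
  by apply: cardsU_le; rewrite ?cards1.
have cw p : cl S p (inr w) -> cov S (C :\: pts [set w] [set w] :|: [set inr w]) p.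
  by apply: covI; rewrite in_setU set11 orbT.
apply: (domx_swap dC).
- by move=> u uC _; exact: sC.
- by rewrite sub1set inE.
move=> p pX _; case: (boolP (cl S p (inr w))) => pw'; first by left; apply: cw.
right; split=> //.
  by apply: contraNneq pw' => ->; rewrite /= -pw eqxx orbT.
move=> u uC cu; split=> //; apply/negP => uA; move: pw'; apply/negP; rewrite negbK.
case: u uC uA cu => u _; rewrite !inE => /eqP->; last by [].
case: p pX => v; rewrite inE => vX /=.
  have vX' : v \in X by move: vX; rewrite inE => /andP[].
  by move/cl_nr/(nearw v vX') => [] ->; rewrite ?eqxx // -pw eqxx orbT.
case/orP => /eqP e; first by rewrite e.
have vX' := subsetP sSX v vX.
by have := wleaf v vX'; rewrite -e eqxx.
Qed.

(* The pruned path may have been needed to dominate y2.  If S avoids the branch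
   of some other child v of y2, then v can be taken to dominate y2.  Otherwise
   subdivide the two edges of the branch of w instead of S: the middle vertex of
   the edge w - y2 then makes y2 available for free. *)
Lemma stable_branch w : w \in X -> w != y1 -> par w = y2 ->
  (forall v, v \in X -> v != y1 -> par v = y2 ->
     exists v0, [/\ v0 \in X, par v0 = v, forall c, c \in X -> par c != v0 &
                    forall c, c \in X -> par c = v -> c = v0]) ->
  stable X0.
Proof.
move=> wX w1 pw grand S x sS0 rS chS C0 dC0.
have [y1X y2X y3X [n01 n12 n02 n23 [n13 n03 rX cX]]] := pendant_facts.
have sSX : S \subset X by apply: subset_trans sS0 (subsetDl _ _).
have y2X0 : y2 \in X0 by rewrite !inE negb_or eq_sym n12 eq_sym n02.
(* Branches at y2 with neither the edge to y2 nor an edge below v subdivided. *)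
pose intact v := [&& v \in X, par v == y2, v != y1, v \notin S &
                     [forall c in X, (par c == v) ==> (c \notin S)]].
case: (pickP intact) => [v /and5P[vX /eqP pv v1 vS /forall_inP v0S]|nointact].
  have [v0 [v0X pv0 v0leaf only]] := grand v vX v1 pv.
  have {}v0S : v0 \notin S by have := v0S v0 v0X; rewrite pv0 eqxx.
  have [C' dC' lC'] := stable_use y0A y1A subA dC0 sSX rS chS.
  have [C dC lC] := drop_end sS0 dC'.
  have {lC lC'}lC : #|C| <= #|C0| by rewrite -ltnS; exact: leq_trans lC lC'.
  have vr : v != r by apply: contraNneq y2r => e; rewrite -pv e par_r.
  have v0r : v0 != r by apply: contraNneq vr => e; rewrite -pv0 e par_r.
  have v0y0 : v0 != y0 by apply: contraNneq v1 => e; rewrite -pv0 e py0.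
  have v0y1 : v0 != y1.
    by apply: contraTneq (par_neq depP vr) => e; rewrite pv -py1 -e pv0 eqxx.
  have vy0 : v != y0 by apply: contraNneq n12 => e; rewrite -py0 -e pv.
  have v0y2 : v0 != y2 by rewrite eq_sym -pv -pv0 (par2_neq depP) ?pv0.
  have v0X0 : v0 \in X0 by rewrite !inE negb_or v0y1 v0y0.
  have vX0 : v \in X0 by rewrite !inE negb_or v1 vy0.
  have near_v0 u : u \in X -> nr u v0 -> u = v0 \/ u = v.
    move=> uX /or3P[/eqP->|e|/eqP<-]; [by left | | by right].
    by rewrite (negPf (v0leaf u uX)) in e.
  have [|//|q [qC qX cq]] := @branch_meet S C (inl v0) dC; first by rewrite inE.
  pose L := [set v; v0]; pose R : {set T} := set0.
  have qA : q \in pts L R.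
    case: q qC qX cq => u; rewrite inE => uC uX.
      by move/cl_nr; rewrite nr_sym => /(near_v0 u uX) [] ->; rewrite !inE eqxx ?orbT.
    rewrite /= => /orP[] /eqP e; first by rewrite e uX in v0S.
    by have := v0leaf u (subsetP sSX u uX); rewrite e eqxx.
  have [/subsetP sC _] := dC.
  exists (C :\: pts L R :|: [set inl v]); last first.
    apply: leq_trans lC; have := @cardsD_sub _ C (pts L R) [set q].
    rewrite !sub1set cards1 => /(_ qC qA); apply: leq_trans.
    by apply: cardsU_le; rewrite ?cards1.
  apply: (domx_swap dC).
  - by move=> u uC _; exact: sC.
  - by rewrite sub1set inl_pts.
  have cv p : cl S p (inl v) -> cov S (C :\: pts L R :|: [set inl v]) p.
    by apply: covI; rewrite in_setU set11 orbT.
  move=> p pX _; case: (boolP (cl S p (inl v))) => pv'; first by left; apply: cv.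
  right; split=> //.
    by apply: contraNneq pv' => ->; rewrite -pv cl_child.
  move=> u uC cu; split=> //; apply/negP => uA; move: pv'; apply/negP; rewrite negbK.
  case: u uC uA cu => u _; last by rewrite !inE.
  rewrite !inE => /orP[] /eqP-> //.
  case: p pX => t; rewrite inE => tX.
    have tX' : t \in X by move: tX; rewrite inE => /andP[].
    by move/cl_nr/(near_v0 t tX') => [] ->; rewrite ?cl_refl // -pv0 cl_par.
  rewrite /= => /orP[] /eqP e; first by rewrite e tX in v0S.
  by have := v0leaf t (subsetP sSX t tX); rewrite -e eqxx.
have [w0 [w0X pw0 w0leaf only]] := grand w wX w1 pw.
have hitS : (w \in S) || (w0 \in S).
  rewrite -[_ || _]negbK negb_or; apply/negP => /andP[wS w0S].
  have := nointact w; rewrite /intact wX pw eqxx w1 wS /= => /negP[].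
  apply/forall_inP => c cXX; apply/implyP => /eqP /(only c cXX) ->; exact: w0S.
have wr : w != r by apply: contraNneq y2r => e; rewrite -pw e par_r.
have w0r : w0 != r by apply: contraNneq wr => e; rewrite -pw0 e par_r.
have w0y0 : w0 != y0 by apply: contraNneq w1 => e; rewrite -pw0 e py0.
have w0y1 : w0 != y1.
  by apply: contraTneq (par_neq depP wr) => e; rewrite pw -py1 -e pw0 eqxx.
have wy0 : w != y0 by apply: contraNneq n12 => e; rewrite -py0 -e pw.
have w0y2 : w0 != y2 by rewrite eq_sym -pw -pw0 (par2_neq depP) ?pw0.
have wy2 : w != y2 by rewrite eq_sym -pw (par_neq depP).
have ww0 : w != w0 by rewrite -pw0 (par_neq depP).
have w0X0 : w0 \in X0 by rewrite !inE negb_or w0y1 w0y0.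
have wX0 : w \in X0 by rewrite !inE negb_or w1 wy0.
have near_w0 u : u \in X -> nr u w0 -> u = w0 \/ u = w.
  move=> uX /or3P[/eqP->|e|/eqP<-]; [by left | | by right].
  by rewrite (negPf (w0leaf u uX)) in e.
have near_w u : u \in X -> nr u w -> [\/ u = w0, u = w | u = y2].
  move=> uX /or3P[/eqP->|/eqP e|/eqP<-]; [by constructor 2 | | by constructor 3].
  by constructor 1; exact: only.
pose S' := [set w0; w].
have sS'0 : S' \subset X0 by rewrite subUset !sub1set w0X0.
have sS'X : S' \subset X by rewrite subUset !sub1set w0X.
have rS' : r \notin S' by rewrite !inE negb_or ![r == _]eq_sym w0r.
have [|C' dC' lC'] := @stable_use C0 _ S' w0 y0A y1A subA dC0 sS'X rS'.
  by rewrite pw0.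
have [C dC lC] := drop_end sS'0 dC'.
have {lC lC'}lC : #|C| <= #|C0| by rewrite -ltnS; exact: leq_trans lC lC'.
have [/subsetP sC _] := dC.
pose L := [set w0; w; y2]; pose R := [set w0; w].
have [|//|q1 [q1C q1X cq1]] := @branch_meet S' C (inl w0) dC; first by rewrite inE.
have [|//|q2 [q2C q2X cq2]] := @branch_meet S' C (inr w) dC; first by rewrite !inE eqxx orbT.
have q1E : q1 = inl w0 \/ q1 = inr w0.
  case: q1 {q1C} q1X cq1 => u; rewrite inE => uX /=.
    rewrite !inE eqxx andbF /= (negPf (w0leaf u uX)) orbF => /eqP->; by left.
  case/orP=> /eqP e; first by right; rewrite e.
  by have := w0leaf u (subsetP sS'X u uX); rewrite e eqxx.
have q2E : [\/ q2 = inr w, q2 = inl w | q2 = inl y2].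
  case: q2 {q2C} q2X cq2 => u _ /=; last by move=> /eqP->; constructor 1.
  by rewrite pw => /orP[] /eqP->; [constructor 2 | constructor 3].
(* For the subdivision [S'] of the branch, [q1] and [q2] are two members of [C] on w0, w, y2 and the
   middles of the two edges. Returning to [S], they are exchanged for [b1] and [b2]; the hypothesis
   on p lists the points that these two may leave to the rest of [C]. *)
have finish b1 b2 : b1 \in pts X0 S -> b2 \in pts X0 S ->
    (forall s, s \in S -> [\/ s = w0, s = w | s = y2]) ->
    (forall p, p \in pts X0 S -> ~~ cl S p b1 -> ~~ cl S p b2 ->
       exists v, [/\ p = inl v, v != w0, v != w & ~~ nr v y2]) ->
    exists2 C1, domx X0 S pred0 C1 & #|C1| <= #|C0|.
  move=> b1X b2X sS hp; exists (C :\: pts L R :|: [set b1; b2]); last first.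
    apply: leq_trans lC; have := @cardsD_sub _ C (pts L R) [set q1; q2].
    have -> : [set q1; q2] \subset C by rewrite subUset !sub1set q1C.
    have -> : [set q1; q2] \subset pts L R.
      rewrite subUset !sub1set; apply/andP; split.
        by case: q1E => ->; rewrite !inE eqxx.
      by case: q2E => ->; rewrite !inE eqxx ?orbT.
    have -> : #|[set q1; q2]| = 2.
      rewrite cards2; suff -> : q1 != q2 by [].
      case: q1E => ->; case: q2E => -> //; rewrite ?(pts_neq _ _).1 ?(pts_neq _ _).2 //;
        by rewrite eq_sym.
    by move=> /(_ isT isT); apply: leq_trans; apply: cardsU_le; rewrite ?card_set2.
  apply: (domx_swap dC).
  - case=> u uC; have := sC _ uC; rewrite !inE //.
    by move=> ->.
  - by rewrite subUset !sub1set b1X.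
  move=> p pX _.
  case: (boolP (cl S p b1)) => p1.
    by left; apply: covI p1; rewrite in_setU set21 orbT.
  case: (boolP (cl S p b2)) => p2.
    by left; apply: covI p2; rewrite in_setU set22 orbT.
  have [v [ep v0 vw v2]] := hp p pX p1 p2; right; subst p.
  have v2' : v != y2 by apply: contraNneq v2 => ->; rewrite nr_refl.
  have vX0 : v \in X0 by rewrite inl_pts in pX.
  have vX : v \in X by move: vX0; rewrite inE => /andP[].
  have vS : v \notin S.
    by apply/negP => /sS [] e; rewrite e eqxx in v0 vw v2'.
  split; rewrite ?inl_pts //.
  case=> u uC cu.
    have vu := cl_nr cu.
    have uL : u \notin L.
      rewrite !inE; apply/negP => /orP[/orP[]|] /eqP e; rewrite e in vu.
      + by case: (near_w0 v vX vu) => e'; rewrite e' eqxx in v0 vw.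
      + by case: (near_w v vX vu) => e'; rewrite e' eqxx in v0 vw v2'.
      + by rewrite vu in v2.
    split; first by rewrite inl_pts.
    move: cu uL; rewrite /= => /or3P[->//|/andP[-> _]|/andP[-> _]] uL.
      by rewrite vS orbT.
    suff -> : u \notin S by rewrite !orbT.
    by apply/negP => /sS [] e; rewrite e !inE eqxx ?orbT in uL.
  exfalso; have := sC _ uC; rewrite !inE.
  case/orP: cu => /eqP e /orP[] /eqP e'; rewrite e e' ?pw0 ?pw eqxx // in v0 vw v2'.
have chain s f : s \in S -> f \in S -> [\/ s = f, par s = f | s = par f].
  move=> /(subsetP chS) + /(subsetP chS); rewrite !inE.
  by case/orP=> /eqP->; case/orP=> /eqP->; [constructor 1 | constructor 2 | constructor 3 | constructor 1].
case: (boolP (y2 \in S)) => y2S.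
  have w0S : w0 \notin S.
    apply/negP => /(chain y2 w0 y2S) [] e; first by rewrite e eqxx in w0y2.
      by have := w0leaf y2 y2X; rewrite e eqxx.
    by rewrite e pw0 eqxx in wy2.
  have wS : w \in S by move: hitS; rewrite (negPf w0S) orbF.
  have sS s : s \in S -> s = w \/ s = y2.
    move=> sS; case: (chain s w sS wS) => e; [by left | | by right; rewrite e].
    by move: (sS); rewrite (only s (subsetP sSX s sS) e) (negPf w0S).
  have onlyw v : v \in X -> v != y1 -> par v = y2 -> v = w.
    move=> vX v1 pv; apply/eqP/negPn/negP => vw.
    have [v0 [v0X pv0 v0leaf onlyv]] := grand v vX v1 pv.
    have vr : v != r by apply: contraNneq y2r => e; rewrite -pv e par_r.
    have vS : v \notin S.
      apply/negP => /sS [] e; first by rewrite e eqxx in vw.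
      by have := par_neq depP vr; rewrite pv e eqxx.
    have := nointact v; rewrite /intact vX pv eqxx v1 vS /= => /negP[].
    apply/forall_inP => c cXX; apply/implyP => /eqP /(onlyv c cXX) ->.
    apply/negP => /sS [] e.
      by have := par_neq depP vr; rewrite pv -pw -e pv0 eqxx.
    by have := par2_neq depP vr; rewrite pv -e pv0 e eqxx => /(_ y2r).
  (* Here [S] consists of w and y2, and w is the only child of y2 left. The middle above y2
     dominates y2 and y3; w dominates w0 and the middle of its own edge. *)
  apply: (finish (inr y2) (inl w)); rewrite ?inl_pts ?inr_pts //.
    by move=> s /sS [->|->]; [constructor 2 | constructor 3].
  case=> v; rewrite inE => vX0 h1 h2; last first.
    case: (sS v vX0) => e; rewrite e in h1 h2; first by rewrite cl_mid in h2.
    by rewrite cl_refl in h1.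
  exists v; split=> //.
  - by apply: contraNneq h2 => ->; rewrite -pw0 cl_par.
  - by apply: contraNneq h2 => ->; rewrite cl_refl.
  apply: contra h2 => /or3P[/eqP e|/eqP e|/eqP e].
  - by rewrite e /= eqxx in h1.
  - rewrite (onlyw v) ?cl_refl //; first by move: vX0; rewrite inE => /andP[].
    by move: vX0; rewrite !inE negb_or => /andP[/andP[]].
  - by rewrite /= e eqxx orbT in h1.
have sS s : s \in S -> s = w \/ s = w0.
  move=> sS; case/orP: hitS => fS; case: (chain s _ sS fS) => e.
  - by left.
  - by right; exact: only (subsetP sSX s sS) e.
  - by rewrite -pw -e sS in y2S.
  - by right.
  - by have := w0leaf s (subsetP sSX s sS); rewrite e eqxx.
  - by left; rewrite e.
(* Here [S] lies within w and w0. The vertex y2 dominates its own surroundings and the middle of the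
   edge at w, and [top S w0] the whole edge from w0 to w. *)
apply: (finish (inl y2) (top S w0)); rewrite ?inl_pts ?top_pts ?pw0 //.
  by move=> s /sS [->|->]; [constructor 2 | constructor 1].
case=> v; rewrite inE => vX0 h1 h2; last first.
  case: (sS v vX0) => e; rewrite e in h1 h2; last by rewrite cl_top_mid in h2.
  by rewrite -pw cl_mid_par in h1.
have vw0 : v != w0 by apply: contraNneq h2 => ->; rewrite cl_top.
have vw : v != w by apply: contraNneq h2 => ->; rewrite -pw0 cl_top_par.
exists v; split=> //; apply: contra h1 => /or3P[/eqP->|/eqP e|/eqP e].
- exact: cl_refl.
- rewrite -e cl_par //; apply/negP => /sS [] e'; by rewrite e' eqxx in vw vw0.
- by rewrite -e cl_child.
Qed.

End Branch.



End PendantPath.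
End Stable.

(** * Construction of stable trees *)

Section StableBuilt.
Variables (T : finType) (r : T) (par : T -> T) (dep : T -> nat).
Hypothesis par_r : par r = r.
Hypothesis depP : forall x, x != r -> dep x = (dep (par x)).+1.
Hypothesis one_child :
  forall x y, x != r -> y != r -> par x = r -> par y = r -> x = y.

Notation nr := (nr par).
Notation rcode := (rcode par).
Notation closed_up := (closed_up r par).
Notation built := (built r par).
Notation stable := (stable r par).
Implicit Types (x y z u v w : T) (X D : {set T}).

(** A single edge is stable but not built, hence the condition on the size, which has to be restored
    after each pruning. The label of the vertex where the path was attached is then read off the
    code of the pruned tree. *)
Lemma stable_built X : closed_up X -> #|X| != 2 -> stable X -> exists D, built X D.
Proof.
move: {2}#|X| (leqnn #|X|) => n; elim: n X => [|n IHn] X.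
  by rewrite leqn0 cards_eq0 => /eqP-> [] ; rewrite inE.
move=> szX clX X2 stX; have [rX cX] := clX.
case: (eqVneq X [set r]) => [->|nX]; first by exists [set r]; exact: built_root.
have [y0 [y0X y0r ymax]] := deepest depP clX nX.
have leafy := deepest_leaf par_r depP ymax y0r.
have y1X : par y0 \in X by exact: cX.
have y2X : par (par y0) \in X by exact: cX.
have deep_leaf v : v != r -> dep v = dep y0 -> forall c, c \in X -> par c != v.
  by move=> vr dv; apply: (deepest_leaf par_r depP _ vr) => x xX; rewrite dv ymax.
(* Vertices of greatest depth have no siblings, since these would be twin leaves. *)
have only v c : v \in X -> v != r -> dep v = dep y0 -> par v != r -> c \in X ->
    par c = par v -> c = v.
  move=> vX vr dv pvr cXX pc; apply/eqP/negPn/negP => cv.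
  have cr : c != r by apply: contraNneq pvr => e; rewrite -pc e par_r.
  have dc : dep c = dep y0 by rewrite (depP cr) pc -(depP vr).
  apply: (stable_no_twin_leaf depP stX clX vX vr (deep_leaf v vr dv) cXX cv).
  - by rewrite -pc eq_sym (par_neq depP).
  - by rewrite /nr pc eqxx orbT.
  move=> x xX /or3P[/eqP->|e|/eqP<-]; [by left | | by right].
  by have := deep_leaf c cr dc x xX; rewrite e.
case: (eqVneq (par y0) r) => [y1r|y1r].
  case/eqP: X2; suff -> : X = [set r; y0] by rewrite cards2 eq_sym y0r.
  apply/eqP; rewrite eqEsubset subUset !sub1set rX y0X !andbT; apply/subsetP => x xX.
  rewrite !inE; case: (eqVneq x r) => //= xr; apply/eqP.
  apply: one_child => //; apply/eqP/negPn/negP => pxr.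
  by have := ymax x xX; rewrite (depP xr) (depP y0r) y1r ltnS leqNgt (dep_root depP).
have only0 c : c \in X -> par c = par y0 -> c = y0 by move=> cXX; apply: only.
have szD (A : {set T}) : y0 \in A -> #|X :\: A| <= n.
  move=> y0A; rewrite -ltnS; apply: leq_trans szX; apply: proper_card.
  by apply/properP; split; [exact: subsetDl | exists y0; rewrite ?inE ?y0A].
have y21 : par (par y0) != par y0 by exact: (par_neq depP).
have y20 : par (par y0) != y0 by exact: (par2_neq depP).
case: (pickP (fun w => [&& w \in X, w != r, par w == par (par y0) & w != par y0])) =>
    [w /and4P[wX wr /eqP pw w1]|onlyw].
  have y2r : par (par y0) != r.
    by apply: contraNneq w1 => e; apply/eqP/one_child => //; rewrite pw.
  have child_deep v v0 : v \in X -> par v = par (par y0) -> v0 \in X -> par v0 = v ->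
      [/\ v != r, v0 != r & dep v0 = dep y0].
    move=> vX pv v0X pv0.
    have vr : v != r by apply: contraNneq y2r => e; rewrite -pv e par_r.
    have v0r : v0 != r by apply: contraNneq vr => e; rewrite -pv0 e par_r.
    by split=> //; rewrite (depP v0r) pv0 (depP vr) pv -(depP y1r) -(depP y0r).
  have stX0 : stable (X :\: [set par y0; y0]).
    case: (pickP (fun v => [&& v \in X, v != par y0, par v == par (par y0) &
        [forall c in X, par c != v]])) => [v /and4P[vX v1 /eqP pv /forall_inP vleaf]|noleaf].
      exact: (stable_branch_leaf par_r depP stX clX y0X erefl erefl y0r y1r y2r leafy only0 vX v1 pv vleaf).
    apply: (stable_branch par_r depP stX clX y0X erefl erefl y0r y1r y2r leafy only0 wX w1 pw).
    move=> v vX v1 pv; have := noleaf v; rewrite /= vX v1 pv eqxx /= => /negbT.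
    move=> /forall_inPn[v0 v0X]; rewrite negbK => /eqP pv0.
    have [vr v0r dv0] := child_deep v v0 vX pv v0X pv0.
    exists v0; split=> //; first exact: deep_leaf.
    by move=> c cXX pc; apply: only; rewrite ?pv0.
  have clX0 : closed_up (X :\: [set par y0; y0]).
    apply: closed_upD => //; first by rewrite !inE negb_or ![r == _]eq_sym y1r.
    move=> c cXX; rewrite !inE => /orP[/eqP e|e]; last by rewrite (negPf (leafy c cXX)) in e.
    by rewrite (only0 c) ?eqxx ?orbT.
  have w0 : w != y0.
    by apply: contraNneq y21 => e; rewrite -pw e.
  have w2 : w != par (par y0) by rewrite -pw eq_sym (par_neq depP).
  have inX0 v : v \in X -> v != par y0 -> v != y0 -> v \in X :\: [set par y0; y0].
    by move=> vX v1 v0; rewrite !inE negb_or v1 v0.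
  have [||D bD] := IHn _ _ clX0 _ stX0.
  - by apply: szD; rewrite !inE eqxx orbT.
  - apply/eqP => c2.
    have : [set r; par (par y0); w] \subset X :\: [set par y0; y0].
      rewrite !subUset !sub1set !inX0 // ?rX //; by rewrite eq_sym.
    move/subset_leq_card; rewrite c2 -setUA !cardsU1 cards1 !inE negb_or.
    by rewrite ![r == _]eq_sym y2r wr [_ == w]eq_sym w2.
  have codeD := built_rcode par_r depP bD.
  (* Either w or a child of w is a leaf of the pruned tree and hence in [D]. Together with y2 it
     would violate packing at w. *)
  have y2D : par (par y0) \notin D.
    have [_ _ pack _] := codeD.
    apply/negP => y2D; case: (boolP [forall c in X, par c != w]) => [/forall_inP wleaf|].
      have wD : w \in D.
        apply: (rcode_leaf_mem codeD clX0 (inX0 w wX w1 w0) wr).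
        by move=> d /setDP[dX _]; exact: wleaf.
      have e : par (par y0) = w.
        by apply: (pack w); rewrite ?inX0 // /nr ?pw ?eqxx ?orbT.
      by rewrite e eqxx in w2.
    move=> /forall_inPn[v0 v0X]; rewrite negbK => /eqP pv0.
    have [_ v0r dv0] := child_deep w v0 wX pw v0X pv0.
    have v00 : v0 != y0 by apply: contraNneq w1 => e; rewrite -pv0 e.
    have v01 : v0 != par y0 by apply: contraNneq w2 => e; rewrite -pv0 e.
    have v0D : v0 \in D.
      apply: (rcode_leaf_mem codeD clX0 (inX0 v0 v0X v01 v00) v0r).
      by move=> d /setDP[dX _]; exact: deep_leaf.
    have e : par (par y0) = v0.
      by apply: (pack w); rewrite ?inX0 // /nr ?pw ?pv0 ?eqxx ?orbT.
    by have := par2_neq depP v0r; rewrite pv0 pw e eqxx => /(_ wr).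
  exists (y0 |: D); rewrite -(setUD2 y1X y0X); apply: built_path2 => //.
  - by rewrite inX0.
  - by rewrite !inE eqxx.
  - by rewrite !inE eqxx orbT.
have y2r : par (par y0) != r.
  apply/eqP => y2r.
  (* If y2 were the root, the root would itself be a leaf attached to y1, a twin of y0. *)
  apply: (@stable_no_twin_leaf _ _ _ _ depP X y0 r stX clX y0X y0r leafy rX).
  - by rewrite eq_sym.
  - by rewrite eq_sym.
  - by rewrite /nr y2r eqxx !orbT.
  move=> x xX; case: (eqVneq x r) => [->|xr]; first by left.
  rewrite /nr par_r [r == x]eq_sym (negPf xr) orbF /= => /eqP px.
  by right; apply: one_child.
have only1 c : c \in X -> par c = par (par y0) -> c = par y0.
  move=> cXX pc; apply/eqP/negPn/negP => c1; have := onlyw c.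
  rewrite /= cXX pc eqxx c1 /= andbT => /negbT; rewrite negbK => /eqP e.
  by rewrite -pc e par_r eqxx in y2r.
have clX0 : closed_up (X :\: [set par (par y0); par y0; y0]).
  apply: closed_upD => //; first by rewrite !inE !negb_or ![r == _]eq_sym y1r y2r.
  move=> c cXX; rewrite !inE => /orP[/orP[/eqP e|/eqP e]|e].
  - by rewrite (only1 c) ?eqxx ?orbT.
  - by rewrite (only0 c) ?eqxx ?orbT.
  - by rewrite (negPf (leafy c cXX)) in e.
have stX0 := stable_path3 depP stX clX y0X erefl erefl y0r y1r y2r leafy only0 only1.
have omit := omit_y3 depP stX clX y0X erefl erefl y0r y1r y2r leafy only0 only1.
have y3X : par (par (par y0)) \in X by exact: cX.
have y32 : par (par (par y0)) != par (par y0) by exact: (par_neq depP).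
have y31 : par (par (par y0)) != par y0 by exact: (par2_neq depP).
have y30 : par (par (par y0)) != y0 by exact: leafy.
have y3X0 : par (par (par y0)) \in X :\: [set par (par y0); par y0; y0].
  by rewrite !inE !negb_or y32 y31 y30.
have [||D bD] := IHn _ _ clX0 _ stX0.
- by apply: szD; rewrite !inE eqxx !orbT.
- set X0 := X :\: _ in clX0 y3X0 omit *; set y3 := par (par (par y0)) in y3X0 omit *.
  have [rX0 cX0] := clX0.
  apply/eqP => c2.
  (* If y3 were the root, the second vertex of [X0] would be its only child y2, which has been
     pruned. *)
  have y3r : y3 != r.
    apply/eqP => y3r; have : 0 < #|X0 :\ r|.
      by rewrite lt0n; apply/eqP => h; move: (cardsD1 r X0); rewrite rX0 c2 h.
    case/card_gt0P=> v; rewrite in_setD1 => /andP[vr vX0].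
    have pvr : par v = r.
      apply/eqP/negPn/negP => pvr.
      have : [set r; par v; v] \subset X0 by rewrite !subUset !sub1set rX0 vX0 cX0.
      move/subset_leq_card; rewrite c2 -setUA !cardsU1 cards1 !inE negb_or.
      by rewrite ![r == _]eq_sym pvr vr (par_neq depP).
    have ev : v = par (par y0) by apply: one_child.
    by move: vX0; rewrite ev !inE eqxx.
  have eX0 : X0 = [set r; y3].
    apply/eqP; rewrite eq_sym eqEcard subUset !sub1set rX0 y3X0 c2 cards2.
    by rewrite eq_sym y3r.
  have py3 : par y3 = r.
    have : par y3 \in X0 by exact: cX0.
    by rewrite eX0 !inE => /orP[/eqP//|/eqP e]; have := par_neq depP y3r; rewrite e eqxx.
  (* The root alone dominates the edge from r to y3, so [omit] yields an empty set that still has to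
     dominate r. *)
  have dr : domx par X0 set0 pred0 [set inl r].
    split; first by rewrite sub1set inE.
    case=> x; rewrite ?inr_pts ?inl_pts ?in_set0 // eX0 !inE => /orP[] /eqP-> _; apply: (covI (set11 _)).
      exact: cl_refl.
    by rewrite -py3 cl_par ?inE.
  have [C [_ covC]] := omit _ dr; rewrite cards1 ltnS leqn0 => /eqP/cards0_eq eC.
  have : cov par set0 C (inl r).
    apply: covC; first by rewrite inE.
    by apply: contra y3r => /eqP[->].
  by case/existsP=> q; rewrite eC inE.
have codeD := built_rcode par_r depP bD.
(* Otherwise the set given by [omit], smaller than [D], would dominate every member of the packing
   [D]. *)
have y3D : par (par (par y0)) \in D.
  apply/negPn/negP => y3D.
  have [C dC lC] := omit _ (rcode_domx codeD).
  have : #|D| <= #|C|.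
    by apply: (rcode_min codeD dC) => d dD; apply: contra y3D => /eqP[<-].
  by rewrite card_inl in lC; rewrite leqNgt lC.
exists (y0 |: D); rewrite -(setUD3 y2X y1X y0X); apply: built_path3 => //.
- by rewrite !inE eqxx.
- by rewrite !inE eqxx orbT.
- by rewrite !inE eqxx orbT.
Qed.

End StableBuilt.

(** * The domination subdivision number *)

(** An equivalence for every bound [k] serves for lower and upper bounds alike, and applies to the
    tree as well as to its subdivisions. *)
Lemma gamma_domx (T : finType) (par : T -> T) (X S : {set T}) (H : sgraph)
    (f : H -> T + T) k :
  injective f -> (forall p, p \in pts X S <-> exists v, f v = p) ->
  (forall u v, near u v = cl par S (f u) (f v)) ->
  gamma H <= k <-> exists2 C, domx par X S pred0 C & #|C| <= k.
Proof.
move=> finj fim fcl; split=> [le_k|[C [/subsetP sC covC] lC]].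
  have [D /forall_inP dD cD] := gamma_ex H.
  exists (f @: D); last by rewrite card_imset // cD.
  split; first by apply/subsetP => _ /imsetP[v _ ->]; apply/fim; exists v.
  move=> p /fim[v <-] _; case: (boolP (v \in D)) => vD.
    by apply: cov_mem; rewrite imset_f.
  have /existsP[u /andP[uD vu]] := dD v vD.
  apply: (@covI _ _ _ _ _ (f u)); first by rewrite imset_f.
  by rewrite -fcl /near vu orbT.
apply: leq_trans lC; apply: (@leq_trans #|f @^-1: C|).
  apply: gamma_min; apply/forall_inP => v; rewrite inE => vC.
  have /existsP[q /andP[qC]] : cov par S C (f v) by apply: covC => //; apply/fim; exists v.
  have /fim[u fu] := sC q qC; rewrite -fu -fcl => /orP[/eqP e|vu].
    by rewrite e fu qC in vC.
  by apply/existsP; exists u; rewrite inE fu qC.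
rewrite -(card_imset _ finj); apply: subset_leq_card.
by apply/subsetP => _ /imsetP[v + ->]; rewrite inE.
Qed.

Section RootedGraph.
Variables (G : sgraph) (r : G) (par : G -> G) (dep : G -> nat).
Hypothesis rootG : rooting r par dep.
Implicit Types (x y u v : G) (D S : {set G}) (F : {set {set G}}).

Let par_r := par_root rootG.
Let depP := dep_par rootG.
Let adjE' := adjE rootG.

Lemma near_nr x y : near x y = nr par x y.
Proof. by rewrite /near /nr adjE'; case: (x == y). Qed.

Lemma adj_nr x y : (x -- y) = (y != x) && nr par x y.
Proof. by rewrite /nr adjE' [y == x]eq_sym; case: (x == y). Qed.

Lemma code_rcode D : code D <-> rcode par setT D.
Proof.
split=> [[dom pack leaf]|[_ dom pack leaf]].
  split; first exact: subsetT.
  - by move=> x _ /dom[d dD]; rewrite adj_nr => /andP[_ xd]; exists d.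
  - by move=> x d e _ dD eD xd xe; apply: (pack x) => //; rewrite near_nr.
  - move=> x _ /leaf[u uD]; rewrite adj_nr => /andP[ux xu].
    by exists u; rewrite inE.
split.
- move=> v vD; have [d dD vd] := dom v (in_setT _) vD; exists d => //.
  by rewrite adj_nr vd andbT; apply: contraNneq vD => <-.
- move=> v u w uD wD; rewrite !near_nr; exact: pack (in_setT _) uD wD.
- move=> v vD; have [u [_ uD uv vu]] := leaf v (in_setT _) vD; exists u => //.
  by rewrite adj_nr uv.
Qed.

Lemma adj_par x : x != r -> x -- par x.
Proof. by move=> xr; rewrite adj_nr (par_neq depP) // /nr eqxx orbT. Qed.

Lemma par_edge_inj x y : x != r -> y != r -> [set x; par x] = [set y; par y] -> x = y.
Proof.
move=> xr yr /set2_eq[[]//|[xpy pxy]].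
have pxr : par x != r by rewrite pxy.
by have := par2_neq depP xr pxr; rewrite pxy -xpy eqxx.
Qed.

Lemma edge_par (E : {set G}) : E \in edges G -> exists2 x, x != r & E = [set x; par x].
Proof.
case/imsetP=> -[a b]; rewrite inE /= => ab ->.
have nab : a != b by apply: contraTneq ab => ->; rewrite adj_irrefl.
move: ab; rewrite adjE' nab /= => /orP[/eqP e|/eqP e].
  exists a; last by rewrite e.
  by apply: contraNneq nab => ar; rewrite -e ar par_r.
exists b; last by rewrite e setUC.
by apply: contraNneq nab => br; rewrite -e br par_r.
Qed.

Definition lower_ends F : {set G} := [set x | (x != r) && ([set x; par x] \in F)].
Definition par_edges S : {set {set G}} := [set [set x; par x] | x in S].

Lemma lower_ends_par S : r \notin S -> lower_ends (par_edges S) = S.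
Proof.
move=> rS; apply/setP => x; rewrite inE; apply/andP/idP => [[xr /imsetP[y yS]]|xS].
  have yr : y != r by apply: contraNneq rS => <-.
  by move/(par_edge_inj xr yr)->.
by split; [apply: contraNneq rS => <- | exact: imset_f].
Qed.

Lemma par_edges_sub S : r \notin S -> par_edges S \subset edges G.
Proof.
move=> rS; apply/subsetP => _ /imsetP[x xS ->].
have xr : x != r by apply: contraNneq rS => <-.
by apply/imsetP; exists (x, par x); rewrite // inE /= adj_par.
Qed.

Lemma card_par_edges S : r \notin S -> #|par_edges S| = #|S|.
Proof.
move=> rS; apply: card_in_imset => x y xS yS; apply: par_edge_inj.
  by apply: contraNneq rS => <-.
by apply: contraNneq rS => <-.
Qed.

Lemma card_lower_ends F : #|lower_ends F| <= #|F|.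
Proof.
have rS : r \notin lower_ends F by rewrite inE eqxx.
rewrite -(card_par_edges rS); apply: subset_leq_card.
by apply/subsetP => _ /imsetP[x + ->]; rewrite inE => /andP[].
Qed.

Lemma gamma_root k : gamma G <= k <-> exists2 C, domx par setT set0 pred0 C & #|C| <= k.
Proof.
apply: (@gamma_domx _ _ _ _ G inl) => [x y []//|p|u v].
  split=> [|[v <-]]; last by rewrite !inE.
  by case: p => x; rewrite !inE // => _; exists x.
by rewrite near_nr /= !inE !andbT.
Qed.

Lemma gamma_subdivide F k : F \subset edges G ->
  gamma (subdivide F) <= k <->
  exists2 C, domx par setT (lower_ends F) pred0 C & #|C| <= k.
Proof.
move=> /subsetP sF; set S := lower_ends F.
have exlow (E : {E : {set G} | E \in F}) : exists x, (x != r) && (val E == [set x; par x]).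
  have [x xr e] := edge_par (sF _ (valP E)); exists x; rewrite xr; exact/eqP.
pose low E := xchoose (exlow E).
have lowP E : low E != r /\ val E = [set low E; par (low E)].
  by have /andP[? /eqP] := xchooseP (exlow E).
have SF x y : x != r -> par x = y -> ([set x; y] \in F) = (x \in S).
  by move=> xr <-; rewrite inE xr.
pose f (p : subdivide F) : G + G := match p with inl x => inl x | inr E => inr (low E) end.
apply: (@gamma_domx _ _ _ _ _ f).
- case=> [x|E] [y|E'] //=; first by case=> ->.
  by case=> e; congr inr; apply: val_inj; rewrite (lowP E).2 (lowP E').2 e.
- case=> x; rewrite ?inl_pts ?inr_pts; split=> [xS|[v fv]].
  + by exists (inl x).
  + by rewrite inE.
  + move: xS; rewrite inE => /andP[xr xF]; pose E : {E : {set G} | E \in F} := exist (fun E => E \in F) _ xF.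
    exists (inr E); congr inr; have [lr le] := lowP E.
    by apply: par_edge_inj => //; rewrite -le.
  + by case: v fv => //= E [<-]; have [lr le] := lowP E; rewrite inE lr -le (valP E).
case=> [x|E] [y|E'].
- rewrite /near /=; have -> : ((inl x : subdivide F) == inl y) = (x == y) by [].
  case: (eqVneq x y) => //= nxy.
  rewrite adjE' nxy /=.
  case: (eqVneq (par x) y) => [pxy|npx] /=.
    have xr : x != r by apply: contraNneq nxy => e; rewrite -pxy e par_r.
    rewrite (SF x y xr pxy); case: (eqVneq (par y) x) => [pyx|]; last by rewrite orbF.
    have pxr : par x != r by rewrite pxy; apply: contraNneq nxy => yr; rewrite -pyx yr par_r.
    by have := par2_neq depP xr pxr; rewrite pxy pyx eqxx.
  case: (eqVneq (par y) x) => [pyx|//] /=.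
  have yr : y != r by apply: contraNneq nxy => e; rewrite -pyx e par_r.
  by rewrite setUC (SF y x yr pyx).
- by rewrite /near /= (lowP E').2 !inE.
- by rewrite /near /= (lowP E).2 !inE.
rewrite /near /= orbF; apply/eqP/eqP => [[->]//|e].
by congr inr; apply: val_inj; rewrite (lowP E).2 (lowP E').2 e.
Qed.

Hypothesis one_child :
  forall x y, x != r -> y != r -> par x = r -> par y = r -> x = y.

(** Outside [D] the root would need one neighbour in [D] and another outside, but all its neighbours
    are children and there is at most one. *)
Lemma code_root D : code D -> r \in D.
Proof.
case=> dom _ leaf; apply/negPn/negP => rD.
have [u uD ru] := dom r rD; have [w wD rw] := leaf r rD.
have child v : r -- v -> v != r /\ par v = r.
  rewrite adjE' par_r => /andP[nrv]; rewrite (negPf nrv) /= => /eqP.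
  by rewrite eq_sym.
have [ur pu] := child u ru; have [wr pw] := child w rw.
by move: wD; rewrite -(one_child ur wr pu pw) uD.
Qed.

Lemma setT_closed : closed_up r par setT.
Proof. by split=> [|x _]; rewrite inE. Qed.

Lemma code_built D : code D -> built r par setT D.
Proof.
move=> codeD; apply: (rcode_built par_r depP); first exact: setT_closed.
  exact: code_root.
exact/code_rcode.
Qed.

Lemma built_code D : built r par setT D -> code D.
Proof. by move=> bD; apply/code_rcode; exact: built_rcode par_r depP _ _ bD. Qed.

Lemma code_uniq D D' : code D -> code D' -> D = D'.
Proof.
move=> cD cD'; apply: (rcode_uniq par_r depP); rewrite ?code_root //; exact/code_rcode.
Qed.

(** By minimality of 3, subdividing at most two edges never increases the domination number; in
    terms of lower ends this makes the full vertex set [stable]. *)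
Lemma dsn_code : 2 < #|G| -> domination_subdivision_number G 3 -> exists D, code D.
Proof.
move=> G3 [_ min3]; suff [D bD] : exists D, built r par setT D by exists D; exact: built_code.
apply: (stable_built par_r depP one_child setT_closed); first by rewrite cardsT gtn_eqF.
move=> S x _ rS chS C dC.
have F2 : #|par_edges S| <= 2.
  by rewrite card_par_edges //; apply: leq_trans (subset_leq_card chS) (card_set2 _ _).
have leF : gamma (subdivide (par_edges S)) <= gamma G.
  rewrite leqNgt; apply/negP => inc.
  have : 3 <= #|par_edges S| by apply: min3; split=> //; exact: par_edges_sub.
  by rewrite leqNgt ltnS F2.
have /(leq_trans leF) : gamma G <= #|C| by apply/gamma_root; exists C.
by move/(gamma_subdivide _ (par_edges_sub rS)); rewrite lower_ends_par.
Qed.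

Lemma code_dsn D : 2 < #|G| -> code D -> domination_subdivision_number G 3.
Proof.
move=> G3 codeD; have cD := (code_rcode D).1 codeD; have bD := code_built codeD.
have gD : gamma G <= #|D|.
  by apply/gamma_root; exists [set inl d | d in D]; [exact: rcode_domx | rewrite card_inl].
have Dg : #|D| <= gamma G.
  have [C dC lC] := (gamma_root (gamma G)).1 (leqnn _).
  by apply: leq_trans lC; exact: (rcode_min cD dC).
split.
  have nT : [set: G] != [set r].
    by apply: contraTneq G3 => e; rewrite -cardsT e cards1.
  have [S [_ rS cS incS]] := rcode_three par_r depP setT_closed (code_root codeD) cD nT.
  exists (par_edges S); rewrite card_par_edges //; split=> //; split.
    exact: par_edges_sub.
  apply: leq_ltn_trans gD _.
  have [C] := (gamma_subdivide _ (par_edges_sub rS)).1 (leqnn _).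
  by rewrite lower_ends_par // => dC; apply: leq_trans; exact: incS.
move=> F [sF]; rewrite ltnNge => inc; rewrite ltnNge; apply: contra inc => F2.
have [_ _ _ two] := built_flexible par_r depP bD.
have [|||C dC lC] := two (lower_ends F).
- exact: subsetT.
- by rewrite inE eqxx.
- exact: leq_trans (card_lower_ends F) F2.
by apply/(gamma_subdivide _ sF); exists C => //; apply: leq_trans Dg.
Qed.

End RootedGraph.

(** A deepest vertex of an arbitrary rooting is a leaf; the tree is rooted anew there. *)
Lemma leaf_rooting (G : sgraph) : is_tree G -> 1 < #|G| ->
  exists (r : G) par dep, rooting r par dep /\
    forall x y, x != r -> y != r -> par x = r -> par y = r -> x = y.
Proof.
move=> treeG G2; have [[G0 _] _] := treeG.
have /card_gt0P[r0 _] := G0.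
have [par [dep rootG]] := rootingP r0 treeG.
have nT : [set: G] != [set r0].
  by apply: contraTneq G2 => e; rewrite -cardsT e cards1.
have [y [_ yr ymax]] := deepest (dep_par rootG) (setT_closed r0 par) nT.
have leafy := deepest_leaf (par_root rootG) (dep_par rootG) ymax yr.
have [par' [dep' rootG']] := rootingP y treeG.
exists y, par', dep'; split=> // u v uy vy pu pv.
have nb w : w != y -> par' w = y -> w = par y.
  move=> wy pw; have : w -- y by rewrite -pw (adj_par rootG').
  rewrite (adjE rootG) wy /= => /orP[e|/eqP//].
  by rewrite (negPf (leafy w (in_setT _))) in e.
by rewrite (nb u) // (nb v).
Qed.

(** * The family F *)

Definition labA (l : label) : bool := if l is LA then true else false.

Lemma labAP l : labA l = false -> l = LB. Proof. by case: l. Qed.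

Section Family.
Variables (G : sgraph) (r : G) (par : G -> G) (dep : G -> nat).
Hypothesis rootG : rooting r par dep.

Let par_r := par_root rootG.
Let depP := dep_par rootG.

(** Here f identifies the labelled tree [H] with the subtree on [X] in such a way that [D]
    corresponds to the label A. *)
Record realizes (X D : {set G}) (H : sgraph) (l : H -> label) (f : H -> G) : Prop := Realizes {
  real_family : family_F l;
  real_inj : injective f;
  real_im : forall x, x \in X <-> exists g, f g = x;
  real_adj : forall g h, (f g -- f h) = (g -- h);
  real_lab : forall g, (f g \in D) = labA (l g) }.

Lemma adj_new X u x : closed_up r par X -> x \notin X -> u \in X ->
  (u -- x) = (par x == u).
Proof.
move=> cX xX uX; rewrite (adj_nr rootG) (nr_new cX xX uX).
by rewrite (notin_neqr uX xX).
Qed.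

(** The root alone is not in the family. The first step from it must attach three vertices, because
    the root is in [D], and the result r, x, y, z is the path P4 with labels A, B, B, A. *)
Lemma built_realizes X D : built r par X D ->
  X = [set r] \/ exists H l f, @realizes X D H l f.
Proof.
elim=> {X D} [|X D x y z bX IH pxD xX yX zX py pz|X D x y bX IH pxX pxD xX yX py].
- by left.
- right; have [cX /subsetP sD rD] := built_closed par_r bX.
  have pxX := sD _ pxD; have rX : r \in X by case: cX.
  have xr : x != r by apply: contraNneq xX => ->.
  have yr : y != r by apply: contraNneq yX => ->.
  have zr : z != r by apply: contraNneq zX => ->.
  have xy : x -- y by rewrite adj_sym -py (adj_par rootG).
  have yz : y -- z by rewrite adj_sym -pz (adj_par rootG).
  have nxz : x != z by rewrite -py -pz (par2_neq depP) ?pz.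
  have nxy : x != y by rewrite -py (par_neq depP).
  have nyz : y != z by rewrite -pz (par_neq depP).
  have xz : (x -- z) = false.
    by rewrite (adjE rootG) nxz pz [y == x]eq_sym (negPf nxy) orbF (notin_neq pxX zX).
  have aX u : u \in X -> [/\ (u -- x) = (par x == u), (u -- y) = false & (u -- z) = false].
    move=> uX; rewrite !(adj_new cX) // py pz.
    by rewrite (notin_neqr uX xX) (notin_neqr uX yX).
  have DX u : u \notin X -> (u \in D) = false by move=> uX; apply: contraNF uX => /sD.
  case: IH => [eX|[H [l [f [Hl finj fim fadj flab]]]]].
    have pxr : par x = r by move: pxX; rewrite eX => /set1P.
    have eD : D = [set r].
      apply/eqP; rewrite eqEsubset sub1set rD andbT -eX; exact/subsetP.
    have [rx ry rz] := aX r rX; rewrite pxr eqxx in rx.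
    exists (path_graph 4), (tnth [tuple LA; LB; LB; LA]), (fun i : 'I_4 => nth r [:: r; x; y; z] i).
    split; first exact: family_P4.
    + have : uniq [:: r; x; y; z].
        by rewrite /= !inE !negb_or ![r == _]eq_sym xr yr zr nxy nxz nyz.
      move=> /(uniqP r) h i j e; apply: val_inj; apply: h e; exact: ltn_ord.
    + move=> u; rewrite eX !inE; split=> [|[[[|[|[|[|i]]]] Hi] //= <-]]; rewrite ?eqxx ?orbT //.
      by case/or4P=> /eqP->; [exists (inord 1)|exists (inord 2)|exists (inord 3)|exists (inord 0)];
        rewrite inordK.
    + case=> [[|[|[|[|i]]]] Hi] // [[|[|[|[|j]]]] Hj] //=;
        by rewrite ?adj_irrefl ?rx ?ry ?rz ?xy ?xz ?yz // adj_sym ?rx ?ry ?rz ?xy ?xz ?yz.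
    + case=> [[|[|[|[|i]]]] Hi] //=; rewrite ?(tnth_nth LA) /= eD !inE ?eqxx ?orbT //;
        by rewrite ?(negPf xr) ?(negPf yr) ?(negPf nxz) ?(negPf nyz).
  have [v fv] := (fim (par x)).1 pxX.
  have lv : l v = LA by move: pxD; rewrite -fv flab; case: (l v).
  pose f' (a : attach_path v 3) : G :=
    match a with inl g => f g | inr i => nth r [:: x; y; z] i end.
  have fX g : f g \in X by apply/fim; exists g.
  exists (attach_path v 3), (attach_label l (v := v) [tuple LB; LB; LA]), f'.
  split; first exact: family_attach3.
  + have ui : uniq [:: x; y; z] by rewrite /= !inE !negb_or nxy nxz nyz.
    have nf g i : i < 3 -> f g <> nth r [:: x; y; z] i.
      move=> i3 e; have := fX g; rewrite e.
      by case: i i3 {e} => [|[|[|i]]] //= _; apply/negP.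
    case=> [g|i] [h|j] //= e.
    * by rewrite (finj _ _ e).
    * by case: (nf g j (ltn_ord j)).
    * by case: (nf h i (ltn_ord i)).
    * congr inr; apply: val_inj; move/(uniqP r): ui => h; apply: h e; exact: ltn_ord.
  + move=> u; rewrite !inE; split=> [|[[g <-|[[|[|[|i]]] Hi] //= <-]]]; rewrite ?fX ?eqxx ?orbT //.
    case/or4P=> [/eqP->|/eqP->|/eqP->|/fim[g fg]]; last by exists (inl g).
    * by exists (inr (inord 0)); rewrite /= inordK.
    * by exists (inr (inord 1)); rewrite /= inordK.
    * by exists (inr (inord 2)); rewrite /= inordK.
  + have fx g : (f g -- x) = (g == v).
      by have [-> _ _] := aX _ (fX g); rewrite -fv (inj_eq finj) eq_sym.
    have fy g : (f g -- y) = false by case: (aX _ (fX g)).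
    have fz g : (f g -- z) = false by case: (aX _ (fX g)).
    case=> [g|[[|[|[|i]]] Hi]] // [h|[[|[|[|j]]] Hj]] //=;
      rewrite ?adj_irrefl ?fadj ?fx ?fy ?fz ?xy ?xz ?yz ?andbT ?andbF //;
      by rewrite adj_sym ?fx ?fy ?fz ?xy ?xz ?yz ?andbT ?andbF.
  + case=> [g|[[|[|[|i]]] Hi]] //=; rewrite ?(tnth_nth LA) /= !inE ?eqxx //.
    * by rewrite flab (notin_neq (fX g) zX).
    * by rewrite (negPf nxz) DX.
    * by rewrite (negPf nyz) DX.
- right; have [cX /subsetP sD rD] := built_closed par_r bX.
  have rX : r \in X by case: cX.
  have yr : y != r by apply: contraNneq yX => ->.
  have xy : x -- y by rewrite adj_sym -py (adj_par rootG).
  have nxy : x != y by rewrite -py (par_neq depP).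
  have aX u : u \in X -> [/\ (u -- x) = (par x == u) & (u -- y) = false].
    by move=> uX; rewrite !(adj_new cX) // py (notin_neqr uX xX).
  have DX u : u \notin X -> (u \in D) = false by move=> uX; apply: contraNF uX => /sD.
  case: IH => [eX|[H [l [f [Hl finj fim fadj flab]]]]].
    by move: pxX pxD; rewrite eX => /set1P->; rewrite rD.
  have [v fv] := (fim (par x)).1 pxX.
  have lv : l v = LB by apply: labAP; rewrite -flab fv; exact: negPf.
  pose f' (a : attach_path v 2) : G :=
    match a with inl g => f g | inr i => nth r [:: x; y] i end.
  have fX g : f g \in X by apply/fim; exists g.
  exists (attach_path v 2), (attach_label l (v := v) [tuple LB; LA]), f'.
  split; first exact: family_attach2.
  + have ui : uniq [:: x; y] by rewrite /= !inE nxy.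
    have nf g i : i < 2 -> f g <> nth r [:: x; y] i.
      move=> i3 e; have := fX g; rewrite e.
      by case: i i3 {e} => [|[|i]] //= _; apply/negP.
    case=> [g|i] [h|j] //= e.
    * by rewrite (finj _ _ e).
    * by case: (nf g j (ltn_ord j)).
    * by case: (nf h i (ltn_ord i)).
    * congr inr; apply: val_inj; move/(uniqP r): ui => h; apply: h e; exact: ltn_ord.
  + move=> u; rewrite !inE; split=> [|[[g <-|[[|[|i]] Hi] //= <-]]]; rewrite ?fX ?eqxx ?orbT //.
    case/or3P=> [/eqP->|/eqP->|/fim[g fg]]; last by exists (inl g).
    * by exists (inr (inord 0)); rewrite /= inordK.
    * by exists (inr (inord 1)); rewrite /= inordK.
  + have fx g : (f g -- x) = (g == v).
      by have [-> _] := aX _ (fX g); rewrite -fv (inj_eq finj) eq_sym.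
    have fy g : (f g -- y) = false by case: (aX _ (fX g)).
    case=> [g|[[|[|i]] Hi]] // [h|[[|[|j]] Hj]] //=;
      rewrite ?adj_irrefl ?fadj ?fx ?fy ?xy ?andbT ?andbF //;
      by rewrite adj_sym ?fx ?fy ?xy ?andbT ?andbF.
  + case=> [g|[[|[|i]] Hi]] //=; rewrite ?(tnth_nth LA) /= !inE ?eqxx //.
    * by rewrite flab (notin_neq (fX g) yX).
    * by rewrite (negPf nxy) DX.
Qed.

Lemma built_in_family D : 2 < #|G| -> built r par setT D -> in_family_F G.
Proof.
move=> G3 /built_realizes [e|[H [l [f [Hl finj fim fadj _]]]]].
  by rewrite -cardsT e cards1 in G3.
exists H, l; split=> //; apply: (giso_inj_surj finj _ fadj) => x.
exact/fim.
Qed.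

End Family.

Lemma family_code (G : sgraph) (l : G -> label) : family_F l -> code [set g | labA (l g)].
Proof.
elim=> {G l} [|G l v Hl [dom pack leaf] lv|G l v Hl [dom pack leaf] lv].
- split.
  + case=> [[|[|[|[|i]]]] Hi] //; rewrite inE ?(tnth_nth LA) // => _.
      by exists (@Ordinal 4 0 isT); rewrite ?inE ?(tnth_nth LA).
    by exists (@Ordinal 4 3 isT); rewrite ?inE ?(tnth_nth LA).
  + case=> [[|[|[|[|i]]]] Hi] // [[|[|[|[|j]]]] Hj] // [[|[|[|[|k]]]] Hk] //;
      rewrite !inE ?(tnth_nth LA) // => _ _ _ _; exact: val_inj.
  + case=> [[|[|[|[|i]]]] Hi] //; rewrite inE ?(tnth_nth LA) // => _.
      by exists (@Ordinal 4 2 isT); rewrite ?inE ?(tnth_nth LA).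
    by exists (@Ordinal 4 1 isT); rewrite ?inE ?(tnth_nth LA).
- have inlP a : (inl a : attach_path v 3) \in [set g | labA (attach_label l (v := v) [tuple LB; LB; LA] g)] = (a \in [set g | labA (l g)]).
    by rewrite !inE.
  pose i0 : attach_path v 3 := inr (@Ordinal 3 0 isT).
  pose i1 : attach_path v 3 := inr (@Ordinal 3 1 isT).
  pose i2 : attach_path v 3 := inr (@Ordinal 3 2 isT).
  split.
  + case=> [a|[[|[|[|i]]] Hi]] //.
    * rewrite inlP => /dom[u uD au]; exists (inl u) => //; by rewrite inlP.
    * by move=> _; exists (inl v); rewrite ?inlP ?inE ?lv //= eqxx.
    * by move=> _; exists i2; rewrite ?inE //= ?(tnth_nth LA).
    * by rewrite inE /= ?(tnth_nth LA).
  + case=> [a|[[|[|[|i]]] Hi]] // [b|[[|[|[|j]]] Hj]] // [c|[[|[|[|k]]] Hk]] //;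
      rewrite ?inlP ?[inr _ \in _]inE /= ?(tnth_nth LA) //=;
      try (by rewrite /near /= ?andbF); try (by move=> *; congr inr; exact: val_inj).
    * by move=> bD cD ab ac; rewrite (pack a b c).
    * by rewrite /near /= !andbT => _ _ /eqP-> /eqP->.
  + case=> [a|[[|[|[|i]]] Hi]] //.
    * rewrite inlP => /leaf[u uD au]; exists (inl u) => //; by rewrite inlP.
    * by move=> _; exists i1; rewrite ?inE //= ?(tnth_nth LA).
    * by move=> _; exists i0; rewrite ?inE //= ?(tnth_nth LA).
    * by rewrite inE /= ?(tnth_nth LA).
- have inlP a : (inl a : attach_path v 2) \in [set g | labA (attach_label l (v := v) [tuple LB; LA] g)] = (a \in [set g | labA (l g)]).
    by rewrite !inE.
  pose i0 : attach_path v 2 := inr (@Ordinal 2 0 isT).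
  pose i1 : attach_path v 2 := inr (@Ordinal 2 1 isT).
  split.
  + case=> [a|[[|[|i]] Hi]] //.
    * rewrite inlP => /dom[u uD au]; exists (inl u) => //; by rewrite inlP.
    * by move=> _; exists i1; rewrite ?inE //= ?(tnth_nth LA).
    * by rewrite inE /= ?(tnth_nth LA).
  + case=> [a|[[|[|i]] Hi]] // [b|[[|[|j]] Hj]] // [c|[[|[|k]] Hk]] //;
      rewrite ?inlP ?[inr _ \in _]inE /= ?(tnth_nth LA) //=;
      try (by rewrite /near /= ?andbF); try (by move=> *; congr inr; exact: val_inj).
    * by move=> bD cD ab ac; rewrite (pack a b c).
    * by rewrite /near /= => bD _ /andP[/eqP e _] _; rewrite e inE lv in bD.
    * by rewrite /near /= => bD _ /andP[/eqP e _] _; rewrite e inE lv in bD.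
    * by rewrite /near /= => _ cD _ /andP[/eqP e _]; rewrite e inE lv in cD.
  + case=> [a|[[|[|i]] Hi]] //.
    * rewrite inlP => /leaf[u uD au]; exists (inl u) => //; by rewrite inlP.
    * by move=> _; exists (inl v); rewrite ?inlP ?inE ?lv //= eqxx.
    * by rewrite inE /= ?(tnth_nth LA).
Qed.

Lemma connect_map (A B : finType) (e : rel A) (e' : rel B) (f : A -> B) :
  (forall a b, e a b -> connect e' (f a) (f b)) ->
  forall a b, connect e a b -> connect e' (f a) (f b).
Proof.
move=> hf a b /connectP[p pp ->]; elim: p a pp => [|c p IH] a /=.
  by move=> _; exact: connect0.
by case/andP=> /hf ac /IH; exact: connect_trans ac.
Qed.

(** * Coronas *)

Section CodeCorona.
Variables (G : sgraph) (D : {set G}).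
Hypotheses (treeG : is_tree G) (codeD : code D).

(** The member of the code in the closed neighbourhood of v; domination ensures that the default is
    never taken. *)
Let pr v : G := if v \in D then v else odflt v [pick d in D | v -- d].

Lemma prP v : v \notin D -> pr v \in D /\ v -- pr v.
Proof.
move=> vD; rewrite /pr (negPf vD); case: pickP => [d /andP[]//|no].
by have [dom _ _] := codeD; have [d dD vd] := dom v vD; have := no d; rewrite /= dD vd.
Qed.

Lemma pr_in v : pr v \in D.
Proof. by case: (boolP (v \in D)) => [vD|/prP[]//]; rewrite /pr vD. Qed.

Lemma pr_id v : v \in D -> pr v = v. Proof. by rewrite /pr => ->. Qed.

Lemma pr_eq v d : d \in D -> near v d -> pr v = d.
Proof.
have [_ pack _] := codeD => dD vd; apply: (pack v); rewrite ?pr_in //.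
case: (boolP (v \in D)) => [/pr_id->|/prP[_ h]]; first exact: near_refl.
by rewrite /near h orbT.
Qed.

Lemma code_indep d e : d \in D -> e \in D -> (d -- e) = false.
Proof.
move=> dD eD; apply/negP => de.
have : pr d = e by apply: pr_eq; rewrite // /near de orbT.
by rewrite pr_id // => e'; rewrite e' adj_irrefl in de.
Qed.

Lemma bridge (x y : G) : x -- y -> ~~ connect (del x y) x y.
Proof. by case: treeG => _ /acyclicP; apply. Qed.

(** The edge from v to [pr v] has an end in the code, so it is not the edge st. *)
Lemma connect_pr s t v : s \notin D -> t \notin D -> connect (del s t) v (pr v).
Proof.
move=> sD tD; case: (boolP (v \in D)) => [/pr_id->|/prP[pD vp]]; first exact: connect0.
apply: connect1; rewrite /del vp /=; apply/eqP => /set2_eq[[_ e]|[_ e]].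
  by rewrite -e pD in tD.
by rewrite -e pD in sD.
Qed.

Lemma connect_del_sym s t : connect_sym (@del G s t).
Proof. exact: sym_connect_sym (@del_sym _ s t). Qed.

Lemma pr_neq s t : s \notin D -> t \notin D -> s -- t -> pr s != pr t.
Proof.
move=> sD tD st; apply: contraL (bridge st) => /eqP e; rewrite negbK.
apply: (connect_trans (connect_pr s sD tD)); rewrite e connect_del_sym.
exact: connect_pr.
Qed.

(** Two closed neighbourhoods are joined by at most one edge: a second one would yield a detour
    around the bridge st through the two centres. *)
Lemma pr_edge_inj s t s' t' : s \notin D -> t \notin D -> s' \notin D -> t' \notin D ->
  s -- t -> s' -- t' -> pr s = pr s' -> pr t = pr t' -> s = s' /\ t = t'.
Proof.
move=> sD tD s'D t'D st st' es et.
case: (eqVneq [set s'; t'] [set s; t]) => [/set2_eq[[-> ->]//|[e _]]|ne].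
  by have := pr_neq sD tD st; rewrite es e eqxx.
have /negP[] := bridge st.
apply: (connect_trans (connect_pr s sD tD)); rewrite es.
apply: (@connect_trans _ _ s'); first by rewrite connect_del_sym connect_pr.
apply: (@connect_trans _ _ t'); first by apply: connect1; rewrite /del st'.
apply: (connect_trans (connect_pr t' sD tD)); rewrite -et.
by rewrite connect_del_sym connect_pr.
Qed.

Let dT : finType := {d : G | d \in D}.
Let prT v : dT := exist _ (pr v) (pr_in v).

Let cut (d e : dT) s t :=
  [&& s \notin D, t \notin D, s -- t, pr s == val d & pr t == val e].

Definition contract_adj (d e : dT) := [exists s, exists t, cut d e s t].

Lemma contract_adjP d e : reflect (exists s t, cut d e s t) (contract_adj d e).
Proof.
apply: (iffP existsP) => [[s /existsP[t]]|[s [t h]]]; first by exists s, t.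
by exists s; apply/existsP; exists t.
Qed.

Lemma contract_sym : symmetric contract_adj.
Proof.
suff sub d e : contract_adj d e -> contract_adj e d.
  by move=> d e; apply/idP/idP; exact: sub.
case/contract_adjP=> s [t /and5P[sD tD st ps pt]]; apply/contract_adjP; exists t, s.
by rewrite /cut sD tD adj_sym st ps pt.
Qed.

Lemma contract_irrefl : irreflexive contract_adj.
Proof.
move=> d; apply/contract_adjP => -[s [t /and5P[sD tD st /eqP ps /eqP pt]]].
by have := pr_neq sD tD st; rewrite ps pt eqxx.
Qed.

(* The tree T' of the corona: its vertices are the members of the code, joined
   when their closed neighbourhoods are joined by an edge. *)
Definition contract : sgraph := SGraph contract_sym contract_irrefl.

Lemma contract_step v w : v -- w -> connect contract_adj (prT v) (prT w).
Proof.
move=> vw; case: (eqVneq (prT v) (prT w)) => [->|ne]; first exact: connect0.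
have ne' : pr v != pr w by apply: contra ne => /eqP e; apply/eqP/val_inj.
apply: connect1; apply/contract_adjP; exists v, w; rewrite /cut vw !eqxx !andbT.
case: (boolP (v \in D)) => vD.
  by rewrite (pr_id vD) (@pr_eq w v) ?eqxx // /near adj_sym vw orbT in ne'.
case: (boolP (w \in D)) => //= wD.
by rewrite (pr_id wD) (@pr_eq v w) ?eqxx // /near vw orbT in ne'.
Qed.

(** Each edge of the contraction comes from a unique edge st of the tree. A walk in the contraction
    avoiding it lifts to a walk avoiding st, because inside the closed neighbourhoods one can move
    without using st. *)
Lemma contract_tree : is_tree contract.
Proof.
have [[G0 conG] _] := treeG; split.
  split; first by have /card_gt0P[v _] := G0; apply/card_gt0P; exists (prT v).
  move=> d e.
  have ed : d = prT (val d) by apply: val_inj; rewrite /= pr_id ?(valP d).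
  have ee : e = prT (val e) by apply: val_inj; rewrite /= pr_id ?(valP e).
  by rewrite {}ed {}ee; apply: (connect_map contract_step); exact: conG.
apply/acyclicP => d e /contract_adjP[s [t /and5P[sD tD st /eqP ps /eqP pt]]].
have step a b : del (G := contract) d e a b -> connect (del s t) (val a) (val b).
  case/andP=> /contract_adjP[s' [t' /and5P[s'D t'D st' /eqP ps' /eqP pt']]] ne.
  rewrite -ps' -pt'; apply: (@connect_trans _ _ s'); first by rewrite connect_del_sym connect_pr.
  apply: (connect_trans _ (connect_pr t' sD tD)); apply: connect1.
  rewrite /del st' /=; apply: contra ne => /eqP /set2_eq[[es et]|[es et]].
    have -> : a = d by apply: val_inj; rewrite -ps' -ps es.
    by have -> : b = e by apply: val_inj; rewrite -pt' -pt et.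
  have -> : a = e by apply: val_inj; rewrite -ps' -pt es.
  have -> : b = d by apply: val_inj; rewrite -pt' -ps et.
  by rewrite setUC.
apply: contra (bridge st) => /(connect_map step) c.
apply: (connect_trans (connect_pr s sD tD)); rewrite ps.
by apply: (connect_trans c); rewrite -pt connect_del_sym connect_pr.
Qed.

(** A vertex s outside the code is to become the internal vertex with centre [pr s] and part
    [part s], the set of centres of the neighbourhoods that s is joined to. *)
Let part s : {set dT} := [set e | [exists t, [&& t \notin D, s -- t & pr t == val e]]].

Lemma partP s e : reflect (exists t, [/\ t \notin D, s -- t & pr t = val e]) (e \in part s).
Proof.
rewrite inE; apply: (iffP existsP) => [[t /and3P[? ? /eqP]]|[t [tD st pt]]].
  by exists t.
by exists t; rewrite tD st pt eqxx.
Qed.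

Definition contract_parts : {ffun contract -> {set {set contract}}} :=
  [ffun d => [set part s | s in [set s | (s \notin D) && (pr s == val d)]]].

Lemma part_inj s s' e : s \notin D -> s' \notin D -> pr s = pr s' ->
  e \in part s -> e \in part s' -> s = s'.
Proof.
move=> sD s'D es /partP[t [tD st pt]] /partP[t' [t'D st' pt']].
by have [] := pr_edge_inj sD tD s'D t'D st st' es (etrans pt (esym pt')).
Qed.

(** Parts are nonempty because leaves are in the code: a leaf outside it would have an empty
    part. *)
Lemma part_ex s : s \notin D -> exists e, e \in part s.
Proof.
have [_ _ leaf] := codeD => sD; have [t tD st] := leaf s sD.
by exists (prT t); apply/partP; exists t.
Qed.

Lemma contract_partition : nbhd_partition contract_parts.
Proof.
apply/forallP => d; rewrite ffunE; apply/and3P; split.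
- apply/eqP/setP => e; apply/bigcupP/idP => [[_ /imsetP[s + ->]]|].
    rewrite inE => /andP[sD ps] /partP[t [tD st pt]]; rewrite inE.
    by apply/contract_adjP; exists s, t; rewrite /cut sD tD st ps pt eqxx.
  rewrite inE => /contract_adjP[s [t /and5P[sD tD st ps /eqP pt]]].
  exists (part s); first by rewrite imset_f // inE sD.
  by apply/partP; exists t.
- apply/trivIsetP => _ _ /imsetP[s + ->] /imsetP[s' + ->].
  rewrite !inE => /andP[sD /eqP ps] /andP[s'D /eqP ps'].
  rewrite disjoint_subset => ne; apply/subsetP => e es; rewrite inE.
  apply: contra ne => es'; rewrite (@part_inj s s' e) //; by rewrite ps ps'.
- apply/imsetP => -[s]; rewrite inE => /andP[/part_ex[e es] _] e0.
  by rewrite -e0 inE in es.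
Qed.

Lemma code_corona : giso G (gcorona contract_parts).
Proof.
have adjD v d : v \notin D -> d \in D -> (v -- d) = (pr v == d).
  move=> vD dD; apply/idP/eqP => [vd|<-]; last by case: (prP vD).
  by apply: pr_eq; rewrite // /near vd orbT.
(* An internal vertex goes back to the vertex having its centre and its part, unique by [part_inj].
   The default is never reached, since every part is some [part s]. *)
pose g (a : gcorona contract_parts) : G := match a with
  | inl d => val d
  | inr x => odflt (val (val x).1)
      [pick s | [&& s \notin D, pr s == val (val x).1 & part s == (val x).2]] end.
have gP x : [/\ g (inr x) \notin D, pr (g (inr x)) = val (val x).1 &
                part (g (inr x)) = (val x).2].
  rewrite /g; case: pickP => [s /and3P[? /eqP ? /eqP]//|no].
  have := valP x; rewrite ffunE => /imsetP[s]; rewrite inE => /andP[sD ps] e.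
  by have := no s; rewrite sD ps e eqxx.
have gD d : g (inl d) \in D by exact: valP.
apply: (@giso_inj_surj _ _ g).
- case=> [d|x] [e|y] h.
  + by congr inl; exact: val_inj.
  + by have [] := gP y; rewrite -h gD.
  + by have [] := gP x; rewrite h gD.
  + have [_ x1 x2] := gP x; have [_ y1 y2] := gP y.
    congr inr; apply: val_inj; rewrite [LHS]surjective_pairing [RHS]surjective_pairing.
    rewrite -x2 -y2 h; congr pair; apply: val_inj.
    by rewrite -x1 -y1 h.
- move=> v; case: (boolP (v \in D)) => vD; first by exists (inl (exist _ v vD)).
  have vP : (prT v, part v).2 \in contract_parts (prT v, part v).1.
    by rewrite /= ffunE; apply/imsetP; exists v; rewrite // inE vD /= eqxx.
  pose x : {x : contract * {set contract} | x.2 \in contract_parts x.1} :=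
    exist (fun x : contract * {set contract} => x.2 \in contract_parts x.1) (prT v, part v) vP.
  exists (inr x); have [gxD gx1 gx2] := gP x; have [e ev] := part_ex vD.
  by apply: (@part_inj _ _ e) => //; rewrite gx2.
case=> [d|x] [e|y].
- by rewrite code_indep.
- have [yD y1 _] := gP y; rewrite adj_sym adjD // y1 /=.
  by rewrite eq_sym.
- by have [xD x1 _] := gP x; rewrite adjD // x1 /= eq_sym.
have [xD x1 x2] := gP x; have [yD y1 y2] := gP y.
apply/idP/and3P => [xy|[_]].
  split.
  - apply/contract_adjP; exists (g (inr x)), (g (inr y)).
    by rewrite /cut xD yD xy x1 y1 !eqxx.
  - by rewrite -x2; apply/partP; exists (g (inr y)).
  - by rewrite -y2; apply/partP; exists (g (inr x)); rewrite adj_sym.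
(* Each of the two memberships provides an edge between the same two neighbourhoods; by
   [pr_edge_inj] both are the same edge, which therefore joins the two given vertices. *)
rewrite -x2 -y2 => /partP[t [tD xt pt]] /partP[s [sD ys ps]].
have [_ e] : g (inr x) = s /\ t = g (inr y).
  by apply: pr_edge_inj; rewrite // ?[s -- _]adj_sym // ?pt ?ps ?x1 ?y1.
by rewrite -e.
Qed.

End CodeCorona.

(** * Codes of general coronas and sequences of contractions *)

Section Corona.
Variable G : sgraph.
Implicit Types (P Q : {ffun G -> {set {set G}}}) (v u : G) (A B C : {set G}).

Lemma part_sub P v A u : nbhd_partition P -> A \in P v -> u \in A -> v -- u.
Proof.
move=> /forallP/(_ v)/and3P[/eqP cP _ _] AP uA.
by have : u \in nbhd v; [rewrite -cP; apply/bigcupP; exists A | rewrite inE].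
Qed.

Lemma part_of P v u : nbhd_partition P -> v -- u -> exists2 A, A \in P v & u \in A.
Proof.
move=> /forallP/(_ v)/and3P[/eqP cP _ _] vu.
by have : u \in nbhd v; [rewrite inE | rewrite -cP => /bigcupP[A ? ?]; exists A].
Qed.

Lemma part_uniq P v u A B : nbhd_partition P -> A \in P v -> B \in P v ->
  u \in A -> u \in B -> A = B.
Proof.
move=> /forallP/(_ v)/and3P[_ /trivIsetP tP _] AP BP uA uB.
apply/eqP/negPn/negP => /(tP A B AP BP); rewrite disjoint_subset.
by move/subsetP/(_ u uA); rewrite inE uB.
Qed.

Lemma part_neq0 P v A : nbhd_partition P -> A \in P v -> exists u, u \in A.
Proof.
move=> /forallP/(_ v)/and3P[_ _ n0] AP; apply/set0Pn.
by apply: contraNneq n0 => <-.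
Qed.

(** The external vertices form a code. An internal vertex is adjacent to exactly one of them, and an
    element of its nonempty part gives it an internal neighbour. *)
Lemma gcorona_code P : nbhd_partition P -> exists D : {set gcorona P}, code D.
Proof.
move=> hP; exists [set inl v | v in [set: G]].
have inlD v : (inl v : gcorona P) \in [set inl v | v in [set: G]] by rewrite imset_f.
have inrD x : (inr x : gcorona P) \notin [set inl v | v in [set: G]].
  by apply/imsetP => -[].
split.
- case=> [v|x]; first by rewrite inlD.
  by move=> _; exists (inl (val x).1) => //=.
- move=> a _ _ /imsetP[v _ ->] /imsetP[w _ ->]; case: a => [u|x].
    by rewrite /near /= !orbF => /eqP-> /eqP->.
  by rewrite /near /= => /eqP-> /eqP->.
case=> [v|[[v A] /= AP]]; first by rewrite inlD.
move=> _; have [u uA] := part_neq0 hP AP; have vu := part_sub hP AP uA.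
have [|B BP vB] := @part_of P u v hP; first by rewrite adj_sym.
by exists (inr (exist (fun x : G * {set G} => x.2 \in P x.1) (u, B) BP)); rewrite ?inrD //= vu uA vB.
Qed.

Lemma contraction_partition P Q : internal_contraction P Q -> nbhd_partition Q.
Proof.
case/andP=> hP /existsP[v /existsP[A /andP[hA /existsP[B /andP[hB /andP[nAB /eqP->]]]]]].
by case: (gcorona_merge_parts hA hB hP nAB).
Qed.

Lemma connect_invariant (I : pred {ffun G -> {set {set G}}}) (step : rel {ffun G -> {set {set G}}}) P Q :
  (forall P Q, I P -> step P Q -> I Q) -> connect step P Q -> I P -> I Q.
Proof.
move=> hI /connectP[p pp ->]; elim: p P pp => //= R p IH P /andP[PR /IH h] IP.
exact: h (hI _ _ IP PR).
Qed.

(** While [Q] differs from [P], some part of [P] contains two parts of [Q]. Merging these keeps the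
    refinement and lowers the total number of parts. *)
Lemma refine_connect P Q : nbhd_partition Q -> nbhd_partition P ->
  (forall v A, A \in Q v -> exists2 B, B \in P v & A \subset B) ->
  connect (@internal_contraction G) Q P.
Proof.
move: {2}(\sum_v #|Q v|) (leqnn (\sum_v #|Q v|)) => n.
elim/ltn_ind: n Q => n IHn Q szQ hQ hP ref.
case: (eqVneq Q P) => [->|nQP]; first exact: connect0.
have [v nv] : exists v, Q v != P v.
  by apply/existsP; apply: contraNT nQP => /existsPn h; apply/eqP/ffunP => v; apply/eqP/negPn.
have [A [B [C [AQ BQ CP nAB [AC BC]]]]] : exists A B C,
    [/\ A \in Q v, B \in Q v, C \in P v, A != B & A \subset C /\ B \subset C].
  pose bad (x : {set G} * {set G} * {set G}) :=
    [&& x.1.1 \in Q v, x.1.2 \in Q v, x.2 \in P v, x.1.1 != x.1.2 & (x.1.1 \subset x.2) && (x.1.2 \subset x.2)].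
  case: (pickP bad) => [[[A B] C] /and5P[? ? ? ? /andP[]]|no]; first by exists A, B, C.
  (* If no part of [P v] contained two parts of [Q v], each part of [Q v] would fill the part around
     it, and both partitions would agree at v. *)
  have sQP A : A \in Q v -> A \in P v.
    move=> AQ; have [C CP AC] := ref v A AQ.
    suff -> : A = C by [].
    apply/eqP; rewrite eqEsubset AC; apply/subsetP => u uC; apply/negPn/negP => uA.
    have [B BQ uB] := part_of hQ (part_sub hP CP uC).
    have [C' C'P BC'] := ref v B BQ.
    have eC : C' = C by apply: (part_uniq hP C'P CP _ uC); exact: (subsetP BC').
    have := no (A, B, C); rewrite /bad /= AQ BQ CP AC -{1}eC BC' /= andbT.
    by move/negbT/negPn/eqP => e; rewrite e uB in uA.
  case/eqP: nv; apply/setP => C; apply/idP/idP; first exact: sQP.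
  move=> CP; have [u uC] := part_neq0 hP CP.
  have [B BQ uB] := part_of hQ (part_sub hP CP uC).
  by rewrite (part_uniq hP CP (sQP B BQ) uC uB).
have [hQ' _] := gcorona_merge_parts AQ BQ hQ nAB.
set Q' := merge_parts Q v A B in hQ'.
have QQ' : internal_contraction Q Q'.
  rewrite /internal_contraction hQ; apply/existsP; exists v; apply/existsP; exists A.
  by rewrite AQ; apply/existsP; exists B; rewrite BQ nAB eqxx.
apply: (connect_trans (connect1 QQ')).
apply: (IHn (\sum_v #|Q' v|)) => //.
  apply: leq_trans szQ; rewrite (bigD1 v) //= [X in _ < X](bigD1 v) //=.
  rewrite -addSn; apply: leq_add; last first.
    by apply: leq_sum => w wv; rewrite ffunE (negPf wv).
  rewrite ffunE eqxx cardsU1; have := @cardsD_sub _ (Q v) [set A; B] [set A; B].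
  rewrite subUset !sub1set AQ BQ => /(_ isT (subxx _)); rewrite cards2 nAB addn2.
  by apply: leq_trans; rewrite -addn1 addnC !add1n ltnS; case: (_ \notin _) => //=; rewrite ltnW.
move=> w E; rewrite ffunE; case: eqP => [->|_]; last exact: ref.
case/setU1P=> [->|/setDP[EQ _]]; last exact: ref.
by exists C; rewrite // subUset AC BC.
Qed.

End Corona.

Lemma connect_flip (T : finType) (e : rel T) x y :
  connect e x y -> connect (fun a b => e b a) y x.
Proof.
case/connectP=> p pp ->; elim: p x pp => [|z p IH] x /=; first by rewrite connect0.
by case/andP=> xz /IH h; apply: connect_trans h _; exact: connect1.
Qed.

(** An isolated vertex of a tree is the whole tree, whose general corona is a single vertex. This
    yields the hypothesis of [gcorona_neighbourhoods]. *)
Lemma gcorona_nontrivial (G : sgraph) (P : {ffun G -> {set {set G}}}) (v : G) :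
  is_tree G -> nbhd_partition P -> 1 < #|gcorona P| -> nbhd v != set0.
Proof.
move=> [[_ conG] _] hP; apply: contraTneq => nv0.
have allv w : w = v.
  have /connectP[p pp ->] := conG v w; case: p pp => //= u p /andP[vu _].
  have uN : u \in nbhd v by rewrite inE.
  by rewrite nv0 inE in uN.
suff all a : a = (inl v : gcorona P).
  rewrite -leqNgt -(cards1 (inl v : gcorona P)); apply: subset_leq_card.
  by apply/subsetP => a _; rewrite (all a) set11.
case: a => [w|[[w A] /= AP]]; first by rewrite (allv w).
have [u uA] := part_neq0 hP AP.
have wu : w -- u := part_sub hP AP uA.
by rewrite (allv u) -(allv w) adj_irrefl in wu.
Qed.

Theorem theorem2 (T : sgraph) (hT : is_tree T) (h3 : 2 < #|T|) :
  [<-> domination_subdivision_number T 3;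
       exists! D : {set T},
         [/\ dominating D, two_packing D & leaves T \subset D];
       in_family_F T;
       exists (T' : sgraph) (P : {ffun T' -> {set {set T'}}}),
         [/\ is_tree T', nbhd_partition P & giso T (gcorona P)];
       exists T' : sgraph,
         is_tree T' /\
         obtained_by (@internal_contraction T') (two_subdivision T') T;
       exists T' : sgraph,
         is_tree T' /\
         obtained_by (@internal_splitting T') (corona1 T') T].
Proof.
have [r [par [dep [rootT one_child]]]] := leaf_rooting hT (ltnW h3).
pose corona := exists (T' : sgraph) (P : {ffun T' -> {set {set T'}}}),
  [/\ is_tree T', nbhd_partition P & giso T (gcorona P)].
have contraction_corona : (exists T' : sgraph, is_tree T' /\
    obtained_by (@internal_contraction T') (two_subdivision T') T) -> corona.
  case=> T' [treeT' [P0 [P [hP0 _ conP isoP]]]]; exists T', P; split=> //.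
  by apply: connect_invariant conP hP0 => P1 P2 _; exact: contraction_partition.
have splitting_corona : (exists T' : sgraph, is_tree T' /\
    obtained_by (@internal_splitting T') (corona1 T') T) -> corona.
  case=> T' [treeT' [P0 [P [hP0 _ conP isoP]]]]; exists T', P; split=> //.
  (* A splitting is a contraction read backwards, so [nbhd_partition] for its result is part of its
     definition. *)
  by apply: connect_invariant conP hP0 => P1 P2 _ /andP[].
have corona_code : corona -> exists D : {set T}, code D.
  by case=> T' [P [_ hP isoP]]; apply: (giso_code isoP); exact: gcorona_code.
have code_unique : (exists D : {set T}, code D) ->
    exists! D : {set T}, [/\ dominating D, two_packing D & leaves T \subset D].
  case=> D codeD; exists D; split; first exact/(codeP D h3).
  by move=> D' /(codeP D' h3); exact: (code_uniq rootT one_child codeD).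
tfae.
- by move/(dsn_code rootT one_child h3)/code_unique.
- case=> D [/(codeP D h3) codeD _].
  exact: (built_in_family rootT h3 (code_built rootT one_child codeD)).
- case=> G [l [Hl isoT]].
  have [D codeD] : exists D : {set T}, code D.
    by apply: (giso_code isoT); exists [set g | labA (l g)]; exact: family_code.
  exists (contract hT codeD), (contract_parts hT codeD); split.
  + exact: contract_tree.
  + exact: contract_partition.
  + exact: code_corona.
- case=> T' [P [treeT' hP isoP]]; exists T'; split=> //.
  have [h1 iso1] := gcorona_singletons T'.
  (* The partition into singletons refines every other one, so contractions lead from it to [P]. *)
  exists [ffun v => [set [set u] | u in nbhd v]], P; split=> //.
  apply: refine_connect => // v A; rewrite ffunE => /imsetP[u]; rewrite inE => vu ->.
  by have [B BP uB] := part_of hP vu; exists B; rewrite // sub1set.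
- move/contraction_corona=> [T' [P [treeT' hP isoP]]]; exists T'; split=> //.
  have nb (v : T') : nbhd v != set0.
    apply: (gcorona_nontrivial v treeT' hP).
    by case: isoP => f [bijf _]; rewrite -(bij_eq_card bijf) ltnW.
  have [h1 iso1] := gcorona_neighbourhoods nb.
  (* Every partition refines the one with a single part at each vertex; the contractions leading
     there are read backwards as splittings. *)
  exists [ffun v => [set nbhd v]], P; split=> //.
  apply: connect_flip; apply: refine_connect => // v A AP.
  exists (nbhd v); first by rewrite ffunE set11.
  by apply/subsetP => u uA; rewrite inE (part_sub hP AP uA).
- move/splitting_corona/corona_code=> [D codeD].
  exact: (code_dsn rootT one_child h3 codeD).
Qed.
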